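(* Let $\omega\subset\mathbb{R}^2$ be an open, bounded domain and let $\beta>0$. Let $v\in\mathcal{C}^1(\bar\omega,\mathbb{R}^3)$, $w\in\mathcal{C}^1(\bar\omega,\mathbb{R}^2)$ and $A\in\mathcal{C}^{0,\beta}(\bar\omega,\mathbb{R}^{2\times 2}_{\mathrm{sym}})$ satisfy $$A-\Big(\frac12(\nabla v)^T\nabla v+\mathrm{sym}\nabla w\Big)\ \text{ is positive definite at every point of }\bar\omega.$$ Then for every exponent $\alpha$ with $0<\alpha<\min\big\{\frac{\beta}{2},\,1-\frac{1}{\sqrt5}\big\}$ and every $\epsilon>0$ there exist $\tilde v\in\mathcal{C}^{1,\alpha}(\bar\omega,\mathbb{R}^3)$ and $\tilde w\in\mathcal{C}^{1,\alpha}(\bar\omega,\mathbb{R}^2)$ such that $$\|\tilde v-v\|_0\le\epsilon,\qquad \|\tilde w-w\|_0\le\epsilon,\qquad A-\Big(\frac12(\nabla\tilde v)^T\nabla\tilde v+\mathrm{sym}\nabla\tilde w\Big)=0\ \text{ in }\bar\omega.$$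
   Context: $\mathbb{R}^{2\times2}_{\mathrm{sym}}$ is the space of symmetric $2\times 2$ matrices; for $w:\omega\to\mathbb{R}^2$, $\mathrm{sym}\nabla w=\frac12(\nabla w+(\nabla w)^T)$; for $v:\omega\to\mathbb{R}^3$, $\nabla v$ is the $3\times 2$ Jacobian matrix. The space $\mathcal{C}^{m,\alpha}(\bar\omega,\mathbb{R}^k)$ consists of restrictions to $\bar\omega$ of fields in $\mathcal{C}^{m,\alpha}(\mathbb{R}^2,\mathbb{R}^k)$; $\|f\|_m$ denotes the $\mathcal{C}^m(\bar\omega)$ norm (so $\|\cdot\|_0$ is the supremum norm). *)

(* Defs.v *)
From Stdlib Require Import Reals.
From Coquelicot Require Import Coquelicot.
Open Scope R_scope.

Definition pt := (R * R)%type.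

Definition dist2 (p q : pt) : R :=
  sqrt ((fst p - fst q)^2 + (snd p - snd q)^2).

Definition d1 (f : pt -> R) (p : pt) : R := Derive (fun t => f (t, snd p)) (fst p).
Definition d2 (f : pt -> R) (p : pt) : R := Derive (fun t => f (fst p, t)) (snd p).

Definition is_C1 (f : pt -> R) : Prop :=
  (forall p : pt, ex_derive (fun t => f (t, snd p)) (fst p)
                  /\ ex_derive (fun t => f (fst p, t)) (snd p)) /\
  (forall p : pt, continuous (d1 f) p /\ continuous (d2 f) p).

Definition bounded_fun (f : pt -> R) : Prop :=
  exists M : R, forall p : pt, Rabs (f p) <= M.

Definition holder (a : R) (f : pt -> R) : Prop :=
  exists M : R, forall p q : pt, p <> q ->
    Rabs (f p - f q) <= M * Rpower (dist2 p q) a.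

Definition is_C0a (b : R) (f : pt -> R) : Prop :=
  bounded_fun f /\ holder b f.

Definition is_C1a (a : R) (f : pt -> R) : Prop :=
  is_C1 f /\ bounded_fun f /\ bounded_fun (d1 f) /\ bounded_fun (d2 f) /\
  holder a (d1 f) /\ holder a (d2 f).

Definition bounded_set (S : pt -> Prop) : Prop :=
  exists M : R, forall p, S p -> Rabs (fst p) <= M /\ Rabs (snd p) <= M.

Definition connected_set (S : pt -> Prop) : Prop :=
  forall U V : pt -> Prop, open U -> open V ->
    (forall p, S p -> U p \/ V p) ->
    (forall p, S p -> ~ (U p /\ V p)) ->
    (forall p, S p -> U p) \/ (forall p, S p -> V p).

Definition is_domain (S : pt -> Prop) : Prop := open S /\ connected_set S.

Definition closure2 (S : pt -> Prop) (p : pt) : Prop :=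
  forall eps : R, 0 < eps -> exists q, S q /\ dist2 p q < eps.

Definition posdef2 (a b c : R) : Prop :=
  forall x y : R, (x, y) <> (0, 0) -> 0 < a * x * x + 2 * b * x * y + c * y * y.

(** Entries of (1/2) (grad v)^T (grad v) + sym grad w, for
    v = (v1,v2,v3) : R^2 -> R^3 and w = (w1,w2) : R^2 -> R^2. *)
Definition gram (g1 g2 g3 h1 h2 h3 : R) : R := g1 * h1 + g2 * h2 + g3 * h3.

Definition E11 (v1 v2 v3 w1 w2 : pt -> R) (p : pt) : R :=
  / 2 * gram (d1 v1 p) (d1 v2 p) (d1 v3 p) (d1 v1 p) (d1 v2 p) (d1 v3 p) + d1 w1 p.
Definition E12 (v1 v2 v3 w1 w2 : pt -> R) (p : pt) : R :=
  / 2 * gram (d1 v1 p) (d1 v2 p) (d1 v3 p) (d2 v1 p) (d2 v2 p) (d2 v3 p)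
  + / 2 * (d2 w1 p + d1 w2 p).
Definition E22 (v1 v2 v3 w1 w2 : pt -> R) (p : pt) : R :=
  / 2 * gram (d2 v1 p) (d2 v2 p) (d2 v3 p) (d2 v1 p) (d2 v2 p) (d2 v3 p) + d2 w2 p.

(* Main.v *)
Require Import Defs.
From Stdlib Require Import Reals Lra Lia ZArith FunctionalExtensionality IndefiniteDescription Classical.
From Coquelicot Require Import Coquelicot.
Open Scope R_scope.
Set Bullet Behavior "Strict Subproofs".

(** Convex integration, each stage of which reaches an arbitrary power of the frequency ratio.

    Suppose that the defect is [d * (h0 + small)], where [h0] is the mean of [1/2 DP^T DP] for the corrugation
    [P = (sin x1, sin x2, cos (x1 + x2))].  After smoothing [v], [w] and [A] at a scale [l] (the quadratic
    commutator is again a smooth field and causes no loss) one perturbs by two-scale trigonometric polynomials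
    of frequency [lam], with coefficients varying at scale [l].  Choosing [w' = w + W - P grad v] turns the
    cross terms into [P . D^2 v], so that every residual is removed, up to a factor [1 / (l lam)], by solving
    on the torus the linearised equation [sym (DP^T Du) + sym DW = F].

    This equation is solvable for every trigonometric polynomial [F]: modulo its range one may drop
    [sin x1 f e1e1], [sin x2 f e2e2] and [cos (x1 + x2) f (e1 + e2)(e1 + e2)].  The first two and symmetric
    gradients leave only the values of curl curl [F] at [sin x1 = sin x2 = 0], where the third profile does not vanish.

    Taking enough correction steps, the defect decays like [r ^ 9] per stage while the second derivatives
    grow at most like [r ^ -3] (or any larger power), hence every Hölder exponent below
    [min (beta / 2, 3 / 5)] is reached, and [1 - 1 / sqrt 5 < 3 / 5].  The first defect is brought to the form
    [d * h0] by finitely many one-dimensional corrugations of high frequency. *)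

(** * Partial derivatives *)

(** The exponents: with [lam = 1 / (l r)] and amplitude [sqrt d / lam], new second derivatives have
    size [C M / r ^ 2], and a third power of [1 / r] absorbs [C]. If defects decay like [r ^ n] and
    second derivatives grow like [r ^ -3], interpolation reaches every exponent below [n / (n + 6)];
    [n = 9] gives [3 / 5]. The new defect may differ from [r ^ 9 d h0] by [r ^ 10 d], and one more
    power of [r] must absorb constants: this is the order 11 reached by ten corrections. Each
    correction differentiates the slow coefficients once and two derivatives must survive, hence
    twelve means in [Sn 12]. The obstacle is uniformity: [r] is chosen once for all stages.
    Therefore the cell problem is solved for a whole family of data with one constant. The threshold
    for [r] still depends on a bound [V] of [grad v], which grows along the iteration; the circle is
    broken because the increments of [grad v] are [Cu sqrt d] with [Cu] independent of [V], hence
    summable to a bound known beforehand. *)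

(* Booleans index the two coordinates: [true] is x1, [false] is x2. *)
Definition crd (b : bool) (p : pt) : R := if b then fst p else snd p.
Definition upd (b : bool) (p : pt) (t : R) : pt := if b then (t, snd p) else (fst p, t).
Definition pd (b : bool) (f : pt -> R) : pt -> R :=
  fun p => Derive (fun t => f (upd b p t)) (crd b p).
Definition exd (b : bool) (f : pt -> R) : Prop :=
  forall p, ex_derive (fun t => f (upd b p t)) (crd b p).
Definition cont (f : pt -> R) : Prop := forall p : pt, continuous f p.

Lemma upd_crd b p : upd b p (crd b p) = p.
Proof. destruct b, p; reflexivity. Qed.
Lemma crd_upd b p t : crd b (upd b p t) = t.
Proof. destruct b; reflexivity. Qed.
Lemma upd_upd b p t s : upd b (upd b p t) s = upd b p s.
Proof. destruct b; reflexivity. Qed.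

(** Existence and value are always obtained together, and the value as an equality of functions, so
    that it can be rewritten under further derivatives. *)
Lemma pd_is_derive b f g :
  (forall p, is_derive (fun t => f (upd b p t)) (crd b p) (g p)) -> exd b f /\ pd b f = g.
Proof.
  intros H; split.
  - intros p; eexists; apply H.
  - apply functional_extensionality; intros p; apply is_derive_unique, H.
Qed.

Lemma is_derive_pd b f : exd b f ->
  forall p t, is_derive (fun t => f (upd b p t)) t (pd b f (upd b p t)).
Proof.
  intros H p t. unfold pd. rewrite crd_upd.
  apply (is_derive_ext (fun s => f (upd b (upd b p t) s))).
  - intros s; rewrite upd_upd; reflexivity.
  - apply Derive_correct. specialize (H (upd b p t)). rewrite crd_upd in H. exact H.
Qed.

Lemma is_derive_pd_at b f p : exd b f ->
  is_derive (fun t => f (upd b p t)) (crd b p) (pd b f p).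
Proof.
  intros H. generalize (is_derive_pd b f H p (crd b p)). rewrite upd_crd. auto.
Qed.

Lemma exd_plus b f g : exd b f -> exd b g ->
  exd b (fun p => f p + g p) /\ pd b (fun p => f p + g p) = (fun p => pd b f p + pd b g p).
Proof.
  intros Hf Hg. apply pd_is_derive. intros p.
  apply (is_derive_plus (fun t => f (upd b p t)) (fun t => g (upd b p t)));
    apply is_derive_pd_at; auto.
Qed.

Lemma exd_mult b f g : exd b f -> exd b g ->
  exd b (fun p => f p * g p) /\
  pd b (fun p => f p * g p) = (fun p => pd b f p * g p + f p * pd b g p).
Proof.
  intros Hf Hg. apply pd_is_derive. intros p.
  generalize (is_derive_mult (fun t => f (upd b p t)) (fun t => g (upd b p t)) (crd b p) _ _
     (is_derive_pd_at b f p Hf) (is_derive_pd_at b g p Hg) Rmult_comm).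
  rewrite upd_crd. unfold plus, mult; simpl. auto.
Qed.

Lemma exd_const b c : exd b (fun _ => c) /\ pd b (fun _ => c) = (fun _ => 0).
Proof. apply pd_is_derive. intros p. apply (is_derive_const (V := R_NormedModule)). Qed.

Lemma exd_scal b c f : exd b f ->
  exd b (fun p => c * f p) /\ pd b (fun p => c * f p) = (fun p => c * pd b f p).
Proof.
  intros Hf. apply pd_is_derive. intros p.
  apply (is_derive_scal (fun t => f (upd b p t))). apply is_derive_pd_at; auto.
Qed.

Lemma exd_minus b f g : exd b f -> exd b g ->
  exd b (fun p => f p - g p) /\ pd b (fun p => f p - g p) = (fun p => pd b f p - pd b g p).
Proof.
  intros Hf Hg. apply pd_is_derive. intros p.
  apply (is_derive_minus (fun t => f (upd b p t)) (fun t => g (upd b p t)));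
    apply is_derive_pd_at; auto.
Qed.

Lemma cont_plus f g : cont f -> cont g -> cont (fun p => f p + g p).
Proof. intros Hf Hg p. apply (continuous_plus (V := R_NormedModule)); auto. Qed.
Lemma cont_minus f g : cont f -> cont g -> cont (fun p => f p - g p).
Proof. intros Hf Hg p. apply (continuous_minus (V := R_NormedModule)); auto. Qed.
Lemma cont_mult f g : cont f -> cont g -> cont (fun p => f p * g p).
Proof. intros Hf Hg p. apply (continuous_mult (K := R_AbsRing)); auto. Qed.
Lemma cont_const c : cont (fun _ => c).
Proof. intros p. apply continuous_const. Qed.
Lemma cont_scal c f : cont f -> cont (fun p => c * f p).
Proof. intros. apply cont_mult; auto using cont_const. Qed.
Lemma cont_crd b : cont (crd b).
Proof. intros [x y]; destruct b; [apply (continuous_fst x y) | apply (continuous_snd x y)]. Qed.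

(** Mixed partials are counted in every order and never interchanged; this is why second derivatives
    are symmetrised in [EE_update]. *)
Fixpoint sm (n : nat) (f : pt -> R) : Prop :=
  cont f /\ match n with O => True | S m => forall b, exd b f /\ sm m (pd b f) end.

(* All partial derivatives of order [j <= n] are bounded by [B * r ^ j] at [p]. *)
Fixpoint bdp (n : nat) (r B : R) (f : pt -> R) (p : pt) : Prop :=
  Rabs (f p) <= B /\
  match n with O => True | S m => forall b, bdp m r (r * B) (pd b f) p end.

Lemma sm_cont n f : sm n f -> cont f.
Proof. destruct n; simpl; tauto. Qed.
Lemma sm_exd n f b : sm (S n) f -> exd b f.
Proof. intros [_ H]; apply H. Qed.
Lemma sm_pd n f b : sm (S n) f -> sm n (pd b f).
Proof. intros [_ H]; apply H. Qed.
Lemma sm_S n f : sm (S n) f -> sm n f.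
Proof.
  revert f; induction n as [|n IH]; intros f [Hc H].
  - split; auto.
  - split; auto. intros b. destruct (H b); auto.
Qed.
Lemma sm_le m n f : (m <= n)%nat -> sm n f -> sm m f.
Proof. induction 1; auto using sm_S. Qed.

Lemma sm_plus n f g : sm n f -> sm n g -> sm n (fun p => f p + g p).
Proof.
  revert f g; induction n as [|n IH]; intros f g [Hf Hf'] [Hg Hg']; split; auto using cont_plus.
  intros b. destruct (Hf' b) as [A1 A2], (Hg' b) as [B1 B2], (exd_plus b f g A1 B1) as [E ->].
  auto.
Qed.
Lemma sm_minus n f g : sm n f -> sm n g -> sm n (fun p => f p - g p).
Proof.
  revert f g; induction n as [|n IH]; intros f g [Hf Hf'] [Hg Hg']; split; auto using cont_minus.
  intros b. destruct (Hf' b) as [A1 A2], (Hg' b) as [B1 B2], (exd_minus b f g A1 B1) as [E ->].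
  auto.
Qed.
Lemma sm_const n c : sm n (fun _ => c).
Proof.
  revert c; induction n as [|n IH]; intros c; split; auto using cont_const.
  intros b. destruct (exd_const b c) as [E ->]. auto.
Qed.
Lemma sm_mult n f g : sm n f -> sm n g -> sm n (fun p => f p * g p).
Proof.
  revert f g; induction n as [|n IH]; intros f g Hf Hg.
  - destruct Hf, Hg; split; auto using cont_mult.
  - split; [apply cont_mult; eapply sm_cont; eauto|].
    intros b. destruct (exd_mult b f g (sm_exd _ _ b Hf) (sm_exd _ _ b Hg)) as [E ->].
    split; auto. apply sm_plus; apply IH; auto using sm_S, sm_pd.
Qed.
Lemma sm_scal n c f : sm n f -> sm n (fun p => c * f p).
Proof. intros; apply sm_mult; auto using sm_const. Qed.

Lemma bdp_abs n r B f p : bdp n r B f p -> Rabs (f p) <= B.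
Proof. destruct n; simpl; tauto. Qed.
Lemma bdp_pd n r B f p b : bdp (S n) r B f p -> bdp n r (r * B) (pd b f) p.
Proof. intros [_ H]; apply H. Qed.
Lemma bdp_le n r B B' f p : 0 <= r -> B <= B' -> bdp n r B f p -> bdp n r B' f p.
Proof.
  revert B B' f; induction n as [|n IH]; intros B B' f Hr HB [H H']; split; auto; try lra.
  intros b. apply (IH (r * B)); auto. apply Rmult_le_compat_l; auto.
Qed.
Lemma bdp_S n r B f p : bdp (S n) r B f p -> bdp n r B f p.
Proof.
  revert B f; induction n as [|n IH]; intros B f [H H']; split; auto.
Qed.
Lemma bdp_le_n m n r B f p : (m <= n)%nat -> bdp n r B f p -> bdp m r B f p.
Proof. induction 1; auto using bdp_S. Qed.
Lemma bdp_r n r r' B f p : 0 <= r <= r' -> bdp n r B f p -> bdp n r' B f p.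
Proof.
  revert B f; induction n as [|n IH]; intros B f Hr [H H']; split; auto.
  intros b. apply (bdp_le _ _ (r * B)); [lra | | apply IH; auto].
  apply Rmult_le_compat_r; [|lra]. eapply Rle_trans; [apply Rabs_pos | exact H].
Qed.
Lemma bdp_one n r B f p : 1 <= r -> bdp n r B f p -> bdp n 1 (B * r ^ n) f p.
Proof.
  intros Hr. revert B f; induction n as [|n IH]; intros B f [H H'].
  - split; auto. simpl; lra.
  - assert (HB : 0 <= B) by (eapply Rle_trans; [apply Rabs_pos | exact H]).
    split.
    + eapply Rle_trans; [exact H|]. rewrite <- (Rmult_1_r B) at 1.
      apply Rmult_le_compat_l; auto. apply pow_R1_Rle; auto.
    + intros b. apply (bdp_le _ _ (r * B * r ^ n)); [lra | simpl; lra | apply IH, H'].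
Qed.

Lemma bdp_plus n r B B' f g p : sm n f -> sm n g ->
  bdp n r B f p -> bdp n r B' g p -> bdp n r (B + B') (fun p => f p + g p) p.
Proof.
  revert B B' f g; induction n as [|n IH]; intros B B' f g Sf Sg [Hf Hf'] [Hg Hg'].
  - split; auto. eapply Rle_trans; [apply Rabs_triang | lra].
  - split; [eapply Rle_trans; [apply Rabs_triang | lra]|].
    intros b. destruct (exd_plus b f g (sm_exd _ _ b Sf) (sm_exd _ _ b Sg)) as [_ ->].
    rewrite Rmult_plus_distr_l. apply IH; auto using sm_pd.
Qed.
Lemma bdp_const n r c p : 0 <= r -> bdp n r (Rabs c) (fun _ => c) p.
Proof.
  intros Hr. revert c; induction n as [|n IH]; intros c; split; auto using Rle_refl.
  intros b. destruct (exd_const b c) as [_ ->].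
  apply (bdp_le _ _ (Rabs 0)); auto.
  rewrite Rabs_R0. apply Rmult_le_pos; auto using Rabs_pos.
Qed.
(** Each derivative doubles the number of Leibniz terms, and all of them carry the same power of
    [r]; hence the factor [2 ^ n]. *)
Lemma bdp_mult n r B B' f g p : 0 <= r -> sm n f -> sm n g ->
  bdp n r B f p -> bdp n r B' g p -> bdp n r (2 ^ n * (B * B')) (fun p => f p * g p) p.
Proof.
  intros Hr. revert B B' f g; induction n as [|n IH]; intros B B' f g Sf Sg Hf Hg;
    assert (HB : Rabs (f p * g p) <= B * B')
      by (rewrite Rabs_mult; apply Rmult_le_compat;
          eauto using Rabs_pos, bdp_abs);
    assert (HB0 : 0 <= B * B') by (eapply Rle_trans; [apply Rabs_pos | exact HB]).
  - split; auto. simpl; lra.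
  - split.
    + eapply Rle_trans; [exact HB|]. rewrite <- (Rmult_1_l (B * B')) at 1.
      apply Rmult_le_compat_r; auto. apply pow_R1_Rle; lra.
    + intros b. destruct (exd_mult b f g (sm_exd _ _ b Sf) (sm_exd _ _ b Sg)) as [_ ->].
      replace (r * (2 ^ S n * (B * B')))
        with (2 ^ n * (r * B * B') + 2 ^ n * (B * (r * B'))) by (simpl; ring).
      apply bdp_plus.
      * apply sm_mult; auto using sm_pd, sm_S.
      * apply sm_mult; auto using sm_pd, sm_S.
      * apply IH; auto using sm_pd, sm_S, bdp_pd, bdp_S.
      * apply IH; auto using sm_pd, sm_S, bdp_pd, bdp_S.
Qed.
Lemma bdp_scal n r B c f p : sm n f ->
  bdp n r B f p -> bdp n r (Rabs c * B) (fun p => c * f p) p.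
Proof.
  revert B f; induction n as [|n IH]; intros B f Sf [Hf Hf'].
  - split; auto. rewrite Rabs_mult. apply Rmult_le_compat_l; auto using Rabs_pos.
  - split; [rewrite Rabs_mult; apply Rmult_le_compat_l; auto using Rabs_pos|].
    intros b. destruct (exd_scal b c f (sm_exd _ _ b Sf)) as [_ ->].
    replace (r * (Rabs c * B)) with (Rabs c * (r * B)) by ring. apply IH; auto using sm_pd.
Qed.

(** With [l = lam] this creates the fast oscillation; with [l = / lam] it expresses slow data in the
    variable of the cell. Both occur in [stage]. *)
Definition scl (l : R) (f : pt -> R) : pt -> R := fun p => f (l * fst p, l * snd p).

Lemma exd_scl b l f : exd b f ->
  exd b (scl l f) /\ pd b (scl l f) = (fun p => l * scl l (pd b f) p).
Proof.
  intros Hf. apply pd_is_derive. intros p.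
  set (q := (l * fst p, l * snd p)).
  apply (is_derive_ext (fun t => (fun s => f (upd b q s)) (l * t))).
  { intros t. unfold scl, q. destruct b; reflexivity. }
  assert (Hl : is_derive (fun t : R => l * t) (crd b p) l).
  { auto_derive; auto; ring. }
  apply (is_derive_comp (fun s => f (upd b q s)) (fun t => l * t) (crd b p) (pd b f q) l); auto.
  replace (l * crd b p) with (crd b q) by (destruct b; reflexivity).
  apply is_derive_pd_at; auto.
Qed.

Lemma cont_scl l f : cont f -> cont (scl l f).
Proof.
  intros Hf p. unfold scl.
  apply (continuous_comp_2 (fun p : pt => l * fst p) (fun p : pt => l * snd p) (fun x y => f (x, y))).
  - apply (cont_scal l (crd true)), cont_crd.
  - apply (cont_scal l (crd false)), cont_crd.
  - apply (continuous_ext f); [intros [x y]; reflexivity | apply Hf].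
Qed.

Lemma sm_scl n l f : sm n f -> sm n (scl l f).
Proof.
  revert f; induction n as [|n IH]; intros f [Hc H]; split; auto using cont_scl.
  intros b. destruct (H b) as [E H'], (exd_scl b l f E) as [E' ->]. split; auto.
  apply sm_scal, IH, H'.
Qed.

Lemma bdp_scl n l r B f p : 0 <= l -> sm n f ->
  bdp n r B f (l * fst p, l * snd p) -> bdp n (l * r) B (scl l f) p.
Proof.
  intros Hl. revert B f; induction n as [|n IH]; intros B f Sf [H H']; split; auto.
  intros b. destruct (exd_scl b l f (sm_exd _ _ b Sf)) as [_ ->].
  rewrite <- (Rabs_pos_eq l Hl) at 2. rewrite Rmult_assoc.
  apply bdp_scal; [apply sm_scl, sm_pd, Sf |]. apply IH; auto using sm_pd.
Qed.

Definition dd1 (p q : pt) : R := Rabs (fst q - fst p) + Rabs (snd q - snd p).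

Lemma MVT_pd b f p t B : exd b f -> (forall s, Rmin (crd b p) t <= s <= Rmax (crd b p) t ->
    Rabs (pd b f (upd b p s)) <= B) ->
  Rabs (f (upd b p t) - f p) <= B * Rabs (t - crd b p).
Proof.
  intros Hf HB.
  destruct (MVT_gen (fun t => f (upd b p t)) (crd b p) t (fun t => pd b f (upd b p t)))
    as (c & Hc & E).
  - intros x _. apply is_derive_pd; auto.
  - intros x _. apply continuity_pt_filterlim.
    apply (ex_derive_continuous (fun t => f (upd b p t))).
    eexists; apply is_derive_pd; auto.
  - rewrite upd_crd in E. rewrite E, Rabs_mult. apply Rmult_le_compat_r; auto using Rabs_pos.
Qed.

(** The points are joined by a horizontal and a vertical segment, so only one-variable mean values
    occur and the natural distance is the l1 one. Bounds on the rectangle suffice, which is all that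
    [C1_cont] has. *)
Lemma lipschitz_box f p q B : (forall b, exd b f) ->
  (forall x, Rmin (fst p) (fst q) <= fst x <= Rmax (fst p) (fst q) ->
     Rmin (snd p) (snd q) <= snd x <= Rmax (snd p) (snd q) ->
     forall b, Rabs (pd b f x) <= B) ->
  Rabs (f q - f p) <= B * dd1 p q.
Proof.
  intros Hf HB. unfold dd1. set (m := upd true p (fst q)).
  assert (H1 : Rabs (f m - f p) <= B * Rabs (fst q - fst p)).
  { apply (MVT_pd true); auto. intros s Hs. apply HB; auto. simpl.
    split; [apply Rmin_l | apply Rmax_l]. }
  assert (H2 : Rabs (f q - f m) <= B * Rabs (snd q - snd p)).
  { replace q with (upd false m (snd q)) at 1 by (destruct q; reflexivity).
    apply (MVT_pd false f m); auto. intros s Hs. apply HB; auto. simpl.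
    split; [apply Rmin_r | apply Rmax_r]. }
  replace (f q - f p) with ((f q - f m) + (f m - f p)) by ring.
  eapply Rle_trans; [apply Rabs_triang | lra].
Qed.

Lemma lipschitz f B : (forall b, exd b f) -> (forall b x, Rabs (pd b f x) <= B) ->
  forall p q, Rabs (f q - f p) <= B * dd1 p q.
Proof. intros; apply lipschitz_box; auto. Qed.

(** * Steklov means *)

Definition box (p : pt) (r : R) (q : pt) : Prop :=
  Rabs (fst q - fst p) <= r /\ Rabs (snd q - snd p) <= r.

Lemma continuous_eps (f : pt -> R) (p : pt) : continuous f p <->
  forall eps, 0 < eps -> exists d, 0 < d /\
    forall q : pt, Rabs (fst q - fst p) < d -> Rabs (snd q - snd p) < d -> Rabs (f q - f p) < eps.
Proof.
  split.
  - intros H eps He.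
    destruct (H (fun y => Rabs (y - f p) < eps)) as [d Hd].
    { exists (mkposreal eps He). intros y Hy. exact Hy. }
    exists d; split; [apply d|]. intros q H1 H2. apply Hd. split; assumption.
  - intros H P [e He]. destruct (H e (cond_pos e)) as (d & Hd & Hq).
    exists (mkposreal d Hd). intros q [H1 H2]. apply He. apply Hq; assumption.
Qed.

Lemma heine f r eps : cont f -> 0 < eps -> exists d, 0 < d /\
  forall p q, Rabs (fst p) <= r -> Rabs (snd p) <= r -> Rabs (fst q) <= r -> Rabs (snd q) <= r ->
    Rabs (fst q - fst p) < d -> Rabs (snd q - snd p) < d -> Rabs (f q - f p) < eps.
Proof.
  intros Hf He.
  destruct (uniform_continuity_2d (fun x y => f (x, y)) (-r) r (-r) r) with (eps := mkposreal eps He)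
    as [d Hd].
  - intros x y _ _. apply continuity_2d_pt_filterlim.
    apply (filterlim_ext f); [intros [? ?]; reflexivity|]. apply Hf.
  - exists d; split; [apply d|]. intros [x y] [u v]; simpl; intros.
    apply Hd; auto; apply Rabs_le_between; assumption.
Qed.

Definition sh (b : bool) (p : pt) (t : R) : pt := upd b p (crd b p + t).
(** A Steklov mean plays the part of a mollifier: its derivative is a difference quotient, so one
    mean gains one derivative at the price of a factor [/ h], with explicit constants. *)
Definition stk (b : bool) (h : R) (f : pt -> R) : pt -> R :=
  fun p => / (2 * h) * RInt (fun t => f (sh b p t)) (- h) h.

Lemma cont_sh f b p : cont f -> forall t, continuous (fun t => f (sh b p t)) t.
Proof.
  intros Hf t P [e He]. destruct (proj1 (continuous_eps f (sh b p t)) (Hf _) e (cond_pos e)) as (d & Hd & Hq).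
  exists (mkposreal d Hd). intros s Hs. apply He. apply Hq.
  all: unfold sh; destruct b; simpl; try (rewrite Rminus_diag, Rabs_R0; assumption).
  all: match goal with |- Rabs ?x < _ => replace x with (s - t) by ring end; exact Hs.
Qed.

Lemma ex_RInt_sh f b p a c : cont f -> ex_RInt (fun t => f (sh b p t)) a c.
Proof. intros. apply (ex_RInt_continuous (V := R_CompleteNormedModule)). intros; apply cont_sh; auto. Qed.

Lemma stk_bound b h f p B : 0 < h -> cont f ->
  (forall t, Rabs t <= h -> Rabs (f (sh b p t)) <= B) -> Rabs (stk b h f p) <= B.
Proof.
  intros Hh Hf HB. unfold stk. rewrite Rabs_mult, Rabs_pos_eq by (left; apply Rinv_0_lt_compat; lra).
  assert (H : Rabs (RInt (fun t => f (sh b p t)) (- h) h) <= (h - - h) * B).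
  { apply abs_RInt_le_const; [lra | apply ex_RInt_sh; auto |].
    intros t Ht. apply HB. apply Rabs_le; lra. }
  apply (Rmult_le_reg_l (2 * h)); [lra|]. rewrite <- Rmult_assoc, Rinv_r by lra. lra.
Qed.

Lemma stk_lin b h a c f g p : 0 < h -> cont f -> cont g ->
  stk b h (fun p => a * f p + c * g p) p = a * stk b h f p + c * stk b h g p.
Proof.
  intros Hh Hf Hg. unfold stk.
  rewrite (RInt_plus (V := R_CompleteNormedModule) (fun t => a * f (sh b p t)) (fun t => c * g (sh b p t))).
  2,3: apply (ex_RInt_scal (V := R_CompleteNormedModule)); apply ex_RInt_sh; auto.
  rewrite (RInt_scal (V := R_CompleteNormedModule) (fun t => f (sh b p t))) by (apply ex_RInt_sh; auto).
  rewrite (RInt_scal (V := R_CompleteNormedModule) (fun t => g (sh b p t))) by (apply ex_RInt_sh; auto).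
  unfold scal, plus; simpl; unfold mult; simpl. ring.
Qed.

Lemma stk_const b h c : 0 < h -> stk b h (fun _ => c) = (fun _ => c).
Proof.
  intros Hh. apply functional_extensionality; intros p. unfold stk.
  rewrite RInt_const. unfold scal; simpl; unfold mult; simpl. field; lra.
Qed.

Lemma cont_stk b h f : 0 < h -> cont f -> cont (stk b h f).
Proof.
  intros Hh Hf p. apply continuous_eps. intros eps He.
  destruct (heine f (Rabs (fst p) + Rabs (snd p) + h + 1) (eps / 2) Hf) as (d & Hd & HU); [lra|].
  exists (Rmin d 1); split; [apply Rmin_pos; lra|]. intros q H1 H2.
  assert (H1' := Rlt_le_trans _ _ _ H1 (Rmin_l _ _)). assert (H2' := Rlt_le_trans _ _ _ H2 (Rmin_l _ _)).
  assert (H1'' := Rlt_le_trans _ _ _ H1 (Rmin_r _ _)). assert (H2'' := Rlt_le_trans _ _ _ H2 (Rmin_r _ _)).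
  apply Rle_lt_trans with (eps / 2); [|lra].
  unfold stk. rewrite <- Rmult_minus_distr_l, Rabs_mult, Rabs_pos_eq by (left; apply Rinv_0_lt_compat; lra).
  rewrite <- (RInt_minus (V := R_CompleteNormedModule)) by (apply ex_RInt_sh; auto).
  assert (H : Rabs (RInt (fun t => minus (f (sh b q t)) (f (sh b p t))) (- h) h) <= (h - - h) * (eps / 2)).
  { apply abs_RInt_le_const; [lra | apply (ex_RInt_minus (V := R_CompleteNormedModule)); apply ex_RInt_sh; auto |].
    intros t Ht. left. change (minus (f (sh b q t)) (f (sh b p t))) with (f (sh b q t) - f (sh b p t)).
    assert (Rabs t <= h) by (apply Rabs_le; lra).
    assert (Hq1 : Rabs (fst q) < Rabs (fst p) + 1)
      by (replace (fst q) with (fst p + (fst q - fst p)) by ring; eapply Rle_lt_trans; [apply Rabs_triang | lra]).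
    assert (Hq2 : Rabs (snd q) < Rabs (snd p) + 1)
      by (replace (snd q) with (snd p + (snd q - snd p)) by ring; eapply Rle_lt_trans; [apply Rabs_triang | lra]).
    assert (P1 := Rabs_pos (fst p)). assert (P2 := Rabs_pos (snd p)).
    assert (T := Rabs_triang).
    apply HU; unfold sh; destruct b; simpl; try (eapply Rle_trans; [apply T|]; lra); try lra.
    all: match goal with |- Rabs (?a + ?u - (?b + ?u)) < _ => replace (a + u - (b + u)) with (a - b) by ring end; auto. }
  apply (Rmult_le_reg_l (2 * h)); [lra|]. rewrite <- Rmult_assoc, Rinv_r, Rmult_1_l by lra. eapply Rle_trans; [exact H | lra].
Qed.

Lemma is_derive_sh b b' f p t u : exd b' f ->
  is_derive (fun u => f (sh b (upd b' p u) t)) u (pd b' f (sh b (upd b' p u) t)).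
Proof.
  intros Hf. destruct (Bool.bool_dec b b') as [<-|Hb].
  - apply (is_derive_ext (fun u => f (upd b p (u + t)))).
    { intros s. unfold sh. rewrite upd_upd, crd_upd. reflexivity. }
    unfold sh. rewrite upd_upd, crd_upd.
    assert (Hl : is_derive (fun u => u + t) u 1) by (auto_derive; auto; ring).
    generalize (is_derive_comp (fun s => f (upd b p s)) (fun u => u + t) u _ 1 (is_derive_pd b f Hf p (u + t)) Hl).
    rewrite (scal_one (V := R_NormedModule)). auto.
  - apply (is_derive_ext (fun u0 : R => f (upd b' (sh b p t) u0))).
    { intros s; destruct b, b'; try congruence; reflexivity. }
    replace (sh b (upd b' p u) t) with (upd b' (sh b p t) u)
      by (destruct b, b'; try congruence; reflexivity).
    apply is_derive_pd; auto.
Qed.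

Lemma stk_pd b b' h f : 0 < h -> cont f -> exd b' f -> cont (pd b' f) ->
  exd b' (stk b h f) /\ pd b' (stk b h f) = stk b h (pd b' f).
Proof.
  intros Hh Hf He Hc. apply pd_is_derive. intros p. unfold stk.
  apply (is_derive_scal (fun u => RInt (fun t => f (sh b (upd b' p u) t)) (- h) h)).
  assert (HD : forall u t, Derive (fun z => f (sh b (upd b' p z) t)) u = pd b' f (sh b (upd b' p u) t))
    by (intros; apply is_derive_unique, is_derive_sh, He).
  replace (RInt (fun t => pd b' f (sh b p t)) (- h) h)
    with (RInt (fun t => Derive (fun u => f (sh b (upd b' p u) t)) (crd b' p)) (- h) h).
  2:{ apply RInt_ext. intros t _. rewrite HD, upd_crd. reflexivity. }
  apply (is_derive_RInt_param (fun u t => f (sh b (upd b' p u) t))).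
  - apply filter_forall. intros u t _. eexists; apply is_derive_sh, He.
  - intros t _. apply (continuity_2d_pt_ext (fun u v => pd b' f (sh b (upd b' p u) v))).
    { intros; symmetry; apply HD. }
    apply continuity_2d_pt_filterlim. intros P [e HP].
    destruct (proj1 (continuous_eps (pd b' f) (sh b (upd b' p (crd b' p)) t)) (Hc _) e (cond_pos e)) as (d & Hd & Hq).
    assert (Hd2 : 0 < d / 2) by lra.
    exists (mkposreal _ Hd2). intros [u v] [Hu Hv]. apply HP. apply Hq.
    all: unfold ball in Hu, Hv; simpl in *; unfold AbsRing_ball, abs, minus, plus, opp in Hu, Hv; simpl in *.
    all: unfold sh; destruct b, b'; simpl in *.
    all: try match goal with |- Rabs (?x - ?x) < _ => rewrite Rminus_diag, Rabs_R0; assumption end.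
    all: try match type of Hu with Rabs (?u + - ?x) < _ => match goal with |- Rabs (u - x) < _ =>
           unfold Rminus; lra end end.
    all: match goal with |- Rabs (?a + ?b - (?c + ?d)) < _ =>
      replace (a + b - (c + d)) with ((a + - c) + (b + - d)) by ring end.
    all: eapply Rle_lt_trans; [apply Rabs_triang|].
    all: try match goal with |- Rabs (?a + - ?a) + _ < _ => rewrite Rplus_opp_r, Rabs_R0; lra end.
    all: lra.
  - apply filter_forall. intros u. apply ex_RInt_sh; auto.
Qed.

(** After the shift [t + u] the integral is a difference of two values of one primitive of [f] along
    the line; continuity of [f] is then enough. *)
Lemma stk_gain b h f : 0 < h -> cont f ->
  exd b (stk b h f) /\
  pd b (stk b h f) = (fun p => / (2 * h) * (f (sh b p h) - f (sh b p (- h)))).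
Proof.
  intros Hh Hf. apply pd_is_derive. intros p. unfold stk.
  apply (is_derive_scal (fun u => RInt (fun t => f (sh b (upd b p u) t)) (- h) h)).
  set (g := fun s => f (upd b p s)).
  assert (Hg : forall s, continuous g s).
  { intros s. apply (continuous_ext (fun s => f (sh b (upd b p 0) s))).
    - intros x. unfold sh. rewrite upd_upd, crd_upd, Rplus_0_l. reflexivity.
    - apply cont_sh; auto. }
  assert (Hi : forall a b, ex_RInt g a b)
    by (intros; apply (ex_RInt_continuous (V := R_CompleteNormedModule)); auto).
  apply (is_derive_ext (fun u => RInt g 0 (u + h) - RInt g 0 (u + - h))).
  { intros u.
    replace (RInt (fun t => f (sh b (upd b p u) t)) (- h) h)
      with (RInt (fun y => scal 1 (g (1 * y + u))) (-h) h).
    2:{ apply RInt_ext. intros x _. rewrite (scal_one (V := R_NormedModule)).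
        unfold g, sh. rewrite upd_upd, crd_upd. f_equal; f_equal; ring. }
    rewrite (RInt_comp_lin (V := R_CompleteNormedModule) g 1 u) by auto.
    replace (1 * - h + u) with (u + - h) by ring. replace (1 * h + u) with (u + h) by ring.
    generalize (RInt_Chasles (V := R_CompleteNormedModule) g 0 (u + - h) (u + h) (Hi _ _) (Hi _ _)).
    unfold plus; simpl. intros <-. ring. }
  assert (HD : forall a, is_derive (fun u => RInt g 0 (u + a)) (crd b p) (g (crd b p + a))).
  { intros a.
    assert (Hl : is_derive (fun u => u + a) (crd b p) 1) by (auto_derive; auto; ring).
    assert (Hr : is_derive (fun x => RInt g 0 x) (crd b p + a) (g (crd b p + a))).
    { apply (is_derive_RInt g (fun x => RInt g 0 x) 0); auto.
      apply filter_forall. intros x. apply (RInt_correct (V := R_CompleteNormedModule)); auto. }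
    generalize (is_derive_comp (fun x => RInt g 0 x) (fun u => u + a) (crd b p) _ 1 Hr Hl).
    rewrite (scal_one (V := R_NormedModule)). auto. }
  apply (is_derive_minus (fun u => RInt g 0 (u + h)) (fun u => RInt g 0 (u + - h))); apply HD.
Qed.

Lemma sm_sh n b t f : sm n f -> sm n (fun p => f (sh b p t)).
Proof.
  revert f; induction n as [|n IH]; intros f [Hc H].
  - split; auto. intros p. apply continuous_eps. intros e He.
    destruct (proj1 (continuous_eps f (sh b p t)) (Hc _) e He) as (d & Hd & Hq).
    exists d; split; auto. intros q H1 H2. apply Hq; unfold sh; destruct b; simpl; auto.
    all: match goal with |- Rabs (?a + ?u - (?b + ?u)) < _ => replace (a + u - (b + u)) with (a - b) by ring end; auto.
  - assert (E : forall b', exd b' (fun p => f (sh b p t)) /\ pd b' (fun p => f (sh b p t)) = (fun p => pd b' f (sh b p t))).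
    { intros b'. apply pd_is_derive. intros p. 
      replace (pd b' f (sh b p t)) with (pd b' f (sh b (upd b' p (crd b' p)) t)) by (rewrite upd_crd; auto).
      apply is_derive_sh, H. }
    split.
    + apply (sm_cont n), IH, sm_S. split; auto.
    + intros b'. destruct (E b') as [E1 ->]. split; auto. apply IH, H.
Qed.

Lemma sm_stk n b h f : 0 < h -> sm n f -> sm n (stk b h f).
Proof.
  intros Hh. revert f; induction n as [|n IH]; intros f [Hc H]; split; auto using cont_stk.
  intros b'. destruct (H b') as [E S]. destruct (stk_pd b b' h f) as [E' ->]; eauto using sm_cont.
Qed.

Definition stk2 (h : R) (f : pt -> R) : pt -> R := stk true h (stk false h f).
(** The index counts the derivatives gained. The innermost mean is split off first, so that [Sn_bdp]
    can let a derivative consume it and keep the remaining means. *)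
Fixpoint Sn (n : nat) (h : R) (f : pt -> R) : pt -> R :=
  match n with O => f | S m => Sn m h (stk2 h f) end.

(** This is the derivative of [stk2] in direction [b]: the mean in that direction has become a
    difference quotient, the mean in the other direction remains. *)
Definition dif (b : bool) (h : R) (f : pt -> R) : pt -> R :=
  stk (negb b) h (fun p => / (2 * h) * (f (sh b p h) - f (sh b p (- h)))).

Lemma cont_dq b h f : cont f -> cont (fun p => / (2 * h) * (f (sh b p h) - f (sh b p (- h)))).
Proof.
  intros Hf. apply cont_scal, cont_minus; apply (sm_cont 0), (sm_sh 0 b); split; auto.
Qed.

Lemma cont_dif b h f : 0 < h -> cont f -> cont (dif b h f).
Proof. intros. apply cont_stk; auto. apply cont_dq; auto. Qed.

Lemma stk2_gain b h f : 0 < h -> cont f ->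
  exd b (stk2 h f) /\ pd b (stk2 h f) = dif b h f.
Proof.
  intros Hh Hf. unfold stk2. destruct b.
  - destruct (stk_gain true h (stk false h f)) as [E ->]; auto using cont_stk.
    split; auto. apply functional_extensionality; intros p. unfold dif; change (negb true) with false.
    set (u := fun p => f (sh true p h)). set (v := fun p => f (sh true p (-h))).
    assert (Hu : cont u) by (apply (sm_cont 0), (sm_sh 0 true); split; auto).
    assert (Hv : cont v) by (apply (sm_cont 0), (sm_sh 0 true); split; auto).
    replace (fun p0 => / (2 * h) * (f (sh true p0 h) - f (sh true p0 (- h))))
      with (fun p0 => / (2 * h) * u p0 + - / (2 * h) * v p0)
      by (apply functional_extensionality; intros; unfold u, v; ring).
    rewrite stk_lin by auto.
    change (stk false h u p) with (stk false h f (sh true p h)).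
    change (stk false h v p) with (stk false h f (sh true p (-h))). ring.
  - destruct (stk_gain false h f) as [E P]; auto.
    destruct (stk_pd true false h (stk false h f)) as [E' ->]; auto using cont_stk.
    + rewrite P. apply cont_dq; auto.
    + split; auto. rewrite P. reflexivity.
Qed.

Lemma cont_stk2 h f : 0 < h -> cont f -> cont (stk2 h f).
Proof. intros Hh Hf. exact (cont_stk true h _ Hh (cont_stk false h f Hh Hf)). Qed.

Lemma sm_stk2_S n h f : 0 < h -> sm n f -> sm (S n) (stk2 h f).
Proof.
  intros Hh Sf. split; [apply cont_stk2; eauto using sm_cont|]. intros b.
  destruct (stk2_gain b h f) as [E ->]; eauto using sm_cont. split; auto.
  apply sm_stk; auto. apply sm_scal, sm_minus; apply sm_sh; auto.
Qed.

Lemma stk2_pd b h f : 0 < h -> cont f -> exd b f -> cont (pd b f) ->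
  exd b (stk2 h f) /\ pd b (stk2 h f) = stk2 h (pd b f).
Proof.
  intros. unfold stk2. destruct (stk_pd false b h f) as [E1 P1]; auto.
  destruct (stk_pd true b h (stk false h f)) as [E2 P2]; auto using cont_stk.
  - rewrite P1; auto using cont_stk.
  - split; auto. rewrite P2, P1; auto.
Qed.

Lemma Sn_pd n b h f : 0 < h -> cont f -> exd b f -> cont (pd b f) ->
  exd b (Sn n h f) /\ pd b (Sn n h f) = Sn n h (pd b f).
Proof.
  intros Hh; revert f; induction n as [|n IH]; simpl; intros f Hf E C; auto.
  destruct (stk2_pd b h f) as [E1 P1]; auto. rewrite <- P1.
  apply IH; auto using cont_stk2. rewrite P1; auto using cont_stk2.
Qed.

Lemma sm_Sn n k h f : 0 < h -> sm k f -> sm (n + k) (Sn n h f).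
Proof.
  intros Hh; revert k f; induction n as [|n IH]; intros k f Sf; auto.
  replace (S n + k)%nat with (n + S k)%nat by lia. apply (IH (S k)), sm_stk2_S; auto.
Qed.

(* The two one-dimensional means of [stk2] act on different variables, so the box only grows by [h]. *)
Lemma stk2_box h f p r B : 0 < h -> cont f ->
  (forall q, box p (r + h) q -> Rabs (f q) <= B) -> forall q, box p r q -> Rabs (stk2 h f q) <= B.
Proof.
  intros Hh Hf HB q [Hq1 Hq2]. apply (stk_bound true h (stk false h f)); [auto | apply cont_stk; auto |]. intros t Ht.
  apply (stk_bound false h f); auto. intros s Hs. apply HB. unfold box, sh; simpl.
  split; match goal with |- Rabs (?a + ?t - ?c) <= _ => replace (a + t - c) with ((a - c) + t) by ring end.
  all: eapply Rle_trans; [apply Rabs_triang | lra].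
Qed.

Lemma Sn_box n h f p B : 0 < h -> cont f ->
  (forall q, box p (INR n * h) q -> Rabs (f q) <= B) -> Rabs (Sn n h f p) <= B.
Proof.
  intros Hh; revert f; induction n as [|n IH]; intros f Hf HB.
  - apply HB. simpl. split; rewrite Rminus_diag, Rabs_R0; lra.
  - simpl Sn. apply IH; auto using cont_stk2. apply stk2_box; auto.
    intros q Hq. apply HB. rewrite S_INR. replace ((INR n + 1) * h) with (INR n * h + h) by ring. auto.
Qed.

Lemma dif_box b h f p r B : 0 < h -> cont f ->
  (forall q, box p (r + h) q -> Rabs (f q) <= B) -> forall q, box p r q -> Rabs (dif b h f q) <= / h * B.
Proof.
  intros Hh Hf HB q [Hq1 Hq2]. apply (stk_bound (negb b) h _); [auto | apply cont_dq; auto |]. intros t Ht.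
  assert (H : forall s, Rabs s <= h -> Rabs (f (sh b (sh (negb b) q t) s)) <= B).
  { intros s Hs. apply HB. unfold box, sh. destruct b; simpl.
    all: split; match goal with |- Rabs (?a + ?t - ?c) <= _ => replace (a + t - c) with ((a - c) + t) by ring end.
    all: eapply Rle_trans; [apply Rabs_triang | lra]. }
  rewrite Rabs_mult, Rabs_pos_eq by (left; apply Rinv_0_lt_compat; lra).
  rewrite Rinv_mult, (Rmult_comm (/ 2)), Rmult_assoc. apply Rmult_le_compat_l; [left; apply Rinv_0_lt_compat; auto|].
  assert (H1 := H h). assert (H2 := H (-h)). rewrite Rabs_Ropp in H2.
  rewrite (Rabs_pos_eq h) in * by lra.
  specialize (H1 (Rle_refl _)). specialize (H2 (Rle_refl _)).
  unfold Rminus. assert (T := Rabs_triang (f (sh b (sh (negb b) q t) h)) (- f (sh b (sh (negb b) q t) (- h)))).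
  rewrite Rabs_Ropp in T. lra.
Qed.

(** Each derivative turns one of the means into a difference quotient, bounded by [/ h] times a
    supremum over a box larger by [h]; the total reach stays [n * h]. Locality of the bound is what
    the commutator estimate uses. *)
Lemma Sn_bdp n h f p B : 0 < h -> cont f ->
  (forall q, box p (INR n * h) q -> Rabs (f q) <= B) -> bdp n (/ h) B (Sn n h f) p.
Proof.
  intros Hh; revert f B; induction n as [|n IH]; intros f B Hf HB.
  - split; auto. apply (Sn_box 0 h f); auto.
  - split; [apply Sn_box; auto|]. intros b. simpl Sn.
    destruct (stk2_gain b h f) as [E P]; auto.
    destruct (Sn_pd n b h (stk2 h f)) as [_ ->]; auto using cont_stk2.
    + rewrite P; apply cont_dif; auto.
    + rewrite P. apply IH; [apply cont_dif; auto|]. apply dif_box; auto.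
      intros q Hq. apply HB. rewrite S_INR. replace ((INR n + 1) * h) with (INR n * h + h) by ring. auto.
Qed.

Lemma Sn_lin n h a c f g : 0 < h -> cont f -> cont g ->
  Sn n h (fun p => a * f p + c * g p) = (fun p => a * Sn n h f p + c * Sn n h g p).
Proof.
  intros Hh; revert f g; induction n as [|n IH]; intros f g Hf Hg; auto.
  simpl. rewrite <- IH by auto using cont_stk2. f_equal.
  apply functional_extensionality; intros p. unfold stk2.
  rewrite <- stk_lin by auto using cont_stk. f_equal. 
  apply functional_extensionality; intros q. apply stk_lin; auto.
Qed.
Lemma Sn_const n h c : 0 < h -> Sn n h (fun _ => c) = (fun _ => c).
Proof. intros Hh; induction n; simpl; auto. unfold stk2. rewrite !stk_const; auto. Qed.
Lemma Sn_plus n h f g : 0 < h -> cont f -> cont g ->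
  Sn n h (fun p => f p + g p) = (fun p => Sn n h f p + Sn n h g p).
Proof.
  intros Hh Hf Hg. generalize (Sn_lin n h 1 1 f g Hh Hf Hg).
  replace (fun p => 1 * f p + 1 * g p) with (fun p => f p + g p)
    by (apply functional_extensionality; intros; ring).
  intros ->. apply functional_extensionality; intros; ring.
Qed.
Lemma Sn_minus n h f g : 0 < h -> cont f -> cont g ->
  Sn n h (fun p => f p - g p) = (fun p => Sn n h f p - Sn n h g p).
Proof.
  intros Hh Hf Hg. generalize (Sn_lin n h 1 (-1) f g Hh Hf Hg).
  replace (fun p => 1 * f p + -1 * g p) with (fun p => f p - g p)
    by (apply functional_extensionality; intros; ring).
  intros ->. apply functional_extensionality; intros; ring.
Qed.
Lemma Sn_scal n h c f : 0 < h -> cont f -> Sn n h (fun p => c * f p) = (fun p => c * Sn n h f p).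
Proof.
  intros Hh Hf. generalize (Sn_lin n h c 0 f f Hh Hf Hf).
  replace (fun p => c * f p + 0 * f p) with (fun p => c * f p)
    by (apply functional_extensionality; intros; ring).
  intros ->. apply functional_extensionality; intros; ring.
Qed.

Lemma Sn_near n h f p e : 0 < h -> cont f ->
  (forall q, box p (INR n * h) q -> Rabs (f q - f p) <= e) -> Rabs (Sn n h f p - f p) <= e.
Proof.
  intros Hh Hf HB.
  generalize (Sn_box n h (fun q => f q - f p) p e Hh (cont_minus _ _ Hf (cont_const _)) HB).
  rewrite Sn_minus by auto using cont_const. rewrite Sn_const by auto. auto.
Qed.

Lemma Sn_lip n h f B p : 0 < h -> cont f -> (forall b, exd b f) -> (forall b x, Rabs (pd b f x) <= B) ->
  Rabs (Sn n h f p - f p) <= 2 * INR n * h * B.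
Proof.
  intros Hh Hf He HB. apply Sn_near; auto. intros q [H1 H2].
  eapply Rle_trans; [apply (lipschitz f B); auto|].
  assert (0 <= B) by (eapply Rle_trans; [apply Rabs_pos | apply (HB true p)]).
  unfold dd1. replace (2 * INR n * h * B) with (B * (2 * (INR n * h))) by ring.
  apply Rmult_le_compat_l; auto; lra.
Qed.

(* The commutator is unchanged when constants are subtracted from [f] and [g], hence quadratic in their oscillation. *)
Lemma Sn_commutator n h f g p e : 0 < h -> cont f -> cont g -> 0 <= e ->
  (forall q, box p (INR n * h) q -> Rabs (f q - f p) <= e /\ Rabs (g q - g p) <= e) ->
  bdp n (/ h) ((1 + 2 ^ n) * (e * e)) (fun x => Sn n h (fun q => f q * g q) x - Sn n h f x * Sn n h g x) p.
Proof.
  intros Hh Hf Hg He HB.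
  set (f' := fun q => f q - f p). set (g' := fun q => g q - g p).
  assert (Cf : cont f') by (apply cont_minus; auto using cont_const).
  assert (Cg : cont g') by (apply cont_minus; auto using cont_const).
  assert (Hr : 0 <= / h) by (left; apply Rinv_0_lt_compat; auto).
  assert (Sf : sm n (Sn n h f')) by (replace n with (n + 0)%nat at 1 by lia; apply sm_Sn; auto; split; auto).
  assert (Sg : sm n (Sn n h g')) by (replace n with (n + 0)%nat at 1 by lia; apply sm_Sn; auto; split; auto).
  assert (Sfg : sm n (Sn n h (fun q => f' q * g' q)))
    by (replace n with (n + 0)%nat at 1 by lia; apply sm_Sn; auto; split; auto using cont_mult).
  replace (fun x => Sn n h (fun q => f q * g q) x - Sn n h f x * Sn n h g x)
    with (fun x => Sn n h (fun q => f' q * g' q) x + -1 * (Sn n h f' x * Sn n h g' x)).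
  - replace ((1 + 2 ^ n) * (e * e)) with (e * e + Rabs (-1) * (2 ^ n * (e * e)))
      by (rewrite Rabs_left; lra).
    apply bdp_plus; auto using sm_scal, sm_mult.
    + apply Sn_bdp; auto using cont_mult. intros q Hq. destruct (HB q Hq).
      rewrite Rabs_mult. apply Rmult_le_compat; auto using Rabs_pos.
    + apply bdp_scal; auto using sm_mult. apply bdp_mult; auto.
      * apply Sn_bdp; auto. intros q Hq. apply HB; auto.
      * apply Sn_bdp; auto. intros q Hq. apply HB; auto.
  - replace (fun q => f' q * g' q)
      with (fun q => f q * g q - (g p * f q + (f p * g q - f p * g p)))
      by (apply functional_extensionality; intros; unfold f', g'; ring).
    unfold f', g'.
    rewrite !Sn_minus, Sn_plus, Sn_minus, !Sn_scal, !Sn_const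
      by auto using cont_mult, cont_minus, cont_plus, cont_scal, cont_const.
    apply functional_extensionality; intros; ring.
Qed.

(** * The linearised problem on the torus *)

Inductive trig : (pt -> R) -> Prop :=
| trig_const c : trig (fun _ => c)
| trig_sin b : trig (fun p => sin (crd b p))
| trig_cos b : trig (fun p => cos (crd b p))
| trig_plus f g : trig f -> trig g -> trig (fun p => f p + g p)
| trig_mult f g : trig f -> trig g -> trig (fun p => f p * g p).

Lemma trig_ext f g : (forall p, f p = g p) -> trig f -> trig g.
Proof. intros H. replace g with f; auto. apply functional_extensionality; auto. Qed.
Lemma trig_scal c f : trig f -> trig (fun p => c * f p).
Proof. intros; apply trig_mult; auto using trig_const. Qed.
Lemma trig_minus f g : trig f -> trig g -> trig (fun p => f p - g p).
Proof.
  intros Hf Hg. apply (trig_ext (fun p => f p + -1 * g p)); [intros; ring|].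
  apply trig_plus; auto using trig_scal.
Qed.

Lemma pd_1d b b' (A : R -> R) A' : (forall x, is_derive A x (A' x)) ->
  exd b' (fun p => A (crd b p)) /\
  pd b' (fun p => A (crd b p)) = (fun p => if Bool.eqb b b' then A' (crd b p) else 0).
Proof.
  intros H. apply pd_is_derive. intros p. destruct b, b'; simpl; try apply H;
    apply (is_derive_const (V := R_NormedModule)).
Qed.

Lemma trig_pd f : trig f -> forall b, exd b f /\ trig (pd b f).
Proof.
  induction 1; intros b'.
  - destruct (exd_const b' c) as [E ->]; auto using trig_const.
  - destruct (pd_1d b b' sin cos is_derive_sin) as [E ->]. split; auto.
    destruct (Bool.eqb b b'); auto using trig_const, trig_cos.
  - destruct (pd_1d b b' cos (fun x => - sin x) is_derive_cos) as [E ->]. split; auto.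
    destruct (Bool.eqb b b'); auto using trig_const.
    apply (trig_ext (fun p => -1 * sin (crd b p))); [intros; ring|]. auto using trig_scal, trig_sin.
  - destruct (IHtrig1 b'), (IHtrig2 b'), (exd_plus b' f g) as [E ->]; auto using trig_plus.
  - destruct (IHtrig1 b'), (IHtrig2 b'), (exd_mult b' f g) as [E ->]; auto using trig_plus, trig_mult.
Qed.

(** One-variable trigonometric polynomials in Fourier form, because [t1_int] integrates frequency by
    frequency; closure under products then rests on the product-to-sum formulas. *)
Inductive t1 : (R -> R) -> Prop :=
| t1_cos a k : t1 (fun x => a * cos (IZR k * x))
| t1_sin a k : t1 (fun x => a * sin (IZR k * x))
| t1_plus A B : t1 A -> t1 B -> t1 (fun x => A x + B x).

Lemma t1_ext A B : (forall x, A x = B x) -> t1 A -> t1 B.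
Proof. intros H. replace B with A; auto. apply functional_extensionality; auto. Qed.
Lemma t1_c a : t1 (fun _ => a).
Proof. apply (t1_ext (fun x => a * cos (IZR 0 * x))), t1_cos. intros. rewrite Rmult_0_l, cos_0; ring. Qed.
Lemma t1_sin1 : t1 sin.
Proof. apply (t1_ext (fun x => 1 * sin (IZR 1 * x))), t1_sin. intros. rewrite !Rmult_1_l; auto. Qed.
Lemma t1_cos1 : t1 cos.
Proof. apply (t1_ext (fun x => 1 * cos (IZR 1 * x))), t1_cos. intros. rewrite !Rmult_1_l; auto. Qed.

Lemma t1_mult A B : t1 A -> t1 B -> t1 (fun x => A x * B x).
Proof.
  intros HA; revert B; induction HA as [a k | a k | A A' _ IH1 _ IH2]; intros B HB.
  3: { apply (t1_ext (fun x => A x * B x + A' x * B x)); [intros; ring|]. apply t1_plus; auto. }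
  all: induction HB as [c l | c l | B B' _ IH1 _ IH2];
    try solve [ eapply t1_ext; [|apply t1_plus; [exact IH1 | exact IH2]]; intros x; simpl; ring ].
  - apply (t1_ext (fun x => a * c / 2 * cos (IZR (k + l) * x) + a * c / 2 * cos (IZR (k - l) * x)));
      [|auto using t1_plus, t1_cos].
    intros x. rewrite plus_IZR, minus_IZR, Rmult_plus_distr_r, Rmult_minus_distr_r, cos_plus, cos_minus. field.
  - apply (t1_ext (fun x => a * c / 2 * sin (IZR (k + l) * x) + - (a * c / 2) * sin (IZR (k - l) * x)));
      [|auto using t1_plus, t1_sin].
    intros x. rewrite plus_IZR, minus_IZR, Rmult_plus_distr_r, Rmult_minus_distr_r, sin_plus, sin_minus. field.
  - apply (t1_ext (fun x => a * c / 2 * sin (IZR (k + l) * x) + a * c / 2 * sin (IZR (k - l) * x)));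
      [|auto using t1_plus, t1_sin].
    intros x. rewrite plus_IZR, minus_IZR, Rmult_plus_distr_r, Rmult_minus_distr_r, sin_plus, sin_minus. field.
  - apply (t1_ext (fun x => - (a * c / 2) * cos (IZR (k + l) * x) + a * c / 2 * cos (IZR (k - l) * x)));
      [|auto using t1_plus, t1_cos].
    intros x. rewrite plus_IZR, minus_IZR, Rmult_plus_distr_r, Rmult_minus_distr_r, cos_plus, cos_minus. field.
Qed.

Lemma t1_scal a A : t1 A -> t1 (fun x => a * A x).
Proof. intros; apply t1_mult; auto using t1_c. Qed.

Lemma t1_der A : t1 A -> exists A', t1 A' /\ forall x, is_derive A x (A' x).
Proof.
  induction 1 as [a k | a k | A B _ [A' [HA DA]] _ [B' [HB DB]]].
  - exists (fun x => - (a * IZR k) * sin (IZR k * x)); split; [apply t1_sin|].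
    intros x. auto_derive; auto. ring.
  - exists (fun x => (a * IZR k) * cos (IZR k * x)); split; [apply t1_cos|].
    intros x. auto_derive; auto. ring.
  - exists (fun x => A' x + B' x); split; [auto using t1_plus|].
    intros x. apply (is_derive_plus (V := R_NormedModule)); auto.
Qed.

(** Here [m] is the mean of [A], the only obstruction to a periodic primitive. *)
Lemma t1_int A : t1 A -> exists m B, t1 B /\ forall x, is_derive B x (A x - m).
Proof.
  induction 1 as [a k | a k | A B _ [m [A' [HA DA]]] _ [n [B' [HB DB]]]].
  - destruct (Z.eq_dec k 0) as [->|Hk].
    + exists a, (fun _ => 0); split; [apply t1_c|]. intros x. rewrite Rmult_0_l, cos_0.
      replace (a * 1 - a) with 0 by ring. apply (is_derive_const (V := R_NormedModule)).
    + exists 0, (fun x => (a / IZR k) * sin (IZR k * x)); split; [apply t1_sin|].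
      intros x. apply not_0_IZR in Hk. auto_derive; auto. field; auto.
  - destruct (Z.eq_dec k 0) as [->|Hk].
    + exists 0, (fun _ => 0); split; [apply t1_c|]. intros x. rewrite Rmult_0_l, sin_0.
      replace (a * 0 - 0) with 0 by ring. apply (is_derive_const (V := R_NormedModule)).
    + exists 0, (fun x => - (a / IZR k) * cos (IZR k * x)); split; [apply t1_cos|].
      intros x. apply not_0_IZR in Hk. auto_derive; auto. field; auto.
  - exists (m + n), (fun x => A' x + B' x); split; [auto using t1_plus|].
    intros x. replace (A x + B x - (m + n)) with ((A x - m) + (B x - n)) by ring.
    apply (is_derive_plus (V := R_NormedModule)); auto.
Qed.

(** Division by [sin]: modulo multiples of [sin x], a trigonometric polynomial is determined by its
    values [a + c] at [0] and [a - c] at [PI]. *)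
Definition mod_sin (A : R -> R) : Prop :=
  exists a c A1, t1 A1 /\ forall x, A x = a + c * cos x + sin x * A1 x.

(** Both functions go through the induction together because the addition formulas mix them. *)
Lemma mod_sin_multiples n a :
  mod_sin (fun x => a * cos (INR n * x)) /\ mod_sin (fun x => a * sin (INR n * x)).
Proof.
  induction n as [|n [(a1 & c1 & A1 & T1 & E1) (a2 & c2 & A2 & T2 & E2)]].
  - split; [exists a, 0, (fun _ => 0) | exists 0, 0, (fun _ => 0)]; split; auto using t1_c;
      intros x; simpl; rewrite Rmult_0_l, ?cos_0, ?sin_0; ring.
  - split.
    + exists c1, a1, (fun x => - c1 * sin x + A1 x * cos x + -1 * (a2 + c2 * cos x + sin x * A2 x)).
      split; [repeat (apply t1_plus || apply t1_mult); auto using t1_c, t1_sin1, t1_cos1|].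
      intros x. rewrite S_INR, Rmult_plus_distr_r, Rmult_1_l, cos_plus.
      replace (a * (cos (INR n * x) * cos x - sin (INR n * x) * sin x))
        with (a * cos (INR n * x) * cos x - a * sin (INR n * x) * sin x) by ring.
      rewrite E1, E2. assert (H : cos x * cos x = 1 - sin x * sin x)
        by (generalize (sin2_cos2 x); unfold Rsqr; lra). ring [H].
    + exists c2, a2, (fun x => - c2 * sin x + A2 x * cos x + (a1 + c1 * cos x + sin x * A1 x)).
      split; [repeat (apply t1_plus || apply t1_mult); auto using t1_c, t1_sin1, t1_cos1|].
      intros x. rewrite S_INR, Rmult_plus_distr_r, Rmult_1_l, sin_plus.
      replace (a * (sin (INR n * x) * cos x + cos (INR n * x) * sin x))
        with (a * sin (INR n * x) * cos x + a * cos (INR n * x) * sin x) by ring.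
      rewrite E1, E2. assert (H : cos x * cos x = 1 - sin x * sin x)
        by (generalize (sin2_cos2 x); unfold Rsqr; lra). ring [H].
Qed.

Lemma t1_mod_sin A : t1 A -> mod_sin A.
Proof.
  induction 1 as [a k | a k | A B _ (a & c & A1 & T1 & E1) _ (a' & c' & B1 & T2 & E2)].
  - destruct (proj1 (mod_sin_multiples (Z.abs_nat k) a)) as (a1 & c1 & A1 & T1 & E1).
    exists a1, c1, A1; split; auto. intros x. rewrite <- E1, INR_IZR_INZ, Zabs2Nat.id_abs.
    destruct (Z.abs_eq_or_opp k) as [-> | ->]; auto.
    rewrite opp_IZR, (Ropp_mult_distr_l_reverse (IZR k)), cos_neg. auto.
  - destruct (Z.abs_eq_or_opp k) as [Hk | Hk].
    + destruct (proj2 (mod_sin_multiples (Z.abs_nat k) a)) as (a1 & c1 & A1 & T1 & E1).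
      exists a1, c1, A1; split; auto. intros x. rewrite <- E1, INR_IZR_INZ, Zabs2Nat.id_abs, Hk. auto.
    + destruct (proj2 (mod_sin_multiples (Z.abs_nat k) (- a))) as (a1 & c1 & A1 & T1 & E1).
      exists a1, c1, A1; split; auto. intros x. rewrite <- E1, INR_IZR_INZ, Zabs2Nat.id_abs, Hk.
      rewrite opp_IZR, (Ropp_mult_distr_l_reverse (IZR k)), sin_neg. ring.
  - exists (a + a'), (c + c'), (fun x => A1 x + B1 x); split; auto using t1_plus.
    intros x. rewrite E1, E2. ring.
Qed.

Lemma t1_trig A b : t1 A -> trig (fun p => A (crd b p)).
Proof.
  assert (H : forall n, trig (fun p => cos (INR n * crd b p)) /\ trig (fun p => sin (INR n * crd b p))).
  { induction n as [|n [IH1 IH2]].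
    - split; [apply (trig_ext (fun _ => 1)) | apply (trig_ext (fun _ => 0))]; auto using trig_const;
        intros p; simpl; rewrite Rmult_0_l, ?cos_0, ?sin_0; auto.
    - split.
      + apply (trig_ext (fun p => cos (INR n * crd b p) * cos (crd b p) - sin (INR n * crd b p) * sin (crd b p))).
        * intros p. rewrite S_INR, Rmult_plus_distr_r, Rmult_1_l, cos_plus. auto.
        * auto using trig_minus, trig_mult, trig_cos, trig_sin.
      + apply (trig_ext (fun p => sin (INR n * crd b p) * cos (crd b p) + cos (INR n * crd b p) * sin (crd b p))).
        * intros p. rewrite S_INR, Rmult_plus_distr_r, Rmult_1_l, sin_plus. auto.
        * auto using trig_plus, trig_mult, trig_cos, trig_sin. }
  induction 1 as [a k | a k | A B _ IH1 _ IH2]; auto using trig_plus.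
  - apply trig_scal. destruct (H (Z.abs_nat k)) as [T _].
    eapply trig_ext; [|exact T]. intros p; simpl. rewrite INR_IZR_INZ, Zabs2Nat.id_abs.
    destruct (Z.abs_eq_or_opp k) as [-> | ->]; auto.
    rewrite opp_IZR, (Ropp_mult_distr_l_reverse (IZR k)), cos_neg. auto.
  - destruct (H (Z.abs_nat k)) as [_ T]. destruct (Z.abs_eq_or_opp k) as [Hk | Hk].
    + apply trig_scal. eapply trig_ext; [|exact T]. intros p; simpl. rewrite INR_IZR_INZ, Zabs2Nat.id_abs, Hk. auto.
    + apply (trig_ext (fun p => - a * sin (INR (Z.abs_nat k) * crd b p))); auto using trig_scal.
      intros p; simpl. rewrite INR_IZR_INZ, Zabs2Nat.id_abs, Hk.
      rewrite opp_IZR, (Ropp_mult_distr_l_reverse (IZR k)), sin_neg. ring.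
Qed.

Inductive sp : (pt -> R) -> Prop :=
| sp_prod A B : t1 A -> t1 B -> sp (fun p => A (fst p) * B (snd p))
| sp_plus f g : sp f -> sp g -> sp (fun p => f p + g p).

Lemma sp_ext f g : (forall p, f p = g p) -> sp f -> sp g.
Proof. intros H. replace g with f; auto. apply functional_extensionality; auto. Qed.

Lemma sp_mult f g : sp f -> sp g -> sp (fun p => f p * g p).
Proof.
  intros Hf; revert g; induction Hf as [A B TA TB | f f' _ IH1 _ IH2]; intros g Hg.
  - induction Hg as [A' B' TA' TB' | g g' _ IH1 _ IH2].
    + apply (sp_ext (fun p => (A (fst p) * A' (fst p)) * (B (snd p) * B' (snd p)))); [intros; ring|].
      apply (sp_prod (fun x => A x * A' x) (fun x => B x * B' x)); auto using t1_mult.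
    + eapply sp_ext; [|apply sp_plus; [exact IH1 | exact IH2]]. intros; simpl; ring.
  - eapply sp_ext; [|apply sp_plus; [apply (IH1 g Hg) | apply (IH2 g Hg)]]. intros; simpl; ring.
Qed.

Lemma trig_sp f : trig f -> sp f.
Proof.
  induction 1; auto using sp_plus, sp_mult.
  - eapply sp_ext; [|apply (sp_prod (fun _ => c) (fun _ => 1)); apply t1_c]. intros; simpl; ring.
  - destruct b; [eapply sp_ext; [|apply (sp_prod sin (fun _ => 1))] | eapply sp_ext; [|apply (sp_prod (fun _ => 1) sin)]];
      auto using t1_c, t1_sin1; intros; simpl; ring.
  - destruct b; [eapply sp_ext; [|apply (sp_prod cos (fun _ => 1))] | eapply sp_ext; [|apply (sp_prod (fun _ => 1) cos)]];
      auto using t1_c, t1_cos1; intros; simpl; ring.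
Qed.

(** This is [cos (x1 + x2)], expanded so that every later identity is polynomial in the sines and
    cosines of the coordinates and follows by [ring] or [field] from [cc]. *)
Definition c3 (p : pt) : R := cos (fst p) * cos (snd p) - sin (fst p) * sin (snd p).

Lemma trig_c3 : trig c3.
Proof.
  apply (trig_minus (fun p => cos (crd true p) * cos (crd false p)) (fun p => sin (crd true p) * sin (crd false p)));
    auto using trig_mult, trig_cos, trig_sin.
Qed.

(* The matrix fields [sum_j u_j D^2 P_j + sym grad W], where [P = - (sin x1, sin x2, cos (x1 + x2))]. *)
Definition Rg (F11 F12 F22 : pt -> R) : Prop := exists u1 u2 u3 W1 W2,
  trig u1 /\ trig u2 /\ trig u3 /\ trig W1 /\ trig W2 /\ forall p,
  F11 p = u1 p * sin (fst p) + u3 p * c3 p + pd true W1 p /\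
  F12 p = u3 p * c3 p + / 2 * (pd false W1 p + pd true W2 p) /\
  F22 p = u2 p * sin (snd p) + u3 p * c3 p + pd false W2 p.

Lemma Rg_ext F11 F12 F22 G11 G12 G22 : Rg F11 F12 F22 ->
  (forall p, F11 p = G11 p /\ F12 p = G12 p /\ F22 p = G22 p) -> Rg G11 G12 G22.
Proof.
  intros (u1 & u2 & u3 & W1 & W2 & T1 & T2 & T3 & T4 & T5 & E) H.
  exists u1, u2, u3, W1, W2. do 5 (split; auto). intros p; destruct (H p) as (<- & <- & <-); apply E.
Qed.

Lemma Rg_lin a c F11 F12 F22 G11 G12 G22 : Rg F11 F12 F22 -> Rg G11 G12 G22 ->
  Rg (fun p => a * F11 p + c * G11 p) (fun p => a * F12 p + c * G12 p) (fun p => a * F22 p + c * G22 p).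
Proof.
  intros (u1 & u2 & u3 & W1 & W2 & T1 & T2 & T3 & T4 & T5 & E)
    (u1' & u2' & u3' & W1' & W2' & T1' & T2' & T3' & T4' & T5' & E').
  exists (fun p => a * u1 p + c * u1' p), (fun p => a * u2 p + c * u2' p), (fun p => a * u3 p + c * u3' p),
    (fun p => a * W1 p + c * W1' p), (fun p => a * W2 p + c * W2' p).
  assert (HW : forall W W' b, trig W -> trig W' ->
    pd b (fun p => a * W p + c * W' p) = (fun p => a * pd b W p + c * pd b W' p)).
  { intros W W' b T T'. destruct (trig_pd W T b), (trig_pd W' T' b).
    destruct (exd_scal b a W) as [X1 Y1], (exd_scal b c W') as [X2 Y2]; auto.
    destruct (exd_plus b _ _ X1 X2) as [_ ->]. rewrite Y1, Y2; auto. }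
  repeat (split; auto using trig_plus, trig_scal).
  all: rewrite !HW by auto; destruct (E p) as (E1 & E2 & E3), (E' p) as (E1' & E2' & E3');
    rewrite ?E1, ?E2, ?E3, ?E1', ?E2', ?E3'; field.
Qed.

Lemma Rg_alg u1 u2 u3 : trig u1 -> trig u2 -> trig u3 ->
  Rg (fun p => u1 p * sin (fst p) + u3 p * c3 p) (fun p => u3 p * c3 p)
     (fun p => u2 p * sin (snd p) + u3 p * c3 p).
Proof.
  intros. exists u1, u2, u3, (fun _ => 0), (fun _ => 0).
  repeat (split; auto using trig_const).
  all: rewrite ?(proj2 (exd_const true 0)), ?(proj2 (exd_const false 0)); ring.
Qed.

Lemma pd_prod A A' B B' : (forall x, is_derive A x (A' x)) -> (forall x, is_derive B x (B' x)) ->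
  pd true (fun p => A (fst p) * B (snd p)) = (fun p => A' (fst p) * B (snd p)) /\
  pd false (fun p => A (fst p) * B (snd p)) = (fun p => A (fst p) * B' (snd p)).
Proof.
  intros HA HB.
  split; apply functional_extensionality; intros p; apply is_derive_unique; unfold upd, crd; simpl.
  - apply (is_derive_ext (fun t => B (snd p) * A t)); [intros; apply Rmult_comm|].
    rewrite Rmult_comm. apply is_derive_scal; auto.
  - apply is_derive_scal; auto.
Qed.

Lemma Rg_W1 A A' B B' : t1 A -> t1 B -> (forall x, is_derive A x (A' x)) -> (forall x, is_derive B x (B' x)) ->
  Rg (fun p => A' (fst p) * B (snd p)) (fun p => / 2 * (A (fst p) * B' (snd p))) (fun _ => 0).
Proof.
  intros TA TB HA HB. destruct (pd_prod A A' B B' HA HB) as [E1 E2].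
  exists (fun _ => 0), (fun _ => 0), (fun _ => 0), (fun p : pt => A (fst p) * B (snd p)), (fun _ => 0).
  repeat (split; auto using trig_const).
  - apply trig_mult; [apply (t1_trig A true TA) | apply (t1_trig B false TB)].
  - rewrite E1; ring.
  - rewrite E2, (proj2 (exd_const true 0)); ring.
  - rewrite (proj2 (exd_const false 0)); ring.
Qed.
Lemma Rg_W2 A A' B B' : t1 A -> t1 B -> (forall x, is_derive A x (A' x)) -> (forall x, is_derive B x (B' x)) ->
  Rg (fun _ => 0) (fun p => / 2 * (A' (fst p) * B (snd p))) (fun p => A (fst p) * B' (snd p)).
Proof.
  intros TA TB HA HB. destruct (pd_prod A A' B B' HA HB) as [E1 E2].
  exists (fun _ => 0), (fun _ => 0), (fun _ => 0), (fun _ => 0), (fun p : pt => A (fst p) * B (snd p)).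
  repeat (split; auto using trig_const).
  - apply trig_mult; [apply (t1_trig A true TA) | apply (t1_trig B false TB)].
  - rewrite (proj2 (exd_const true 0)); ring.
  - rewrite E1, (proj2 (exd_const false 0)); ring.
  - rewrite E2; ring.
Qed.

Lemma cc x : cos x * cos x = 1 - sin x * sin x.
Proof. generalize (sin2_cos2 x); unfold Rsqr; lra. Qed.

Ltac t1_auto := repeat (apply t1_plus || apply t1_mult); auto using t1_c, t1_sin1, t1_cos1.
Ltac trig_auto := repeat first
  [ exact trig_c3 | exact (trig_sin true) | exact (trig_sin false) | exact (trig_cos true) | exact (trig_cos false)
  | apply trig_const | apply trig_minus | apply trig_plus | apply trig_mult ].
Ltac der := intros x; auto_derive; auto; ring.

(** The field has vanishing curl curl and is itself the symmetric gradient of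
    [(sin x1 B, cos x1 B')]. It is used to trade an [e1e1] entry for an [e2e2] entry. *)
Lemma swap_cos B B' B'' : t1 B -> t1 B' -> (forall x, is_derive B x (B' x)) -> (forall x, is_derive B' x (B'' x)) ->
  Rg (fun p => cos (fst p) * B (snd p)) (fun _ => 0) (fun p => cos (fst p) * B'' (snd p)).
Proof.
  intros TB TB' D D'.
  eapply Rg_ext; [apply (Rg_lin 1 1);
    [apply (Rg_W1 sin cos B B') | apply (Rg_W2 cos (fun x => - sin x) B' B'')]; auto using t1_sin1, t1_cos1|].
  - apply is_derive_sin.
  - apply is_derive_cos.
  - intros p; simpl; repeat split; field.
Qed.

Lemma swap_cos' B B' B'' : t1 B -> t1 B' -> (forall x, is_derive B x (B' x)) -> (forall x, is_derive B' x (B'' x)) ->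
  Rg (fun p => B'' (fst p) * cos (snd p)) (fun _ => 0) (fun p => B (fst p) * cos (snd p)).
Proof.
  intros TB TB' D D'.
  eapply Rg_ext; [apply (Rg_lin 1 1);
    [apply (Rg_W2 B B' sin cos) | apply (Rg_W1 B' B'' cos (fun x => - sin x))]; auto using t1_sin1, t1_cos1|].
  - apply is_derive_sin.
  - apply is_derive_cos.
  - intros p; simpl; repeat split; field.
Qed.

(** A profile constant in [x1] has no periodic primitive in [x1]. Writing
    [1 = 2 sin x1 ^ 2 + cos (2 x1)], the first term is absorbed by [u1], and the second, which does
    oscillate, is traded as in [swap_cos]. *)
Lemma swap_one B B' B'' : t1 B -> t1 B' -> (forall x, is_derive B x (B' x)) -> (forall x, is_derive B' x (B'' x)) ->
  Rg (fun p => B (snd p)) (fun _ => 0)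
     (fun p => / 4 * ((1 - 2 * (sin (fst p) * sin (fst p))) * B'' (snd p))).
Proof.
  intros TB TB' D D'.
  assert (T := t1_trig B false TB).
  eapply Rg_ext; [apply (Rg_lin 1 1);
    [apply (Rg_alg (fun p => 2 * sin (fst p) * B (snd p)) (fun _ => 0) (fun _ => 0)) |
     apply (Rg_lin 1 (/ 4));
     [apply (Rg_W1 (fun x => sin x * cos x) (fun x => 1 - 2 * (sin x * sin x)) B B') |
      apply (Rg_W2 (fun x => 1 + -2 * (sin x * sin x)) (fun x => - 4 * (sin x * cos x)) B' B'')]]|]; auto; try t1_auto.
  - apply trig_mult; auto. trig_auto.
  - apply trig_const.
  - apply trig_const.
  - intros x. auto_derive; auto. ring [(cc x)].
  - der.
  - intros p; simpl; repeat split; field.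
Qed.

Lemma swap_one' B B' B'' : t1 B -> t1 B' -> (forall x, is_derive B x (B' x)) -> (forall x, is_derive B' x (B'' x)) ->
  Rg (fun p => / 4 * (B'' (fst p) * (1 - 2 * (sin (snd p) * sin (snd p))))) (fun _ => 0) (fun p => B (fst p)).
Proof.
  intros TB TB' D D'.
  assert (T := t1_trig B true TB).
  eapply Rg_ext; [apply (Rg_lin 1 1);
    [apply (Rg_alg (fun _ => 0) (fun p => 2 * sin (snd p) * B (fst p)) (fun _ => 0)) |
     apply (Rg_lin 1 (/ 4));
     [apply (Rg_W2 B B' (fun x => sin x * cos x) (fun x => 1 - 2 * (sin x * sin x))) |
      apply (Rg_W1 B' B'' (fun x => 1 + -2 * (sin x * sin x)) (fun x => - 4 * (sin x * cos x)))]]|]; auto; try t1_auto.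
  - apply trig_const.
  - apply trig_mult; auto. trig_auto.
  - apply trig_const.
  - intros x. auto_derive; auto. ring [(cc x)].
  - der.
  - intros p; simpl; repeat split; field.
Qed.

Lemma Rg_e11_one : Rg (fun _ => 1) (fun _ => 0) (fun _ => 0).
Proof.
  eapply Rg_ext; [apply (Rg_lin 2 1);
    [apply (Rg_alg (fun p => sin (fst p)) (fun _ => 0) (fun _ => 0)) |
     apply (Rg_W1 (fun x => sin x * cos x) (fun x => 1 - 2 * (sin x * sin x)) (fun _ => 1) (fun _ => 0))]|].
  all: try solve [trig_auto | t1_auto | der | intros x; auto_derive; auto; ring [(cc x)]].
  intros p; simpl; repeat split; field.
Qed.

Lemma Rg_e22_one : Rg (fun _ => 0) (fun _ => 0) (fun _ => 1).
Proof.
  eapply Rg_ext; [apply (Rg_lin 2 1);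
    [apply (Rg_alg (fun _ => 0) (fun p => sin (snd p)) (fun _ => 0)) |
     apply (Rg_W2 (fun _ => 1) (fun _ => 0) (fun x => sin x * cos x) (fun x => 1 - 2 * (sin x * sin x)))]|].
  all: try solve [trig_auto | t1_auto | der | intros x; auto_derive; auto; ring [(cc x)]].
  intros p; simpl; repeat split; field.
Qed.

Lemma Rg_e12_one : Rg (fun _ => 0) (fun _ => 1) (fun _ => 0).
Proof.
  (* Since [2 c3 ^ 2 = 1 + cos (2 x1 + 2 x2)], the third corrugation provides the constant matrix
     [(e1 + e2)(e1 + e2)]; the oscillating remainder times this matrix is a symmetric gradient. The
     diagonal entries are then subtracted. *)
  assert (H : Rg (fun _ => 1) (fun _ => 1) (fun _ => 1)).
  { set (sc := fun x => sin x * cos x). set (c2x := fun x => 1 + -2 * (sin x * sin x)).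
    assert (TS : t1 sc) by (unfold sc; t1_auto). assert (TC : t1 c2x) by (unfold c2x; t1_auto).
    assert (DS : forall x, is_derive sc x (c2x x)) by (intros x; unfold sc, c2x; auto_derive; auto; ring [(cc x)]).
    assert (DC : forall x, is_derive c2x x (-4 * sc x)) by (unfold sc, c2x; der).
    eapply Rg_ext; [apply (Rg_lin 2 (-1));
      [apply (Rg_alg (fun _ => 0) (fun _ => 0) c3) |
       apply (Rg_lin 1 1); [apply (Rg_lin 1 1); [apply (Rg_W1 sc c2x c2x (fun x => -4 * sc x)) | apply (Rg_W1 c2x (fun x => -4 * sc x) sc c2x)]
        | apply (Rg_lin 1 1); [apply (Rg_W2 sc c2x c2x (fun x => -4 * sc x)) | apply (Rg_W2 c2x (fun x => -4 * sc x) sc c2x)]]]|];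
    auto; try trig_auto.
    intros p; unfold c3, sc, c2x; repeat split; field [(cc (fst p)) (cc (snd p))]. }
  eapply Rg_ext; [exact (Rg_lin 1 (-1) _ _ _ _ _ _ H (Rg_lin 1 1 _ _ _ _ _ _ Rg_e11_one Rg_e22_one))|].
  intros p; repeat split; ring.
Qed.

(* The four classes below are exactly those not killed by [u1], [u2] and [W] alone: they do not vanish
   on [sin x1 = sin x2 = 0]. The third corrugation, nonzero on this set, takes care of them. *)
Lemma Rg_class_cos : Rg (fun _ => 0) (fun _ => 0) (fun p => cos (fst p)).
Proof.
  (* Origin of [u3 = cos x2]: on [sin x1 = sin x2 = 0] the curl curl of the right-hand side is that
     of [u3 c3 (e1 + e2)(e1 + e2)], namely [c3 (d1 - d2)^2 u3], because [c3] depends on [x1 + x2]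
     only. There it must equal [d1^2 cos x1 = - cos x1]. The remaining coefficients follow by
     elimination. *)
  eapply Rg_ext; [apply (Rg_lin 1 1);
    [apply (Rg_alg (fun p => sin (snd p) * cos (snd p)) 
              (fun p => cos (fst p) * sin (snd p) - 3 * (sin (fst p) * cos (snd p))) (fun p => cos (snd p))) |
     apply (Rg_lin (-1) (-2));
     [apply (swap_cos (fun x => cos x * cos x) (fun x => -2 * (sin x * cos x)) (fun x => -2 * (cos x * cos x - sin x * sin x))) |
      apply (Rg_lin 1 1);
      [apply (Rg_W2 sin cos (fun x => cos x * cos x) (fun x => -2 * (sin x * cos x))) |
       apply (Rg_W2 cos (fun x => - sin x) (fun x => sin x * cos x) (fun x => cos x * cos x - sin x * sin x))]]]|].
  all: try solve [trig_auto | t1_auto | der | apply is_derive_sin | apply is_derive_cos].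
  intros p; unfold c3; repeat split; field [(cc (fst p)) (cc (snd p))].
Qed.

(** By the same criterion [u3] is half of [cos x1 ^ 2]: then [(d1 - d2)^2 u3 = - cos (2 x1)], which
    is [-1] where the sines vanish, and [c3] is [cos x1 cos x2] there. *)
Lemma Rg_class_cos_cos : Rg (fun _ => 0) (fun _ => 0) (fun p => cos (fst p) * cos (snd p)).
Proof.
  eapply Rg_ext; [apply (Rg_lin (/ 2) (/ 2));
    [apply (Rg_alg (fun p => 4 * (sin (fst p) * (cos (fst p) * cos (snd p))) + cos (fst p) * (cos (fst p) * sin (snd p)))
              (fun p => sin (fst p) * (cos (fst p) * cos (fst p)) - 2 * (sin (fst p) - / 3 * (sin (fst p) * (sin (fst p) * sin (fst p)))))
              (fun p => cos (fst p) * cos (fst p))) |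
     apply (Rg_lin (-2) 1);
     [apply (swap_cos cos (fun x => -1 * sin x) (fun x => - cos x)) |
      apply (Rg_lin (- / 3) (-2));
      [apply (swap_cos' (fun x => cos x * (cos x * cos x)) (fun x => -3 * (cos x * (cos x * sin x)))
               (fun x => -3 * cos x + 9 * (cos x * (sin x * sin x)))) |
       apply (Rg_lin 1 1);
       [apply (Rg_W2 (fun x => sin x + - / 3 * (sin x * (sin x * sin x))) (fun x => cos x * (cos x * cos x)) cos (fun x => - sin x)) |
        apply (Rg_W2 (fun x => / 3 * (cos x * (cos x * cos x))) (fun x => - (cos x * (cos x * sin x))) sin cos)]]]]|].
  all: try solve [trig_auto | t1_auto | der | apply is_derive_sin | apply is_derive_cos
    | intros x; auto_derive; auto; field [(cc x)] ].
  intros p; unfold c3; repeat split; field [(cc (fst p)) (cc (snd p))].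
Qed.

(** Here [u3 = 2 cos x1 cos x2]: where the sines vanish, [c3 (d1 - d2)^2 u3] equals [-4], the value
    of [d1^2 cos (2 x1)] there. *)
Lemma Rg_class_cos2 : Rg (fun _ => 0) (fun _ => 0) (fun p => 1 - 2 * (sin (fst p) * sin (fst p))).
Proof.
  set (sc := fun x => sin x * cos x). set (c2x := fun x => 1 + -2 * (sin x * sin x)).
  assert (TS : t1 sc) by (unfold sc; t1_auto). assert (TC : t1 c2x) by (unfold c2x; t1_auto).
  assert (DS : forall x, is_derive sc x (c2x x)) by (intros x; unfold sc, c2x; auto_derive; auto; ring [(cc x)]).
  assert (DC : forall x, is_derive c2x x (-4 * sc x)) by (unfold sc, c2x; der).
  eapply Rg_ext; [apply (Rg_lin 2 1);
    [apply (Rg_alg (fun p => cos (fst p) * (sin (snd p) * cos (snd p)) + sin (fst p) * (cos (snd p) * cos (snd p)))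
              (fun p => cos (fst p) * (cos (fst p) * sin (snd p)) - sin (fst p) * (cos (fst p) * cos (snd p)))
              (fun p => cos (fst p) * cos (snd p))) |
     apply (Rg_lin (-2) 1);
     [apply (swap_one (fun x => cos x * cos x) (fun x => -2 * sc x) (fun x => -2 * c2x x)) |
      apply (Rg_lin (- / 2) 1); [exact Rg_e12_one|];
      apply (Rg_lin (-1) 1); [exact Rg_e22_one|];
      apply (Rg_lin (-2) 1); [apply (Rg_W2 sc c2x (fun x => cos x * cos x) (fun x => -2 * sc x)) |
      apply (Rg_lin (-1) (-1)); [apply (Rg_W1 (fun _ => 1) (fun _ => 0) sc c2x) | apply (Rg_W2 c2x (fun x => -4 * sc x) sc c2x)]]]]|];
  auto.
  all: try solve [trig_auto | t1_auto | unfold sc; der | apply is_derive_sin | apply is_derive_cos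
    | apply (t1_scal (-2) sc TS) | intros x; apply (is_derive_scal sc); apply DS | intros x; apply (is_derive_const (V := R_NormedModule)) ].
  intros p; unfold c3, sc, c2x; repeat split; field [(cc (fst p)) (cc (snd p))].
Qed.

Lemma Rg_class_e11_cos : Rg (fun p => cos (snd p)) (fun _ => 0) (fun _ => 0).
Proof.
  eapply Rg_ext; [apply (Rg_lin 1 1);
    [apply (Rg_alg (fun p => sin (fst p) * cos (snd p) - 3 * (cos (fst p) * sin (snd p)))
              (fun p => sin (fst p) * cos (fst p)) (fun p => cos (fst p))) |
     apply (Rg_lin (-1) (-2));
     [apply (swap_cos' (fun x => cos x * cos x) (fun x => -2 * (sin x * cos x)) (fun x => -2 * (cos x * cos x - sin x * sin x))) |
      apply (Rg_lin 1 1);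
      [apply (Rg_W1 (fun x => cos x * cos x) (fun x => -2 * (sin x * cos x)) sin cos) |
       apply (Rg_W1 (fun x => sin x * cos x) (fun x => cos x * cos x - sin x * sin x) cos (fun x => - sin x))]]]|].
  all: try solve [trig_auto | t1_auto | der | apply is_derive_sin | apply is_derive_cos].
  intros p; unfold c3; repeat split; field [(cc (fst p)) (cc (snd p))].
Qed.

(** [swap_one] with [B = cos] relates this class to [cos x2 e1e1], the mirror image of
    [Rg_class_cos]. *)
Lemma Rg_class_cos2_cos :
  Rg (fun _ => 0) (fun _ => 0) (fun p => (1 - 2 * (sin (fst p) * sin (fst p))) * cos (snd p)).
Proof.
  eapply Rg_ext; [apply (Rg_lin 4 (-4));
    [exact Rg_class_e11_cos | apply (swap_one cos (fun x => -1 * sin x) (fun x => - cos x))]|].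
  all: try solve [t1_auto | der].
  intros p; repeat split; field.
Qed.

Lemma Rg_u1 u : trig u -> Rg (fun p => u p * sin (fst p)) (fun _ => 0) (fun _ => 0).
Proof.
  intros. eapply Rg_ext; [apply (Rg_alg u (fun _ => 0) (fun _ => 0)); auto using trig_const|].
  intros p; repeat split; ring.
Qed.
Lemma Rg_u2 u : trig u -> Rg (fun _ => 0) (fun _ => 0) (fun p => u p * sin (snd p)).
Proof.
  intros. eapply Rg_ext; [apply (Rg_alg (fun _ => 0) u (fun _ => 0)); auto using trig_const|].
  intros p; repeat split; ring.
Qed.

Lemma trig_prod A B : t1 A -> t1 B -> trig (fun p => A (fst p) * B (snd p)).
Proof. intros TA TB. apply trig_mult; [apply (t1_trig A true TA) | apply (t1_trig B false TB)]. Qed.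

(** After division of [B] by [sin x2], the multiple of [sin x2] is absorbed by [u2] and only the two
    special classes remain. *)
Lemma Rg_e22_cos B : t1 B -> Rg (fun _ => 0) (fun _ => 0) (fun p => cos (fst p) * B (snd p)).
Proof.
  intros TB. destruct (t1_mod_sin B TB) as (a & c & B1 & T1 & E).
  eapply Rg_ext; [apply (Rg_lin 1 1);
    [apply (Rg_lin a c _ _ _ _ _ _ Rg_class_cos Rg_class_cos_cos) | apply (Rg_u2 (fun p => cos (fst p) * B1 (snd p)))]|].
  - apply trig_prod; auto using t1_cos1.
  - intros p; rewrite E; repeat split; ring.
Qed.
Lemma Rg_e22_cos2 B : t1 B ->
  Rg (fun _ => 0) (fun _ => 0) (fun p => (1 - 2 * (sin (fst p) * sin (fst p))) * B (snd p)).
Proof.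
  intros TB. destruct (t1_mod_sin B TB) as (a & c & B1 & T1 & E).
  eapply Rg_ext; [apply (Rg_lin 1 1);
    [apply (Rg_lin a c _ _ _ _ _ _ Rg_class_cos2 Rg_class_cos2_cos) |
     apply (Rg_u2 (fun p => (1 + -2 * (sin (fst p) * sin (fst p))) * B1 (snd p)))]|].
  - apply (trig_prod (fun x => 1 + -2 * (sin x * sin x))); auto; t1_auto.
  - intros p; rewrite E; repeat split; ring.
Qed.

(** Division of [A] by [sin x1] leaves the profiles [1] and [cos x1]; trading turns them into [e2e2]
    entries with profiles [cos (2 x1)] and [cos x1], already known to be in the range. *)
Lemma Rg_e11 A B : t1 A -> t1 B -> Rg (fun p => A (fst p) * B (snd p)) (fun _ => 0) (fun _ => 0).
Proof.
  intros TA TB. destruct (t1_mod_sin A TA) as (a & c & A1 & T1 & E).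
  destruct (t1_der B TB) as (B' & TB' & D). destruct (t1_der B' TB') as (B'' & TB'' & D').
  eapply Rg_ext; [apply (Rg_lin 1 1);
    [apply (Rg_lin a (- / 4 * a) _ _ _ _ _ _ (swap_one B B' B'' TB TB' D D') (Rg_e22_cos2 B'' TB'')) |
     apply (Rg_lin 1 1);
     [apply (Rg_lin c (- c) _ _ _ _ _ _ (swap_cos B B' B'' TB TB' D D') (Rg_e22_cos B'' TB'')) |
      apply (Rg_u1 _ (trig_prod A1 B T1 TB))]]|].
  intros p; rewrite E; repeat split; field.
Qed.

Lemma Rg_e22 A B : t1 A -> t1 B -> Rg (fun _ => 0) (fun _ => 0) (fun p => A (fst p) * B (snd p)).
Proof.
  intros TA TB. destruct (t1_mod_sin B TB) as (a & c & B1 & T1 & E).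
  destruct (t1_der A TA) as (A' & TA' & D). destruct (t1_der A' TA') as (A'' & TA'' & D').
  assert (TC : t1 (fun x => 1 + -2 * (sin x * sin x))) by t1_auto.
  eapply Rg_ext; [apply (Rg_lin 1 1);
    [apply (Rg_lin a (- / 4 * a) _ _ _ _ _ _ (swap_one' A A' A'' TA TA' D D') (Rg_e11 A'' _ TA'' TC)) |
     apply (Rg_lin 1 1);
     [apply (Rg_lin c (- c) _ _ _ _ _ _ (swap_cos' A A' A'' TA TA' D D') (Rg_e11 A'' _ TA'' t1_cos1)) |
      apply (Rg_u2 _ (trig_prod A B1 TA T1))]]|].
  intros p; rewrite E; repeat split; field.
Qed.

(** The part of [A] with mean zero is integrated in [x1] at the price of an [e2e2] entry; what
    remains, [m B (x2)], is integrated in [x2] without any such price, up to the constant [m n]. *)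
Lemma Rg_e12 A B : t1 A -> t1 B -> Rg (fun _ => 0) (fun p => A (fst p) * B (snd p)) (fun _ => 0).
Proof.
  intros TA TB. destruct (t1_int A TA) as (m & A1 & TA1 & DA). destruct (t1_int B TB) as (n & B1 & TB1 & DB).
  destruct (t1_der B TB) as (B' & TB' & D).
  eapply Rg_ext; [apply (Rg_lin 2 (-2));
    [apply (Rg_W2 A1 (fun x => A x - m) B B') |
     apply (Rg_lin 1 (- m)); [apply (Rg_e22 A1 B') |
       apply (Rg_lin 1 (/ 2 * n)); [apply (Rg_W1 (fun _ => 1) (fun _ => 0) B1 (fun x => B x - n)) | apply Rg_e12_one]]]|];
  auto using t1_c.
  - intros x; apply (is_derive_const (V := R_NormedModule)).
  - intros p; repeat split; field.
Qed.

Lemma Rg_all F11 F12 F22 : trig F11 -> trig F12 -> trig F22 -> Rg F11 F12 F22.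
Proof.
  intros H1 H2 H3.
  assert (Z : forall f, sp f -> Rg f (fun _ => 0) (fun _ => 0) /\ Rg (fun _ => 0) f (fun _ => 0) /\ Rg (fun _ => 0) (fun _ => 0) f).
  { induction 1 as [A B TA TB | f g _ (I1 & I2 & I3) _ (J1 & J2 & J3)].
    - split; [apply Rg_e11 | split; [apply Rg_e12 | apply Rg_e22]]; auto.
    - split; [|split].
      + eapply Rg_ext; [exact (Rg_lin 1 1 _ _ _ _ _ _ I1 J1)|]; intros p; repeat split; ring.
      + eapply Rg_ext; [exact (Rg_lin 1 1 _ _ _ _ _ _ I2 J2)|]; intros p; repeat split; ring.
      + eapply Rg_ext; [exact (Rg_lin 1 1 _ _ _ _ _ _ I3 J3)|]; intros p; repeat split; ring. }
  destruct (Z _ (trig_sp _ H1)) as (I1 & _ & _), (Z _ (trig_sp _ H2)) as (_ & I2 & _), (Z _ (trig_sp _ H3)) as (_ & _ & I3).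
  eapply Rg_ext; [exact (Rg_lin 1 1 _ _ _ _ _ _ I1 (Rg_lin 1 1 _ _ _ _ _ _ I2 I3))|].
  intros p; repeat split; ring.
Qed.

(** * Approximate solutions of the cell problem *)

Inductive ix := j1 | j2 | j3.
Definition sum3 (F : ix -> R) : R := F j1 + F j2 + F j3.

Definition s3 (p : pt) : R := sin (fst p) * cos (snd p) + cos (fst p) * sin (snd p).

Definition P0 (j : ix) : pt -> R :=
  match j with
  | j1 => fun p => sin (crd true p)
  | j2 => fun p => sin (crd false p)
  | j3 => c3
  end.
Definition dP0 (j : ix) (a : bool) : pt -> R :=
  match j with
  | j1 => fun p => if a then cos (crd true p) else 0
  | j2 => fun p => if a then 0 else cos (crd false p)
  | j3 => fun p => - s3 p
  end.
Definition ddP0 (j : ix) (a b : bool) : pt -> R :=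
  match j with
  | j1 => fun p => if a then (if b then - sin (crd true p) else 0) else 0
  | j2 => fun p => if a then 0 else (if b then 0 else - sin (crd false p))
  | j3 => fun p => - c3 p
  end.

Lemma trig_P0 j : trig (P0 j).
Proof. destruct j; [apply (trig_sin true) | apply (trig_sin false) | apply trig_c3]. Qed.

Lemma pd_P0 j a : pd a (P0 j) = dP0 j a.
Proof.
  apply functional_extensionality; intros p. apply is_derive_unique.
  destruct j, a; simpl; unfold upd, crd, c3, s3; simpl; auto_derive; auto; ring.
Qed.
Lemma pd_dP0 j a b : pd b (dP0 j a) = ddP0 j a b.
Proof.
  apply functional_extensionality; intros p. apply is_derive_unique.
  destruct j, a, b; simpl; unfold upd, crd, c3, s3; simpl; auto_derive; auto; ring.
Qed.
Lemma trig_dP0 j a : trig (dP0 j a).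
Proof. rewrite <- pd_P0. apply trig_pd, trig_P0. Qed.

(** By the Leibniz rule [sym (DP^T Du)] is the symmetric gradient of [u . DP] minus [u . D^2 P].
    Choosing [W = V - u . DP] removes all derivatives of [u], which leaves the algebraic problem
    described by [Rg]. *)
Lemma torus_solve (F : bool -> bool -> pt -> R) :
  (forall a b, trig (F a b)) -> (forall a b p, F a b p = F b a p) ->
  exists (u : ix -> pt -> R) (W : bool -> pt -> R),
    (forall j, trig (u j)) /\ (forall b, trig (W b)) /\ forall a b p,
    sum3 (fun j => / 2 * (dP0 j a p * pd b (u j) p + dP0 j b p * pd a (u j) p))
      + / 2 * (pd a (W b) p + pd b (W a) p) = F a b p.
Proof.
  intros HF Hs.
  destruct (Rg_all (F true true) (F true false) (F false false))
    as (u1 & u2 & u3 & W1 & W2 & T1 & T2 & T3 & T4 & T5 & E); auto.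
  set (u := fun j => match j with j1 => u1 | j2 => u2 | j3 => u3 end).
  set (V := fun b : bool => if b then W1 else W2).
  assert (Tu : forall j, trig (u j)) by (intros []; auto).
  assert (TV : forall b, trig (V b)) by (intros []; auto).
  exists u, (fun b p => V b p - (u j1 p * dP0 j1 b p + u j2 p * dP0 j2 b p + u j3 p * dP0 j3 b p)).
  split; auto. split.
  { intros b. apply trig_minus; auto. auto using trig_plus, trig_mult, trig_dP0. }
  assert (D : forall a b, pd a (fun p => V b p - (u j1 p * dP0 j1 b p + u j2 p * dP0 j2 b p + u j3 p * dP0 j3 b p))
    = fun p => pd a (V b) p - ((pd a (u j1) p * dP0 j1 b p + u j1 p * ddP0 j1 b a p)
       + (pd a (u j2) p * dP0 j2 b p + u j2 p * ddP0 j2 b a p) + (pd a (u j3) p * dP0 j3 b p + u j3 p * ddP0 j3 b a p))).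
  { intros a b.
    assert (Eu : forall j, exd a (fun p => u j p * dP0 j b p) /\
       pd a (fun p => u j p * dP0 j b p) = fun p => pd a (u j) p * dP0 j b p + u j p * ddP0 j b a p).
    { intros j. rewrite <- pd_dP0. apply exd_mult; apply trig_pd; auto using trig_dP0. }
    destruct (Eu j1) as [X1 Y1], (Eu j2) as [X2 Y2], (Eu j3) as [X3 Y3].
    destruct (exd_plus a _ _ X1 X2) as [X4 Y4]. destruct (exd_plus a _ _ X4 X3) as [X5 Y5].
    destruct (exd_minus a _ _ (proj1 (trig_pd _ (TV b) a)) X5) as [_ ->].
    rewrite Y5, Y4, Y1, Y2, Y3. reflexivity. }
  intros a b p. rewrite !D. unfold sum3.
  destruct (E p) as (E1 & E2 & E3).
  destruct a, b; [rewrite E1 | rewrite E2 | rewrite (Hs false true), E2 | rewrite E3];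
    unfold u, V; simpl; field.
Qed.

(** * Families of two-scale trigonometric polynomials with uniform constants *)

Section Families.
Context {I : Type} (rho : I -> R).
Hypothesis Hrho : forall i, 0 < rho i <= 1.

(* The constants are uniform over the family. *)
Definition Slow (n k : nat) (f : I -> pt -> R) : Prop :=
  exists C, 0 <= C /\ forall i, sm n (f i) /\ forall p, bdp n (rho i) (C * rho i ^ k) (f i) p.

Lemma rho_pow k i : 0 <= rho i ^ k.
Proof. apply pow_le. destruct (Hrho i); lra. Qed.
Lemma rho_pow_le k l i : (k <= l)%nat -> rho i ^ l <= rho i ^ k.
Proof.
  induction 1 as [|l _ IH]; [lra|]. simpl. eapply Rle_trans; [|exact IH].
  rewrite <- (Rmult_1_l (rho i ^ l)) at 2. apply Rmult_le_compat_r; [apply rho_pow | apply Hrho].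
Qed.

Lemma Slow_weaken n n' k k' f : (n' <= n)%nat -> (k' <= k)%nat -> Slow n k f -> Slow n' k' f.
Proof.
  intros Hn Hk (C & HC & H). exists C; split; auto. intros i. destruct (H i) as [S B].
  assert (0 < rho i <= 1) by auto.
  split; [eapply sm_le; eauto|]. intros p. apply (bdp_le_n n' n); auto.
  apply (bdp_le _ _ (C * rho i ^ k)); [lra | | auto].
  apply Rmult_le_compat_l; auto. apply rho_pow_le; auto.
Qed.
Lemma Slow_mult n k l f g : Slow n k f -> Slow n l g -> Slow n (k + l) (fun i p => f i p * g i p).
Proof.
  intros (C & HC & H) (D & HD & H'). exists (2 ^ n * (C * D)); split.
  - apply Rmult_le_pos; [apply pow_le; lra | apply Rmult_le_pos; auto].
  - intros i. destruct (H i) as [S B], (H' i) as [S' B']. assert (0 < rho i <= 1) by auto.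
    split; auto using sm_mult. intros p.
    replace (2 ^ n * (C * D) * rho i ^ (k + l)) with (2 ^ n * ((C * rho i ^ k) * (D * rho i ^ l)))
      by (rewrite pow_add; ring).
    apply bdp_mult; auto; lra.
Qed.
Lemma Slow_pd n k f b : Slow (S n) k f -> Slow n (S k) (fun i => pd b (f i)).
Proof.
  intros (C & HC & H). exists C; split; auto. intros i. destruct (H i) as [S B].
  split; [apply sm_pd; auto|]. intros p.
  replace (C * rho i ^ Datatypes.S k) with (rho i * (C * rho i ^ k)) by (simpl; ring). apply bdp_pd; auto.
Qed.
Lemma Slow_exd n k f b i : Slow (S n) k f -> exd b (f i).
Proof. intros (C & HC & H). destruct (H i) as [S _]. eapply sm_exd; eauto. Qed.
Lemma Slow_const n c : Slow n 0 (fun _ _ => c).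
Proof.
  exists (Rabs c); split; [apply Rabs_pos|]. intros i. split; [apply sm_const|]. intros p.
  rewrite Rmult_1_r. apply bdp_const. destruct (Hrho i); lra.
Qed.
Lemma Slow_zero n k : Slow n k (fun _ _ => 0).
Proof.
  exists 0; split; [lra|]. intros i. split; [apply sm_const|]. intros p.
  replace (0 * rho i ^ k) with (Rabs 0) by (rewrite Rabs_R0; ring). apply bdp_const. destruct (Hrho i); lra.
Qed.

(** The number of terms and the torus factors [t] are common to the whole family; only the slow
    coefficients depend on [i]. This makes the bounds below uniform. *)
Inductive TP (n k : nat) : (I -> pt -> R) -> Prop :=
| TP_mono c t : Slow n k c -> trig t -> TP n k (fun i p => c i p * t p)
| TP_plus f g : TP n k f -> TP n k g -> TP n k (fun i p => f i p + g i p).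

Lemma TP_ext n k f g : (forall i p, f i p = g i p) -> TP n k f -> TP n k g.
Proof.
  intros H. replace g with f; auto.
  apply functional_extensionality; intros i; apply functional_extensionality; auto.
Qed.
Lemma TP_weaken n n' k k' f : (n' <= n)%nat -> (k' <= k)%nat -> TP n k f -> TP n' k' f.
Proof.
  intros Hn Hk. induction 1; [apply TP_mono | apply TP_plus]; auto. eapply Slow_weaken; eauto.
Qed.
Lemma TP_slow n k c : Slow n k c -> TP n k c.
Proof. intros. apply (TP_ext _ _ (fun i p => c i p * 1)); [intros; ring|]. apply (TP_mono _ _ c (fun _ => 1)); auto using trig_const. Qed.
Lemma TP_trig n t : trig t -> TP n 0 (fun _ => t).
Proof. intros. apply (TP_ext _ _ (fun i p => 1 * t p)); [intros; ring|]. apply (TP_mono _ _ (fun _ _ => 1)); auto using Slow_const. Qed.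
Lemma TP_mult n k l f g : TP n k f -> TP n l g -> TP n (k + l) (fun i p => f i p * g i p).
Proof.
  intros Hf; revert g; induction Hf as [c t Hc Ht | f f' _ IH1 _ IH2]; intros g Hg.
  - induction Hg as [c' t' Hc' Ht' | g g' _ IH1 _ IH2].
    + apply (TP_ext _ _ (fun i p => (c i p * c' i p) * (t p * t' p))); [intros; ring|].
      apply (TP_mono _ _ (fun i p => c i p * c' i p) (fun p => t p * t' p)); auto using Slow_mult, trig_mult.
    + eapply TP_ext; [|apply TP_plus; [exact IH1 | exact IH2]]. intros; simpl; ring.
  - eapply TP_ext; [|apply TP_plus; [apply (IH1 g Hg) | apply (IH2 g Hg)]]. intros; simpl; ring.
Qed.
Lemma TP_scal n k c f : TP n k f -> TP n k (fun i p => c * f i p).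
Proof.
  intros. apply (TP_mult n 0 k (fun _ _ => c) f); auto. apply TP_slow, Slow_const.
Qed.
Lemma TP_minus n k f g : TP n k f -> TP n k g -> TP n k (fun i p => f i p - g i p).
Proof.
  intros Hf Hg. apply (TP_ext _ _ (fun i p => f i p + -1 * g i p)); [intros; ring|].
  apply TP_plus; auto using TP_scal.
Qed.
Lemma TP_zero n k : TP n k (fun _ _ => 0).
Proof. apply TP_slow, Slow_zero. Qed.

(** The order [k] does not improve, since the derivative may fall on the fast factor, while one
    derivative of the coefficients is spent. *)
Lemma TP_pd n k f b : TP (S n) k f -> (forall i, exd b (f i)) /\ TP n k (fun i => pd b (f i)).
Proof.
  induction 1 as [c t Hc Ht | f g _ [E1 T1] _ [E2 T2]].
  - destruct (trig_pd t Ht b) as [Et Tt].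
    assert (E := fun i => exd_mult b (c i) t (Slow_exd n k c b i Hc) Et).
    split; [intros i; apply E|].
    apply (TP_ext _ _ (fun i p => pd b (c i) p * t p + c i p * pd b t p)).
    { intros i p. rewrite (proj2 (E i)). auto. }
    apply TP_plus; [apply (TP_mono _ _ (fun i => pd b (c i))) | apply TP_mono]; auto.
    + apply (Slow_weaken n _ (S k)); auto. apply Slow_pd; auto.
    + apply (Slow_weaken (S n) _ k); auto.
  - assert (E := fun i => exd_plus b (f i) (g i) (E1 i) (E2 i)).
    split; [intros i; apply E|].
    apply (TP_ext _ _ (fun i p => pd b (f i) p + pd b (g i) p)).
    { intros i p. rewrite (proj2 (E i)). auto. }
    apply TP_plus; auto.
Qed.

Lemma trig_bounded t : trig t -> exists C, 0 <= C /\ forall p, Rabs (t p) <= C.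
Proof.
  induction 1 as [c | b | b | f g _ (C & HC & H) _ (D & HD & H') | f g _ (C & HC & H) _ (D & HD & H')].
  - exists (Rabs c); split; auto using Rabs_pos, Rle_refl.
  - exists 1; split; [lra|]. intros p. apply Rabs_le, SIN_bound.
  - exists 1; split; [lra|]. intros p. apply Rabs_le, COS_bound.
  - exists (C + D); split; [lra|]. intros p. eapply Rle_trans; [apply Rabs_triang|]. apply Rplus_le_compat; auto.
  - exists (C * D); split; [apply Rmult_le_pos; auto|]. intros p. rewrite Rabs_mult.
    apply Rmult_le_compat; auto using Rabs_pos.
Qed.

Lemma cont_trig t : trig t -> cont t.
Proof.
  induction 1; auto using cont_const, cont_plus, cont_mult.
  - intros p. apply (continuous_comp (crd b) sin); [apply cont_crd|]. apply continuity_pt_filterlim, continuity_sin.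
  - intros p. apply (continuous_comp (crd b) cos); [apply cont_crd|]. apply continuity_pt_filterlim, continuity_cos.
Qed.

Lemma TP_bound n k f : TP n k f -> exists C, 0 <= C /\ forall i, cont (f i) /\ forall p, Rabs (f i p) <= C * rho i ^ k.
Proof.
  induction 1 as [c t (C & HC & H) Ht | f g _ (C & HC & H) _ (D & HD & H')].
  - destruct (trig_bounded t Ht) as (D & HD & HD').
    exists (C * D); split; [apply Rmult_le_pos; auto|]. intros i. destruct (H i) as [S B]. split.
    + apply cont_mult; [eapply sm_cont; eauto | apply cont_trig; auto].
    + intros p. rewrite Rabs_mult. replace (C * D * rho i ^ k) with ((C * rho i ^ k) * D) by ring.
      apply Rmult_le_compat; auto using Rabs_pos. eapply bdp_abs; eauto.
  - exists (C + D); split; [lra|]. intros i. destruct (H i) as [S B], (H' i) as [S' B'].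
    split; auto using cont_plus. intros p. eapply Rle_trans; [apply Rabs_triang|].
    rewrite Rmult_plus_distr_r. apply Rplus_le_compat; auto.
Qed.

Lemma TP_bdp n k f : TP n k f -> exists C, 0 <= C /\ forall i, sm n (f i) /\ forall p, bdp n 1 C (f i) p.
Proof.
  revert f; induction n as [|n IH]; intros f Hf; destruct (TP_bound _ _ _ Hf) as (C & HC & H).
  all: assert (H1 : forall i p, Rabs (f i p) <= C).
  1,3: intros i p; eapply Rle_trans; [apply H|]; rewrite <- (Rmult_1_r C) at 2;
    apply Rmult_le_compat_l; auto; rewrite <- (pow_O (rho i)); apply rho_pow_le; lia.
  - exists C; split; auto. intros i; split; [split; auto; apply H | intros p; split; auto].
  - assert (HD := fun b => TP_pd n k f b Hf).
    destruct (IH _ (proj2 (HD true))) as (D1 & HD1 & B1). destruct (IH _ (proj2 (HD false))) as (D2 & HD2 & B2).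
    exists (C + D1 + D2); split; [lra|]. intros i; split.
    + split; [apply H|]. intros b. split; [apply HD|]. destruct b; [apply B1 | apply B2].
    + intros p. split; [eapply Rle_trans; [apply H1 | lra]|].
      intros b. rewrite Rmult_1_l. destruct b; [apply (bdp_le _ _ D1) | apply (bdp_le _ _ D2)]; try lra; [apply B1 | apply B2].
Qed.

Definition solvable (n k : nat) (F : bool -> bool -> I -> pt -> R) : Prop :=
  exists (Y : ix -> I -> pt -> R) (Z : bool -> I -> pt -> R) (Rr : bool -> bool -> I -> pt -> R),
    (forall j, TP (S n) k (Y j)) /\ (forall b, TP (S n) k (Z b)) /\
    (forall a b, TP n (S k) (Rr a b)) /\ (forall a b i p, Rr a b i p = Rr b a i p) /\
    forall a b i p, F a b i p =
      sum3 (fun j => / 2 * (dP0 j a p * pd b (Y j i) p + dP0 j b p * pd a (Y j i) p))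
      + / 2 * (pd a (Z b i) p + pd b (Z a i) p) + Rr a b i p.

Lemma solvable_plus n k F G : solvable n k F -> solvable n k G ->
  solvable n k (fun a b i p => F a b i p + G a b i p).
Proof.
  intros (Y & Z & Rr & TY & TZ & TR & Sy & E) (Y' & Z' & Rr' & TY' & TZ' & TR' & Sy' & E').
  exists (fun j i p => Y j i p + Y' j i p), (fun b i p => Z b i p + Z' b i p), (fun a b i p => Rr a b i p + Rr' a b i p).
  split; [intros; apply TP_plus; auto|]. split; [intros; apply TP_plus; auto|]. split; [intros; apply TP_plus; auto|].
  split; [intros; rewrite (Sy a b), (Sy' a b); auto|].
  intros a b i p. rewrite E, E'.
  assert (DY : forall j c, pd c (fun p => Y j i p + Y' j i p) p = pd c (Y j i) p + pd c (Y' j i) p).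
  { intros j c. rewrite (proj2 (exd_plus c (Y j i) (Y' j i) (proj1 (TP_pd _ _ _ c (TY j)) i) (proj1 (TP_pd _ _ _ c (TY' j)) i))). auto. }
  assert (DZ : forall j c, pd c (fun p => Z j i p + Z' j i p) p = pd c (Z j i) p + pd c (Z' j i) p).
  { intros j c. rewrite (proj2 (exd_plus c (Z j i) (Z' j i) (proj1 (TP_pd _ _ _ c (TZ j)) i) (proj1 (TP_pd _ _ _ c (TZ' j)) i))). auto. }
  unfold sum3. rewrite !DY, !DZ. ring.
Qed.

Lemma solvable_ext n k F G : (forall a b i p, F a b i p = G a b i p) -> solvable n k F -> solvable n k G.
Proof.
  intros H (Y & Z & Rr & TY & TZ & TR & Sy & E). exists Y, Z, Rr. 
  do 4 (split; auto). intros; rewrite <- H; auto.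
Qed.

(* A slow coefficient commutes with the torus solution operator up to its own derivatives. *)
Lemma solvable_entry n k (M : bool -> bool -> R) f : (forall a b, M a b = M b a) ->
  TP (S n) k f -> solvable n k (fun a b i p => M a b * f i p).
Proof.
  intros HM. induction 1 as [c t Hc Ht | f g _ IH1 _ IH2].
  2:{ eapply solvable_ext; [|apply solvable_plus; [exact IH1 | exact IH2]]. intros; simpl; ring. }
  destruct (torus_solve (fun a b p => M a b * t p)) as (u & W & Tu & TW & E).
  { intros; apply trig_scal; auto. }
  { intros; rewrite (HM a b); auto. }
  assert (Ec := fun i b => Slow_exd n k c b i Hc).
  exists (fun j i p => c i p * u j p), (fun b i p => c i p * W b p),
    (fun a b i p => pd a (c i) p * (- / 2 * (dP0 j1 b p * u j1 p + dP0 j2 b p * u j2 p + dP0 j3 b p * u j3 p + W b p))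
                  + pd b (c i) p * (- / 2 * (dP0 j1 a p * u j1 p + dP0 j2 a p * u j2 p + dP0 j3 a p * u j3 p + W a p))).
  split; [intros; apply TP_mono; auto|]. split; [intros; apply TP_mono; auto|].
  split; [|split].
  - intros a b. 
    apply TP_plus; apply (TP_mono _ _ (fun i => pd _ (c i)));
      try (apply Slow_pd; auto); apply trig_scal; auto 10 using trig_plus, trig_mult, trig_dP0.
  - intros; ring.
  - intros a b i p. rewrite <- Rmult_assoc, (Rmult_comm (M a b)), Rmult_assoc. rewrite <- E.
    assert (DY : forall j d, pd d (fun p => c i p * u j p) p = pd d (c i) p * u j p + c i p * pd d (u j) p).
    { intros j d. rewrite (proj2 (exd_mult d (c i) (u j) (Ec i d) (proj1 (trig_pd _ (Tu j) d)))). auto. }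
    assert (DZ : forall j d, pd d (fun p => c i p * W j p) p = pd d (c i) p * W j p + c i p * pd d (W j) p).
    { intros j d. rewrite (proj2 (exd_mult d (c i) (W j) (Ec i d) (proj1 (trig_pd _ (TW j) d)))). auto. }
    unfold sum3. rewrite !DY, !DZ. field.
Qed.

Lemma solvable_all n k F : (forall a b, TP (S n) k (F a b)) -> (forall a b i p, F a b i p = F b a i p) ->
  solvable n k F.
Proof.
  intros T Sy.
  eapply solvable_ext; [|apply solvable_plus;
    [apply (solvable_entry n k (fun a b => if a then (if b then 1 else 0) else 0) (F true true)) |
     apply solvable_plus;
     [apply (solvable_entry n k (fun a b => if a then (if b then 0 else 1) else (if b then 1 else 0)) (F true false)) |
      apply (solvable_entry n k (fun a b => if a then 0 else (if b then 0 else 1)) (F false false))]]]; auto.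
  - intros [] [] i p; simpl; rewrite ?(Sy false true); ring.
  - intros [] []; auto.
  - intros [] []; auto.
  - intros [] []; auto.
Qed.

Context (H : bool -> bool -> I -> pt -> R) (K : ix -> bool -> bool -> I -> pt -> R).

(** [K] stands for the rescaled second derivatives of [v]: the term [P . K] is what the correction
    of [w] leaves behind. [N] is the order of the residual and [n] the regularity left. *)
Definition approx (n N : nat) : Prop :=
  exists (q : ix -> I -> pt -> R) (w : bool -> I -> pt -> R) (Rr : bool -> bool -> I -> pt -> R),
    (forall j, TP (S n) 1 (q j)) /\ (forall b, TP (S n) 0 (w b)) /\
    (forall a b, TP n N (Rr a b)) /\ (forall a b i p, Rr a b i p = Rr b a i p) /\
    forall a b i p, H a b i p =
      sum3 (fun j => / 2 * ((dP0 j a p + pd a (q j i) p) * (dP0 j b p + pd b (q j i) p)))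
      + / 2 * (pd a (w b i) p + pd b (w a i) p)
      - sum3 (fun j => (P0 j p + q j i p) * K j a b i p) + Rr a b i p.

(** The correction [Y] of order [N] solves the equation linearised at [P0], not at [P0 + q]. All
    that it neglects has order at least [N + 1]: [Dq . DY] because [q] has order one, [DY . DY]
    because [N >= 1], and [Y . K] because [K] has order one. *)
Lemma approx_step n N : (1 <= N)%nat ->
  (forall j a b, Slow n 1 (K j a b)) -> (forall j a b i p, K j a b i p = K j b a i p) ->
  approx (S n) N -> approx n (S N).
Proof.
  intros HN HK KS (q & w & Rr & Tq & Tw & TR & Sy & E).
  destruct (solvable_all n N Rr TR Sy) as (Y & Z & R' & TY & TZ & TR' & Sy' & E').
  exists (fun j i p => q j i p + Y j i p), (fun b i p => w b i p + Z b i p),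
    (fun a b i p => R' a b i p
       - sum3 (fun j => / 2 * (pd a (q j i) p * pd b (Y j i) p + pd b (q j i) p * pd a (Y j i) p))
       - sum3 (fun j => / 2 * (pd a (Y j i) p * pd b (Y j i) p))
       + sum3 (fun j => Y j i p * K j a b i p)).
  assert (W1 : forall j, TP (S n) 1 (Y j)) by (intros j; apply (TP_weaken (S n) _ N); auto).
  assert (Tq' : forall j, TP (S n) 1 (q j)) by (intros j; apply (TP_weaken (S (S n)) _ 1); auto).
  split; [intros; apply TP_plus; auto|].
  split; [intros; apply TP_plus; [apply (TP_weaken (S (S n)) _ 0) | apply (TP_weaken (S n) _ N)]; auto; lia|].
  split; [|split].
  - intros a b. unfold sum3.
    assert (Dq : forall c j, TP n 1 (fun i => pd c (q j i))) by (intros c j; apply (TP_pd n 1 (q j)); auto).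
    assert (DY : forall c j, TP n N (fun i => pd c (Y j i))) by (intros c j; apply (TP_pd n N (Y j)); auto).
    assert (DY' : forall c j, TP n 1 (fun i => pd c (Y j i))) by (intros c j; apply (TP_pd n 1 (Y j)); auto).
    assert (X1 : forall j c d, TP n (S N) (fun i p => pd c (q j i) p * pd d (Y j i) p))
      by (intros; apply (TP_mult n 1 N (fun i => pd c (q j i))); auto).
    assert (X2 : forall j c d, TP n (S N) (fun i p => pd c (Y j i) p * pd d (Y j i) p))
      by (intros; apply (TP_mult n 1 N (fun i => pd c (Y j i))); auto).
    assert (X3 : forall j, TP n (S N) (fun i p => Y j i p * K j a b i p)).
    { intros j. rewrite <- Nat.add_1_r. apply (TP_mult n N 1 (Y j)).
      - apply (TP_weaken (S n) _ N); auto.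
      - apply TP_slow; auto. }
    apply TP_plus; [apply TP_minus; [apply TP_minus; auto|]|]; repeat apply TP_plus; auto.
    all: apply TP_scal; auto; apply TP_plus; auto.
  - intros a b i p. rewrite (Sy' a b). unfold sum3. rewrite !(KS _ a b). ring.
  - intros a b i p. rewrite E, E'.
    assert (DY : forall j c, pd c (fun p => q j i p + Y j i p) p = pd c (q j i) p + pd c (Y j i) p).
    { intros j c. rewrite (proj2 (exd_plus c (q j i) (Y j i) (proj1 (TP_pd _ _ _ c (Tq j)) i) (proj1 (TP_pd _ _ _ c (TY j)) i))). auto. }
    assert (DZ : forall j c, pd c (fun p => w j i p + Z j i p) p = pd c (w j i) p + pd c (Z j i) p).
    { intros j c. rewrite (proj2 (exd_plus c (w j i) (Z j i) (proj1 (TP_pd _ _ _ c (Tw j)) i) (proj1 (TP_pd _ _ _ c (TZ j)) i))). auto. }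
    unfold sum3. rewrite !DY, !DZ. field.
Qed.

Lemma approx_iter N n : (forall j a b, Slow (N + n) 1 (K j a b)) -> (forall j a b i p, K j a b i p = K j b a i p) ->
  approx (N + n) 1 -> approx n (S N).
Proof.
  revert n; induction N as [|N IH]; intros n HK KS HA; auto.
  apply approx_step; auto; [lia | | apply IH; auto].
  - intros j a b. apply (Slow_weaken (S N + n) _ 1); auto; lia.
  - intros j a b. replace (N + S n)%nat with (S N + n)%nat by lia. auto.
  - replace (N + S n)%nat with (S N + n)%nat by lia. auto.
Qed.
End Families.

Definition h0 (a b : bool) : R := if Bool.eqb a b then / 2 else / 4.

(* [h0] is the average of [1/2 DP0^T DP0]; this field corrects the oscillating part of the latter. *)
Definition W0 (a : bool) : pt -> R := fun p =>
  / 4 * ((if a then - (sin (fst p) * cos (fst p)) else - (sin (snd p) * cos (snd p))) + s3 p * c3 p).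

Lemma W0_spec a b p :
  sum3 (fun j => / 2 * (dP0 j a p * dP0 j b p)) + / 2 * (pd a (W0 b) p + pd b (W0 a) p) = h0 a b.
Proof.
  assert (D : forall a b, pd a (W0 b) = fun p => / 4 * ((if Bool.eqb a b then 1 - 2 * (cos (crd a p) * cos (crd a p)) else 0)
     + (c3 p * c3 p - s3 p * s3 p))).
  { intros a' b'. apply functional_extensionality; intros q. apply is_derive_unique. unfold W0, c3, s3.
    destruct a', b'; simpl; auto_derive; auto; field [(cc (fst q)) (cc (snd q))]. }
  rewrite !D. unfold sum3, h0.
  destruct a, b; simpl; unfold c3, s3; field [(cc (fst p)) (cc (snd p))].
Qed.

Lemma trig_W0 a : trig (W0 a).
Proof.
  unfold W0, s3. destruct a.
  - apply (trig_ext (fun p => / 4 * ((-1 * (sin (crd true p) * cos (crd true p))) + (sin (crd true p) * cos (crd false p) + cos (crd true p) * sin (crd false p)) * c3 p))).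
    + intros p; simpl; ring.
    + trig_auto.
  - apply (trig_ext (fun p => / 4 * ((-1 * (sin (crd false p) * cos (crd false p))) + (sin (crd true p) * cos (crd false p) + cos (crd true p) * sin (crd false p)) * c3 p))).
    + intros p; simpl; ring.
    + trig_auto.
Qed.

(** Of the [N + 2] derivatives of the data, [N] are spent on the correction steps and two remain to
    bound the second derivatives of the perturbation. [C] depends on [N] and [C0] only. *)
Lemma cell N C0 : 0 <= C0 -> exists C, 0 < C /\
  forall (r : R) (K : ix -> bool -> bool -> pt -> R) (g : bool -> bool -> pt -> R),
  0 < r <= 1 ->
  (forall j a b, sm (N + 2) (K j a b) /\ forall p, bdp (N + 2) r (C0 * r) (K j a b) p) ->
  (forall a b, sm (N + 2) (g a b) /\ forall p, bdp (N + 2) r (C0 * r) (g a b) p) ->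
  (forall j a b p, K j a b p = K j b a p) -> (forall a b p, g a b p = g b a p) ->
  exists (P : ix -> pt -> R) (W : bool -> pt -> R),
    (forall j, sm 2 (P j) /\ forall p, bdp 2 1 C (P j) p) /\
    (forall b, sm 2 (W b) /\ forall p, bdp 2 1 C (W b) p) /\
    forall a b p, Rabs (h0 a b + g a b p -
      (sum3 (fun j => / 2 * (pd a (P j) p * pd b (P j) p)) + / 2 * (pd a (W b) p + pd b (W a) p)
       - sum3 (fun j => P j p * K j a b p))) <= C * r ^ S N.
Proof.
  intros HC0.
  set (good := fun x : R * (ix -> bool -> bool -> pt -> R) * (bool -> bool -> pt -> R) =>
    let '(r, K, g) := x in 0 < r <= 1 /\
    (forall j a b, sm (N + 2) (K j a b) /\ forall p, bdp (N + 2) r (C0 * r) (K j a b) p) /\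
    (forall a b, sm (N + 2) (g a b) /\ forall p, bdp (N + 2) r (C0 * r) (g a b) p) /\
    (forall j a b p, K j a b p = K j b a p) /\ (forall a b p, g a b p = g b a p)).
  (* Uniformity in the data comes from taking all admissible triples as the index set of one
     family. *)
  set (I := {x | good x}).
  set (rho := fun i : I => fst (fst (proj1_sig i))).
  set (KK := fun j a b (i : I) => snd (fst (proj1_sig i)) j a b).
  set (gg := fun a b (i : I) => snd (proj1_sig i) a b).
  assert (Hrho : forall i, 0 < rho i <= 1) by (intros [[[r K] g] Hg]; apply Hg).
  assert (HK : forall j a b, Slow rho (N + 2) 1 (KK j a b)).
  { intros j a b. exists C0; split; auto. intros [[[r K] g] Hg]. unfold KK, rho; simpl. rewrite Rmult_1_r. apply Hg. }
  assert (Hg : forall a b, Slow rho (N + 2) 1 (gg a b)).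
  { intros a b. exists C0; split; auto. intros [[[r K] g] Hg]. unfold gg, rho; simpl. rewrite Rmult_1_r. apply Hg. }
  assert (KS : forall j a b i p, KK j a b i p = KK j b a i p) by (intros j a b [[[r K] g] Hi] p; apply Hi).
  assert (gS : forall a b i p, gg a b i p = gg b a i p) by (intros a b [[[r K] g] Hi] p; apply Hi).
  assert (A : approx rho (fun a b i p => h0 a b + gg a b i p) KK 2 (S N)).
  { apply approx_iter; auto.
    (* Starting point: without correction the residual is [g + P0 . K], which has order one. *)
    exists (fun _ _ _ => 0), (fun b _ => W0 b), (fun a b i p => gg a b i p + sum3 (fun j => P0 j p * KK j a b i p)).
    split; [intros; apply TP_zero; auto|]. split; [intros; apply TP_trig; auto using trig_W0|].
    split; [|split].
    - intros a b. apply TP_plus; [apply TP_slow; auto|]. unfold sum3.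
      assert (X : forall j, TP rho (N + 2) 1 (fun i p => P0 j p * KK j a b i p)).
      { intros j. apply (TP_mult rho Hrho (N + 2) 0 1 (fun _ => P0 j) (KK j a b)); [apply TP_trig | apply TP_slow]; auto using trig_P0. }
      apply TP_plus; [apply TP_plus|]; apply X.
    - intros a b i p. rewrite (gS a b). unfold sum3. rewrite !(KS _ a b). ring.
    - intros a b i p. rewrite <- (W0_spec a b p). rewrite !(proj2 (exd_const _ 0)). unfold sum3. ring. }
  destruct A as (q & w & Rr & Tq & Tw & TR & _ & E).
  assert (TP3 : forall j, TP rho 2 0 (fun i p => P0 j p + q j i p)).
  { intros j. apply TP_plus; [apply TP_trig; auto using trig_P0|]. apply (TP_weaken rho Hrho 3 _ 1); auto. }
  assert (Tw2 : forall b, TP rho 2 0 (w b)) by (intros b; apply (TP_weaken rho Hrho 3 _ 0); auto).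
  destruct (TP_bdp rho Hrho _ _ _ (TP3 j1)) as (C1 & HC1 & B1).
  destruct (TP_bdp rho Hrho _ _ _ (TP3 j2)) as (C2 & HC2 & B2).
  destruct (TP_bdp rho Hrho _ _ _ (TP3 j3)) as (C3 & HC3 & B3).
  destruct (TP_bdp rho Hrho _ _ _ (Tw2 true)) as (C4 & HC4 & B4).
  destruct (TP_bdp rho Hrho _ _ _ (Tw2 false)) as (C5 & HC5 & B5).
  destruct (TP_bound rho _ _ _ (TR true true)) as (C6 & HC6 & B6).
  destruct (TP_bound rho _ _ _ (TR true false)) as (C7 & HC7 & B7).
  destruct (TP_bound rho _ _ _ (TR false true)) as (C8 & HC8 & B8).
  destruct (TP_bound rho _ _ _ (TR false false)) as (C9 & HC9 & B9).
  set (C := 1 + C1 + C2 + C3 + C4 + C5 + C6 + C7 + C8 + C9).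
  exists C; split; [unfold C; lra|].
  intros r K g Hr HK' Hg' KS' gS'.
  set (i := exist good (r, K, g) (conj Hr (conj HK' (conj Hg' (conj KS' gS')))) : I).
  exists (fun j p => P0 j p + q j i p), (fun b => w b i).
  split; [|split].
  - intros []; [destruct (B1 i) as [S B] | destruct (B2 i) as [S B] | destruct (B3 i) as [S B]]; split; auto;
      intros p; eapply bdp_le; eauto; unfold C; lra.
  - intros []; [destruct (B4 i) as [S B] | destruct (B5 i) as [S B]]; split; auto;
      intros p; eapply bdp_le; eauto; unfold C; lra.
  - intros a b p.
    assert (Dq : forall j c, pd c (fun p => P0 j p + q j i p) p = dP0 j c p + pd c (q j i) p).
    { intros j c. rewrite (proj2 (exd_plus c (P0 j) (q j i) (proj1 (trig_pd _ (trig_P0 j) c)) (proj1 (TP_pd rho Hrho _ _ _ c (Tq j)) i))).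
      rewrite pd_P0. auto. }
    assert (E1 := E a b i p). change (gg a b i p) with (g a b p) in E1.
    replace (h0 a b + g a b p - _) with (Rr a b i p).
    + assert (Hrp : 0 <= r ^ S N) by (apply pow_le; lra).
      destruct a, b; [destruct (B6 i) as [_ B] | destruct (B7 i) as [_ B] | destruct (B8 i) as [_ B] | destruct (B9 i) as [_ B]];
        (eapply Rle_trans; [apply B|]; apply Rmult_le_compat_r; [exact Hrp | unfold C; lra]).
    + rewrite E1. unfold sum3. rewrite !Dq. change (KK ?j a b i p) with (K j a b p). ring.
Qed.

(** * One stage of the iteration *)

Definition EE (v : ix -> pt -> R) (w : bool -> pt -> R) (a b : bool) (p : pt) : R :=
  sum3 (fun j => / 2 * (pd a (v j) p * pd b (v j) p)) + / 2 * (pd a (w b) p + pd b (w a) p).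

Definition corr (P : ix -> pt -> R) (v : ix -> pt -> R) (b : bool) : pt -> R :=
  fun p => P j1 p * pd b (v j1) p + P j2 p * pd b (v j2) p + P j3 p * pd b (v j3) p.

Lemma pd_corr P v a b : (forall j, exd a (P j)) -> (forall j, exd a (pd b (v j))) ->
  exd a (corr P v b) /\ pd a (corr P v b) =
  (fun p => sum3 (fun j => pd a (P j) p * pd b (v j) p + P j p * pd a (pd b (v j)) p)).
Proof.
  intros HP Hv. unfold corr.
  destruct (exd_mult a (P j1) (pd b (v j1))) as [X1 Y1]; auto.
  destruct (exd_mult a (P j2) (pd b (v j2))) as [X2 Y2]; auto.
  destruct (exd_mult a (P j3) (pd b (v j3))) as [X3 Y3]; auto.
  destruct (exd_plus a _ _ X1 X2) as [X4 Y4]. destruct (exd_plus a _ _ X4 X3) as [X5 Y5].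
  split; auto. rewrite Y5, Y4, Y1, Y2, Y3. reflexivity.
Qed.

(* The correction [corr P v] of [w] trades the first order cross terms for [P . D^2 v]. *)
Lemma EE_update v w P W a b p :
  (forall j c, exd c (v j)) -> (forall b c, exd c (w b)) ->
  (forall j c, exd c (P j)) -> (forall b c, exd c (W b)) -> (forall j c d, exd c (pd d (v j))) ->
  EE (fun j p => v j p + P j p) (fun b p => w b p + (W b p - corr P v b p)) a b p =
  EE v w a b p + (sum3 (fun j => / 2 * (pd a (P j) p * pd b (P j) p)) + / 2 * (pd a (W b) p + pd b (W a) p)
   - sum3 (fun j => P j p * (/ 2 * (pd a (pd b (v j)) p + pd b (pd a (v j)) p)))).
Proof.
  intros Hv Hw HP HW Hvv.
  assert (D1 : forall j c, pd c (fun p => v j p + P j p) p = pd c (v j) p + pd c (P j) p)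
    by (intros j c; rewrite (proj2 (exd_plus c _ _ (Hv j c) (HP j c))); auto).
  assert (D2 : forall b c, pd c (fun p => w b p + (W b p - corr P v b p)) p =
     pd c (w b) p + (pd c (W b) p - sum3 (fun j => pd c (P j) p * pd b (v j) p + P j p * pd c (pd b (v j)) p))).
  { intros b' c. destruct (pd_corr P v c b') as [X Y]; auto.
    destruct (exd_minus c _ _ (HW b' c) X) as [X' Y'].
    rewrite (proj2 (exd_plus c _ _ (Hw b' c) X')), Y', Y. auto. }
  unfold EE, sum3. rewrite !D1, !D2. unfold sum3. field.
Qed.

Lemma bdp_2 r B f p : bdp 2 r B f p ->
  (forall a, Rabs (pd a f p) <= r * B) /\ (forall a b, Rabs (pd a (pd b f) p) <= r * (r * B)).
Proof.
  intros H; split; intros a; [|intros b].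
  - apply (bdp_abs 1 r), bdp_pd, H.
  - apply (bdp_abs 0 r), bdp_pd, bdp_pd, H.
Qed.

Lemma sm_corr n P v b : (forall j, sm n (P j)) -> (forall j, sm n (pd b (v j))) -> sm n (corr P v b).
Proof. intros HP Hv. unfold corr. repeat apply sm_plus; apply sm_mult; auto. Qed.

Lemma bdp_corr n r B V P v b p : 0 <= r -> (forall j, sm n (P j)) -> (forall j, sm n (pd b (v j))) ->
  (forall j, bdp n r B (P j) p) -> (forall j, bdp n r V (pd b (v j)) p) ->
  bdp n r (3 * (2 ^ n * (B * V))) (corr P v b) p.
Proof.
  intros Hr SP Sv HP HV. unfold corr.
  replace (3 * (2 ^ n * (B * V))) with ((2 ^ n * (B * V) + 2 ^ n * (B * V)) + 2 ^ n * (B * V)) by ring.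
  assert (H : forall j, bdp n r (2 ^ n * (B * V)) (fun p => P j p * pd b (v j) p) p) by (intros; apply bdp_mult; auto).
  assert (S : forall j, sm n (fun p => P j p * pd b (v j) p)) by (intros; apply sm_mult; auto).
  apply bdp_plus; auto using sm_plus. apply bdp_plus; auto.
Qed.

Lemma sm_EE n v w a b : (forall j, sm (S n) (v j)) -> (forall b, sm (S n) (w b)) -> sm n (EE v w a b).
Proof.
  intros Hv Hw. unfold EE, sum3.
  repeat (apply sm_plus || apply sm_mult); auto using sm_const, sm_pd.
Qed.

(* Smoothing at scale [l] turns the defect into a field of frequency [1 / l]; the loss is the commutator. *)
Lemma smoothed_defect l M D c v w (A : bool -> bool -> pt -> R) a b p : 0 < l -> 0 <= M -> 0 <= D ->
  (forall j, sm 2 (v j)) -> (forall b, sm 2 (w b)) -> cont (A a b) ->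
  (forall j a b p, Rabs (pd a (pd b (v j)) p) <= M) ->
  (forall p, Rabs (A a b p - EE v w a b p - c) <= D) ->
  bdp 12 (/ l) (D + 3 * (/ 2 * ((1 + 2 ^ 12) * (24 * l * M * (24 * l * M)))))
    (fun p => Sn 12 l (A a b) p - EE (fun j => Sn 12 l (v j)) (fun b => Sn 12 l (w b)) a b p - c) p.
Proof.
  intros Hl HM HD Sv Sw CA HV HA.
  assert (Hr : 0 <= / l) by (left; apply Rinv_0_lt_compat; auto).
  assert (Cv : forall j d, cont (pd d (v j))) by (intros j d; apply (sm_cont 1), sm_pd, Sv).
  assert (Cw : forall j d, cont (pd d (w j))) by (intros j d; apply (sm_cont 1), sm_pd, Sw).
  assert (Pv : forall j d, pd d (Sn 12 l (v j)) = Sn 12 l (pd d (v j)))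
    by (intros j d; apply (Sn_pd 12 d l (v j)); auto; [apply (sm_cont 2), Sv | apply (sm_exd 1), Sv]).
  assert (Pw : forall j d, pd d (Sn 12 l (w j)) = Sn 12 l (pd d (w j)))
    by (intros j d; apply (Sn_pd 12 d l (w j)); auto; [apply (sm_cont 2), Sw | apply (sm_exd 1), Sw]).
  assert (S12 : forall f, cont f -> sm 12 (Sn 12 l f)) by (intros f Hf; apply (sm_Sn 12 0 l f); auto; split; auto).
  set (cm := fun j p => Sn 12 l (fun q => pd a (v j) q * pd b (v j) q) p - Sn 12 l (pd a (v j)) p * Sn 12 l (pd b (v j)) p).
  assert (Scm : forall j, sm 12 (cm j)) by (intros j; apply sm_minus; [|apply sm_mult]; auto using cont_mult).
  replace (fun p => Sn 12 l (A a b) p - EE (fun j => Sn 12 l (v j)) (fun b => Sn 12 l (w b)) a b p - c)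
    with (fun p => Sn 12 l (fun q => A a b q - EE v w a b q - c) p + (/ 2 * cm j1 p + / 2 * cm j2 p + / 2 * cm j3 p)).
  - assert (CE : cont (EE v w a b)) by (apply (sm_cont 1), sm_EE; auto).
    assert (CD : cont (fun q => A a b q - EE v w a b q - c)) by (apply cont_minus; [apply cont_minus; auto | apply cont_const]).
    assert (B : forall j, bdp 12 (/ l) (/ 2 * ((1 + 2 ^ 12) * (24 * l * M * (24 * l * M)))) (fun p => / 2 * cm j p) p).
    { intros j. assert (H2 : 0 < / 2) by lra. rewrite <- (Rabs_pos_eq (/ 2)) at 1 by lra. apply bdp_scal; auto.
      assert (H24 : 0 <= 24 * l * M) by (apply Rmult_le_pos; lra).
      apply Sn_commutator; auto.
      (* Twelve means of radius [l] reach points at l1 distance at most [24 l], where a gradient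
         with derivative bound [M] varies by at most [24 l M]. *)
      assert (X : forall d q, box p (INR 12 * l) q -> Rabs (pd d (v j) q - pd d (v j) p) <= 24 * l * M).
      { intros d q [Q1 Q2]. eapply Rle_trans; [apply (lipschitz (pd d (v j)) M); auto; intros e; apply (sm_exd 0), sm_pd, Sv|].
        unfold dd1. replace (24 * l * M) with (M * (24 * l)) by ring. apply Rmult_le_compat_l; auto.
        replace (INR 12) with 12 in * by (simpl; ring). lra. }
      auto. }
    replace (3 * (/ 2 * ((1 + 2 ^ 12) * (24 * l * M * (24 * l * M)))))
      with (/ 2 * ((1 + 2 ^ 12) * (24 * l * M * (24 * l * M))) + / 2 * ((1 + 2 ^ 12) * (24 * l * M * (24 * l * M)))
          + / 2 * ((1 + 2 ^ 12) * (24 * l * M * (24 * l * M)))) by ring.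
    apply bdp_plus; auto using sm_plus, sm_scal.
    + apply Sn_bdp; auto.
    + apply bdp_plus; auto using sm_plus, sm_scal. apply bdp_plus; auto using sm_scal.
  - assert (EW : Sn 12 l (EE v w a b) = fun p =>
      (/ 2 * Sn 12 l (fun q => pd a (v j1) q * pd b (v j1) q) p + / 2 * Sn 12 l (fun q => pd a (v j2) q * pd b (v j2) q) p
        + / 2 * Sn 12 l (fun q => pd a (v j3) q * pd b (v j3) q) p) + / 2 * (Sn 12 l (pd a (w b)) p + Sn 12 l (pd b (w a)) p)).
    { unfold EE, sum3. rewrite !Sn_plus, !Sn_scal, Sn_plus; auto 10 using cont_plus, cont_mult, cont_scal. }
    rewrite !Sn_minus, Sn_const, EW; auto using cont_const.
    2: apply (sm_cont 1), sm_EE; auto.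
    2: apply cont_minus; auto; apply (sm_cont 1), sm_EE; auto.
    apply functional_extensionality; intros q. unfold EE, sum3, cm. rewrite !Pv, !Pw. ring.
Qed.
Opaque Sn.

Lemma bdp_rescaled_sum n lam r B M f g p : 0 < lam -> 0 <= r -> sm n f -> sm n g ->
  (forall q, bdp n r M f q) -> (forall q, bdp n r M g q) -> 
  bdp n (/ lam * r) (Rabs B * M) (scl (/ lam) (fun q => B * (/ 2 * (f q + g q)))) p.
Proof.
  intros Hl Hr Sf Sg Hf Hg. assert (H2 : 0 < / lam) by (apply Rinv_0_lt_compat; auto).
  apply bdp_scl; [lra | auto using sm_scal, sm_plus |].
  apply bdp_scal; [auto using sm_scal, sm_plus|].
  replace M with (Rabs (/ 2) * (M + M)) by (rewrite Rabs_pos_eq; lra).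
  apply bdp_scal; [auto using sm_plus|]. apply bdp_plus; auto.
Qed.

Lemma h0_bound a b : 0 <= h0 a b <= / 2.
Proof. unfold h0; destruct (Bool.eqb a b); lra. Qed.
Lemma h0_sym a b : h0 a b = h0 b a.
Proof. destruct a, b; reflexivity. Qed.
Lemma EE_sym v w a b p : EE v w a b p = EE v w b a p.
Proof. unfold EE, sum3; ring. Qed.

(** A round bound for [2 + 3 / 2 * (1 + 2 ^ 12) * 24 ^ 2], about 3.54 million: [2] for the defect
    and the reserved [r ^ 9 d h0], the rest for the commutators of the three components. *)
Definition step_const : R := 4000000.

(** The order of the quantifiers matters: [Cu] precedes [V], so that the iteration can fix [V] from
    [Cu] and then [r] from [V]. The bound [G] for [grad w] enters only the displacement of [w]. The
    scale [l] makes the squared gradient oscillation [(l M) ^ 2] equal to [r ^ 2 d], below the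
    tolerated error [r d]. *)
Lemma stage : exists Cu, 1 <= Cu /\ forall V, 1 <= V -> exists CV r0, 1 <= CV /\ 0 < r0 <= / 2 /\
  forall r d M G A v w, 0 < r <= r0 -> 0 < d <= 1 -> 0 < M ->
  (forall a b p, A a b p = A b a p) -> (forall a b, cont (A a b)) ->
  (forall j, sm 2 (v j)) -> (forall b, sm 2 (w b)) ->
  (forall j a p, Rabs (pd a (v j) p) <= V) -> (forall b a p, Rabs (pd a (w b) p) <= G) ->
  (forall j a b p, Rabs (pd a (pd b (v j)) p) <= M) -> (forall j a b p, Rabs (pd a (pd b (w j)) p) <= M) ->
  (forall a b p, Rabs (A a b p - EE v w a b p - d * h0 a b) <= r * d) ->
  let l := sqrt d * r / M in
  (forall a b p, Rabs (Sn 12 l (A a b) p - A a b p) <= / 2 * (r * (r ^ 9 * d))) ->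
  exists v' w', (forall j, sm 2 (v' j)) /\ (forall b, sm 2 (w' b)) /\
    (forall j a b p, Rabs (pd a (pd b (v' j)) p) <= M * (/ r) ^ 3) /\
    (forall j a b p, Rabs (pd a (pd b (w' j)) p) <= M * (/ r) ^ 3) /\
    (forall j a p, Rabs (pd a (v' j) p - pd a (v j) p) <= Cu * sqrt d) /\
    (forall j a p, Rabs (pd a (w' j) p - pd a (w j) p) <= CV * sqrt d) /\
    (forall j p, Rabs (v' j p - v j p) <= CV * l) /\
    (forall j p, Rabs (w' j p - w j p) <= CV * (1 + G) * l) /\
    (forall a b p, Rabs (A a b p - EE v' w' a b p - r ^ 9 * d * h0 a b) <= r * (r ^ 9 * d)).
Proof.
  (* Ten corrections leave a residual [C r ^ 11], one power below the required [r ^ 10]; this power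
     absorbs [C]. *)
  destruct (cell 10 step_const) as (C & HC & Hcell); [unfold step_const; lra|].
  change (10 + 2)%nat with 12%nat in Hcell. change (S 10) with 11%nat in Hcell.
  exists (24 + C); split; [lra|]. intros V HV.
  (* The [12] is three components times the Leibniz factor [2 ^ 2] in [corr P v]. *)
  set (C2 := C + 12 * (C * V)).
  assert (HC2 : C <= C2) by (unfold C2; assert (0 <= C * V) by (apply Rmult_le_pos; lra); lra).
  (* The threshold gives [r * (1 + C2) <= / 2], used twice: for the new defect, and to absorb [C2]
     in the growth [(/ r) ^ 3]. The terms with [24] come from [Sn_lip] with twelve means. *)
  exists (24 * V + 24 + C2), (/ (2 * (1 + C2))). split; [lra|].
  assert (Hr0 : 0 < / (2 * (1 + C2))) by (apply Rinv_0_lt_compat; lra).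
  assert (Hr0' : 2 * (1 + C2) * / (2 * (1 + C2)) = 1) by (apply Rinv_r; lra).
  split. { split; auto. apply Rinv_le_contravar; lra. }
  intros r d M G A v w Hr Hd HM SA CA Sv Sw Bv Bw Bvv Bww HD l Hl.
  assert (Hr1 : r * (1 + C2) <= / 2).
  { assert (X : r * (2 * (1 + C2)) <= / (2 * (1 + C2)) * (2 * (1 + C2))) by (apply Rmult_le_compat_r; lra). lra. }
  assert (Hrh : r <= / 2). { assert (0 <= r * C2) by (apply Rmult_le_pos; lra). lra. }
  set (s := sqrt d) in *.
  assert (Hs : 0 < s) by (apply sqrt_lt_R0; lra).
  assert (Hss : s * s = d) by (apply sqrt_sqrt; lra).
  assert (Hs1 : s <= 1) by (rewrite <- sqrt_1; apply sqrt_le_1; lra).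
  assert (Hlp : 0 < l) by (unfold l; apply Rdiv_lt_0_compat; auto; apply Rmult_lt_0_compat; lra).
  assert (HlM : l * M = s * r) by (unfold l; field; lra).
  (* The ratio of the fast scale [/ lam] to the smoothing scale [l] is exactly [r]. *)
  set (lam := / (l * r)).
  assert (Hlr : 0 < l * r) by (apply Rmult_lt_0_compat; lra).
  assert (Hlam : 0 < lam) by (apply Rinv_0_lt_compat; auto).
  assert (Elam : / l = lam * r) by (unfold lam; field; lra).
  assert (Elam' : / lam * / l = r) by (rewrite Elam; field; lra).
  assert (Hil : 0 <= / l) by (left; apply Rinv_0_lt_compat; auto).
  assert (Hil' : 0 <= / l <= lam). { split; auto. rewrite Elam. rewrite <- (Rmult_1_r lam) at 2. apply Rmult_le_compat_l; lra. }
  set (vl := fun j => Sn 12 l (v j)). set (wl := fun b => Sn 12 l (w b)).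
  assert (Svl : forall j, sm 14 (vl j)) by (intros j; exact (sm_Sn 12 2 l _ Hlp (Sv j))).
  assert (Swl : forall j, sm 14 (wl j)) by (intros j; exact (sm_Sn 12 2 l _ Hlp (Sw j))).
  assert (Cv : forall j, cont (v j)) by (intros j; apply (sm_cont 2), Sv).
  assert (Cw : forall j, cont (w j)) by (intros j; apply (sm_cont 2), Sw).
  assert (Ev : forall j a, exd a (v j)) by (intros; apply (sm_exd 1), Sv).
  assert (Ew : forall j a, exd a (w j)) by (intros; apply (sm_exd 1), Sw).
  assert (Cdv : forall j d, cont (pd d (v j))) by (intros j e; apply (sm_cont 1), sm_pd, Sv).
  assert (Cdw : forall j d, cont (pd d (w j))) by (intros j e; apply (sm_cont 1), sm_pd, Sw).
  assert (Edv : forall j a b, exd a (pd b (v j))) by (intros; apply (sm_exd 0), sm_pd, Sv).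
  assert (Edw : forall j a b, exd a (pd b (w j))) by (intros; apply (sm_exd 0), sm_pd, Sw).
  assert (Cddv : forall j a b, cont (pd a (pd b (v j)))) by (intros; apply (sm_cont 0), sm_pd, sm_pd, Sv).
  assert (Cddw : forall j a b, cont (pd a (pd b (w j)))) by (intros; apply (sm_cont 0), sm_pd, sm_pd, Sw).
  assert (Pv : forall j d, pd d (vl j) = Sn 12 l (pd d (v j))) by (intros j e; apply (Sn_pd 12 e l (v j)); auto).
  assert (Pw : forall j d, pd d (wl j) = Sn 12 l (pd d (w j))) by (intros j e; apply (Sn_pd 12 e l (w j)); auto).
  assert (Pvv : forall j a b, pd a (pd b (vl j)) = Sn 12 l (pd a (pd b (v j))))
    by (intros j a b; rewrite Pv; apply (Sn_pd 12 a l (pd b (v j))); auto).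
  assert (Pww : forall j a b, pd a (pd b (wl j)) = Sn 12 l (pd a (pd b (w j))))
    by (intros j a b; rewrite Pw; apply (Sn_pd 12 a l (pd b (w j))); auto).
  assert (S12 : forall f, cont f -> sm 12 (Sn 12 l f)) by (intros f Hf; apply (sm_Sn 12 0 l f); auto; split; auto).
  assert (I12 : INR 12 = 12) by (simpl; ring).
  (* For [P] of amplitude [s / lam], the term [P . D^2 v] is [s ^ 2 = d] times a cell profile times
     [D^2 v / (lam s)]; this factor brings the term to the scale of the cell problem. *)
  set (ks := / (lam * s)).
  assert (Hks : 0 < ks) by (apply Rinv_0_lt_compat, Rmult_lt_0_compat; auto).
  assert (EksM : ks * M = r * r). { unfold ks, lam. replace M with (s * r / l) by (rewrite <- HlM; field; lra). field; lra. }
  set (K := fun j a b => scl (/ lam) (fun q => ks * (/ 2 * (pd a (pd b (vl j)) q + pd b (pd a (vl j)) q)))).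
  (* The part [r ^ 9 d h0] is deliberately left uncorrected: it is the positive leading defect that
     the next stage needs. *)
  set (c := fun a b => d * h0 a b + r ^ 9 * d * h0 a b).
  set (g := fun a b => scl (/ lam) (fun q => / d * (Sn 12 l (A a b) q - EE vl wl a b q - c a b))).
  assert (HK : forall j a b, sm 12 (K j a b) /\ forall p, bdp 12 r (step_const * r) (K j a b) p).
  { intros j a b. unfold K. rewrite !Pvv. split; [apply sm_scl, sm_scal, sm_scal, sm_plus; auto|].
    intros p. apply (bdp_le _ _ (Rabs ks * M)); [lra | |].
    - rewrite Rabs_pos_eq, EksM by lra. apply Rmult_le_compat_r; unfold step_const; lra.
    - rewrite <- Elam'. apply bdp_rescaled_sum; auto; intros q; apply Sn_bdp; auto. }
  assert (Hr9 : 0 <= r ^ 9 <= r).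
  { split; [apply pow_le; lra|]. replace (r ^ 9) with (r ^ 8 * r) by ring. rewrite <- (Rmult_1_l r) at 3.
    apply Rmult_le_compat_r; [lra|]. rewrite <- (pow1 8). apply pow_incr; lra. }
  assert (Sg : forall a b, sm 12 (fun q => Sn 12 l (A a b) q - EE vl wl a b q - c a b)).
  { intros a b. apply sm_minus; [apply sm_minus; auto | apply sm_const].
    apply (sm_le 12 13); [lia|]. apply sm_EE; auto. }
  assert (Hg : forall a b, sm 12 (g a b) /\ forall p, bdp 12 r (step_const * r) (g a b) p).
  { intros a b. split; [apply sm_scl, sm_scal; auto|].
    intros p. unfold g. rewrite <- Elam' at 1. apply bdp_scl; [left; apply Rinv_0_lt_compat; auto | apply sm_scal; auto |].
    eapply bdp_le; [auto | | apply bdp_scal; [auto|]; apply (smoothed_defect l M (r * d + r * d)); auto; try lra].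
    - rewrite Rabs_pos_eq by (left; apply Rinv_0_lt_compat; lra).
      replace (24 * l * M * (24 * l * M)) with (576 * (r * r) * d)
        by (replace (24 * l * M) with (24 * (l * M)) by ring; rewrite HlM, <- Hss; ring).
      replace (/ d * (r * d + r * d + 3 * (/ 2 * ((1 + 2 ^ 12) * (576 * (r * r) * d)))))
        with (2 * r + (3 / 2 * (1 + 2 ^ 12) * 576) * r * r) by (field; lra).
      assert (X : (3 / 2 * (1 + 2 ^ 12) * 576) * r * r <= (3 / 2 * (1 + 2 ^ 12) * 576) * r * 1).
      { apply Rmult_le_compat_l; [|lra]. apply Rmult_le_pos; lra. }
      unfold step_const. simpl in *. lra.
    - apply Rplus_le_le_0_compat; apply Rmult_le_pos; lra.
    - intros q. unfold c.
      replace (A a b q - EE v w a b q - (d * h0 a b + r ^ 9 * d * h0 a b))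
        with ((A a b q - EE v w a b q - d * h0 a b) + - (r ^ 9 * d * h0 a b)) by ring.
      eapply Rle_trans; [apply Rabs_triang|]. apply Rplus_le_compat; auto.
      destruct (h0_bound a b). rewrite Rabs_Ropp, Rabs_pos_eq.
      + rewrite <- (Rmult_1_r (r * d)). apply Rmult_le_compat; try lra.
        * apply Rmult_le_pos; lra.
        * apply Rmult_le_compat_r; lra.
      + apply Rmult_le_pos; auto. apply Rmult_le_pos; lra. }
  assert (KS : forall j a b p, K j a b p = K j b a p).
  { intros j a b p. unfold K, scl. rewrite (Rplus_comm (pd a _ _)). reflexivity. }
  assert (gS : forall a b p, g a b p = g b a p).
  { intros a b p. unfold g, scl, c.
    replace (A b a) with (A a b) by (apply functional_extensionality; intros; apply SA).
    rewrite (EE_sym vl wl a b), (h0_sym a b). reflexivity. }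
  assert (Hr01 : 0 < r <= 1) by lra.
  destruct (Hcell r K g Hr01 HK Hg KS gS) as (Q & om & HQ & Hom & Hres).
  (* [P] enters quadratically and gets gradients of size [s = sqrt d]; [W] enters linearly and gets
     gradients of size [d]. *)
  set (P := fun j p => s / lam * scl lam (Q j) p). set (W := fun b p => d / lam * scl lam (om b) p).
  assert (Hsl : 0 < s / lam) by (apply Rdiv_lt_0_compat; auto).
  assert (Hdl : 0 < d / lam <= s / lam).
  { split; [apply Rdiv_lt_0_compat; lra|]. apply Rmult_le_compat_r; [left; apply Rinv_0_lt_compat; auto|].
    rewrite <- Hss, <- (Rmult_1_r s) at 1. rewrite Rmult_1_r. rewrite <- (Rmult_1_r s) at 3. apply Rmult_le_compat_l; lra. }
  assert (SP : forall j, sm 2 (P j)) by (intros j; apply sm_scal, sm_scl, HQ).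
  assert (SW : forall j, sm 2 (W j)) by (intros j; apply sm_scal, sm_scl, Hom).
  assert (BP : forall j p, bdp 2 lam (C * (s / lam)) (P j) p).
  { intros j p. rewrite Rmult_comm. rewrite <- (Rabs_pos_eq (s / lam)) at 1 by lra.
    apply bdp_scal; [apply sm_scl, HQ|]. rewrite <- (Rmult_1_r lam) at 1. apply bdp_scl; [lra | apply HQ | apply HQ]. }
  assert (BW : forall j p, bdp 2 lam (C * (s / lam)) (W j) p).
  { intros j p. apply (bdp_le _ _ (Rabs (d / lam) * C)); [lra | rewrite Rabs_pos_eq, Rmult_comm by lra; apply Rmult_le_compat_l; lra |].
    apply bdp_scal; [apply sm_scl, Hom|]. rewrite <- (Rmult_1_r lam) at 1. apply bdp_scl; [lra | apply Hom | apply Hom]. }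
  assert (Sdvl : forall j b, sm 2 (pd b (vl j))) by (intros; apply (sm_le 2 13); [lia | apply sm_pd, Svl]).
  assert (BT : forall b p, bdp 2 lam (C2 * (s / lam)) (fun p => W b p - corr P vl b p) p).
  { intros b p.
    replace (C2 * (s / lam)) with (C * (s / lam) + Rabs (-1) * (3 * (2 ^ 2 * (C * (s / lam) * V)))).
    2:{ rewrite Rabs_left by lra. unfold C2. simpl. ring. }
    replace (fun p => W b p - corr P vl b p) with (fun p => W b p + -1 * corr P vl b p)
      by (apply functional_extensionality; intros; ring).
    assert (SC : sm 2 (corr P vl b)) by (apply sm_corr; auto).
    apply bdp_plus; auto using sm_scal. apply bdp_scal; auto. apply bdp_corr; auto; [lra|].
    intros j. rewrite Pv. apply (bdp_r 2 (/ l)); auto. apply (bdp_le_n 2 12); [lia|].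
    apply Sn_bdp; auto. }
  assert (EP : forall j c, exd c (P j)) by (intros; apply (sm_exd 1), SP).
  assert (EdP : forall j c e, exd c (pd e (P j))) by (intros; apply (sm_exd 0), sm_pd, SP).
  assert (ST : forall b, sm 2 (fun p => W b p - corr P vl b p)) by (intros; apply sm_minus; auto; apply sm_corr; auto).
  assert (Evl : forall j c, exd c (vl j)) by (intros; apply (sm_exd 13), Svl).
  assert (Ewl : forall j c, exd c (wl j)) by (intros; apply (sm_exd 13), Swl).
  (* New second derivatives have size [s * lam], which is [M / r ^ 2] by the choice of [l]. *)
  assert (EMr : lam * (lam * (C2 * (s / lam))) = C2 * M * (/ r) ^ 2).
  { replace (lam * (lam * (C2 * (s / lam)))) with (C2 * s * lam) by (field; lra).
    unfold lam, l. simpl. field. lra. }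
  assert (HM3 : M + C2 * M * (/ r) ^ 2 <= M * (/ r) ^ 3).
  { replace (M + C2 * M * (/ r) ^ 2) with (M * (/ r) ^ 3 * (r * (r * r) + r * C2)) by (simpl; field; lra).
    rewrite <- (Rmult_1_r (M * (/ r) ^ 3)) at 2. apply Rmult_le_compat_l.
    - apply Rmult_le_pos; [lra|]. apply pow_le. left; apply Rinv_0_lt_compat; lra.
    - assert (r * (r * r) <= r * (1 * 1)) by (apply Rmult_le_compat_l; [lra | apply Rmult_le_compat; lra]). lra. }
  assert (Elip : forall V', 2 * INR 12 * l * V' = 24 * (l * V')) by (intros; rewrite I12; ring).
  assert (Hsl' : s / lam <= l).
  { unfold lam. replace (s / / (l * r)) with (s * r * l) by (field; lra). rewrite <- (Rmult_1_l l) at 2.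
    apply Rmult_le_compat_r; [lra|]. rewrite <- (Rmult_1_l 1). apply Rmult_le_compat; lra. }
  assert (Tri : forall x y z B1 B2, Rabs (x - z) <= B1 -> Rabs y <= B2 -> Rabs (x + y - z) <= B1 + B2).
  { intros x y z B1 B2 H1 H2. replace (x + y - z) with ((x - z) + y) by ring.
    eapply Rle_trans; [apply Rabs_triang | lra]. }
  exists (fun j p => vl j p + P j p), (fun b p => wl b p + (W b p - corr P vl b p)).
  split; [intros j; apply sm_plus; auto; apply (sm_le 2 14); auto; lia|].
  split; [intros j; apply sm_plus; auto; apply (sm_le 2 14); auto; lia|].
  assert (D1 : forall j c, pd c (fun p => vl j p + P j p) = fun p => pd c (vl j) p + pd c (P j) p)
    by (intros; apply exd_plus; auto).
  assert (D2 : forall j c, pd c (fun p => wl j p + (W j p - corr P vl j p)) =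
      fun p => pd c (wl j) p + pd c (fun p => W j p - corr P vl j p) p).
  { intros j e; apply (exd_plus e (wl j)); auto. apply (sm_exd 1), ST. }
  assert (HCl : C * (s / lam) <= C * l /\ C2 * (s / lam) <= C2 * l) by (split; apply Rmult_le_compat_l; lra).
  assert (HlV : 0 <= l * V) by (apply Rmult_le_pos; lra).
  assert (HlG : 0 <= l * G).
  { apply Rmult_le_pos; [lra|]. eapply Rle_trans; [apply Rabs_pos | apply (Bw true true (0, 0))]. }
  split; [|split; [|split; [|split; [|split; [|split]]]]].
  - intros j a b p. rewrite D1. rewrite (proj2 (exd_plus a (pd b (vl j)) (pd b (P j)) (sm_exd 1 _ a (Sdvl j b)) (EdP j a b))).
    rewrite Pvv. eapply Rle_trans; [apply Rabs_triang|]. eapply Rle_trans; [apply Rplus_le_compat|exact HM3].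
    + apply Sn_box; auto.
    + eapply Rle_trans; [apply (bdp_2 lam _ (P j) p (BP j p))|]. rewrite <- EMr.
      apply Rmult_le_compat_l; [lra|]. apply Rmult_le_compat_l; [lra|]. apply Rmult_le_compat_r; lra.
  - intros j a b p. rewrite D2. 
    rewrite (proj2 (exd_plus a (pd b (wl j)) (pd b (fun p => W j p - corr P vl j p))
      (sm_exd 12 _ a (sm_pd 13 _ b (Swl j))) (sm_exd 0 _ a (sm_pd 1 _ b (ST j))))).
    rewrite Pww. eapply Rle_trans; [apply Rabs_triang|]. eapply Rle_trans; [apply Rplus_le_compat|exact HM3].
    + apply Sn_box; auto.
    + rewrite <- EMr. apply (bdp_2 lam _ _ p (BT j p)).
  - intros j a p. rewrite D1. rewrite Pv.
    apply Rle_trans with (24 * (l * M) + lam * (C * (s / lam))).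
    + apply Tri; [rewrite <- Elip; apply Sn_lip; auto | apply (bdp_2 lam _ _ p (BP j p))].
    + rewrite HlM. replace (lam * (C * (s / lam))) with (C * s) by (field; lra).
      assert (s * r <= s * 1) by (apply Rmult_le_compat_l; lra). lra.
  - intros j a p. rewrite D2. rewrite Pw.
    apply Rle_trans with (24 * (l * M) + lam * (C2 * (s / lam))).
    + apply Tri; [rewrite <- Elip; apply Sn_lip; auto | apply (bdp_2 lam _ _ p (BT j p))].
    + rewrite HlM. replace (lam * (C2 * (s / lam))) with (C2 * s) by (field; lra).
      assert (s * r <= s * 1) by (apply Rmult_le_compat_l; lra).
      assert (0 <= V * s) by (apply Rmult_le_pos; lra). lra.
  - intros j p. apply Rle_trans with (24 * (l * V) + C * (s / lam)).
    + apply Tri; [rewrite <- Elip; apply Sn_lip; auto | apply (bdp_abs 2 lam), BP].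
    + assert (C * l <= C2 * l) by (apply Rmult_le_compat_r; lra). lra.
  - intros j p. apply Rle_trans with (24 * (l * G) + C2 * (s / lam)).
    + apply Tri; [rewrite <- Elip; apply Sn_lip; auto | apply (bdp_abs 2 lam _ _ p (BT j p))].
    + assert (0 <= C2 * (l * G)) by (apply Rmult_le_pos; lra).
      assert (0 <= V * (l * G)) by (apply Rmult_le_pos; lra). lra.
  - intros a b p.
    rewrite EE_update; auto.
    2:{ intros; apply (sm_exd 1), SW. }
    2:{ intros; apply (sm_exd 1), Sdvl. }
    assert (DP : forall j c, pd c (P j) p = s * pd c (Q j) (lam * fst p, lam * snd p)).
    { intros j c'. unfold P.
      destruct (exd_scl c' lam (Q j)) as [X Y]; [apply (sm_exd 1), HQ|].
      rewrite (proj2 (exd_scal c' (s / lam) _ X)), Y. unfold scl. field. lra. }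
    assert (DW : forall j c, pd c (W j) p = d * pd c (om j) (lam * fst p, lam * snd p)).
    { intros j c'. unfold W.
      destruct (exd_scl c' lam (om j)) as [X Y]; [apply (sm_exd 1), Hom|].
      rewrite (proj2 (exd_scal c' (d / lam) _ X)), Y. unfold scl. field. lra. }
    assert (Hb := Hres a b (lam * fst p, lam * snd p)).
    assert (Eq : (/ lam * fst (lam * fst p, lam * snd p), / lam * snd (lam * fst p, lam * snd p)) = p).
    { destruct p as [x y]; simpl. f_equal; field; lra. }
    unfold g, K, scl in Hb. rewrite Eq in Hb.
    set (X := h0 a b + _ - _) in Hb.
    (* The error is the smoothing error of [A] plus [d] times the cell residual; each receives half
       of [r ^ 10 d]. *)
    replace (A a b p - _ - r ^ 9 * d * h0 a b) with (- (Sn 12 l (A a b) p - A a b p) + d * X).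
    + eapply Rle_trans; [apply Rabs_triang|]. rewrite Rabs_Ropp.
      replace (r * (r ^ 9 * d)) with (/ 2 * (r * (r ^ 9 * d)) + / 2 * (r * (r ^ 9 * d))) by field.
      apply Rplus_le_compat; auto. rewrite Rabs_mult, (Rabs_pos_eq d) by lra.
      apply Rle_trans with (d * (C * r ^ 11)); [apply Rmult_le_compat_l; auto; lra|].
      replace (d * (C * r ^ 11)) with (r * C * (r * (r ^ 9 * d))) by ring.
      apply Rmult_le_compat_r.
      * apply Rmult_le_pos; [lra|]. apply Rmult_le_pos; lra.
      * assert (r * C <= r * C2) by (apply Rmult_le_compat_l; lra). lra.
    + unfold X, sum3. rewrite !DP, !DW. unfold P, scl, c, ks. rewrite <- Hss. field. repeat split; lra.
Qed.

(** * Limits in the Hölder class *)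

Lemma dist2_ge p q : Rabs (fst p - fst q) <= dist2 p q /\ Rabs (snd p - snd q) <= dist2 p q.
Proof.
  unfold dist2. assert (H1 := pow2_ge_0 (fst p - fst q)). assert (H2 := pow2_ge_0 (snd p - snd q)).
  split; rewrite <- (sqrt_pow2 (Rabs _)) by apply Rabs_pos; apply sqrt_le_1; rewrite ?pow2_abs; lra.
Qed.

Lemma dd1_dist2 p q : dd1 p q <= 2 * dist2 q p.
Proof. unfold dd1. destruct (dist2_ge q p). lra. Qed.

Lemma dist2_le p q : dist2 p q <= Rabs (fst p - fst q) + Rabs (snd p - snd q).
Proof.
  unfold dist2. assert (X1 := Rabs_pos (fst p - fst q)). assert (X2 := Rabs_pos (snd p - snd q)).
  rewrite <- (sqrt_pow2 (Rabs (fst p - fst q) + Rabs (snd p - snd q))) by lra.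
  assert (X3 : 0 <= Rabs (fst p - fst q) * Rabs (snd p - snd q)) by (apply Rmult_le_pos; auto).
  assert (X4 := pow2_ge_0 (fst p - fst q)). assert (X5 := pow2_ge_0 (snd p - snd q)).
  rewrite <- (pow2_abs (fst p - fst q)), <- (pow2_abs (snd p - snd q)) in *.
  apply sqrt_le_1; simpl in *; lra.
Qed.

Lemma dist2_pos p q : p <> q -> 0 < dist2 p q.
Proof.
  intros H. destruct (dist2_ge p q) as [H1 H2].
  destruct (Rle_lt_dec (dist2 p q) 0) as [H0|]; auto. exfalso. apply H.
  destruct p as [x y], q as [u v]; simpl in *.
  assert (forall a b, Rabs (a - b) <= 0 -> a = b).
  { intros a b Hab. apply Rminus_diag_uniq. destruct (Req_dec (a - b) 0) as [|N]; auto.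
    apply Rabs_pos_lt in N. lra. }
  f_equal; auto with real; apply H3; lra.
Qed.

Lemma dist2_upd b p s : dist2 (upd b p s) p = Rabs (s - crd b p).
Proof.
  unfold dist2. rewrite <- sqrt_Rsqr_abs. f_equal. unfold Rsqr. destruct b; simpl; ring.
Qed.

Lemma Rpower_small c e : 0 < c -> 0 < e -> exists d, 0 < d /\ forall x, 0 < x <= d -> Rpower x c <= e.
Proof.
  intros Hc He. exists (Rpower e (/ c)). split; [apply exp_pos|]. intros x Hx.
  apply Rle_trans with (Rpower (Rpower e (/ c)) c); [apply Rle_Rpower_l; lra|].
  rewrite Rpower_mult, Rinv_l, Rpower_1 by lra. lra.
Qed.

Lemma Rpower_pow_swap x q y : 0 < x -> Rpower (x ^ q) y = Rpower x y ^ q.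
Proof.
  intros Hx. induction q as [|q IH]; simpl.
  - unfold Rpower. rewrite ln_1, Rmult_0_r, exp_0. auto.
  - rewrite <- Rpower_mult_distr; auto using pow_lt. rewrite IH; auto.
Qed.

Lemma interpolation z a b t : 0 <= z -> 0 < a -> 0 < b -> z <= a -> z <= b -> 0 <= t <= 1 ->
  z <= Rpower a (1 - t) * Rpower b t.
Proof.
  intros [Hz|<-] Ha Hb Hza Hzb Ht.
  - rewrite <- (Rpower_1 z) at 1 by auto. replace 1 with ((1 - t) + t) at 1 by ring. rewrite Rpower_plus.
    apply Rmult_le_compat; try (left; apply exp_pos); apply Rle_Rpower_l; lra.
  - apply Rmult_le_pos; left; apply exp_pos.
Qed.

Lemma geometric_increments (u : nat -> R) C k : 0 <= C -> 0 <= k < 1 ->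
  (forall q, Rabs (u (S q) - u q) <= C * k ^ q) -> forall q, Rabs (u q - u O) <= C / (1 - k).
Proof.
  intros HC Hk Hu q.
  assert (H : Rabs (u q - u O) <= C / (1 - k) * (1 - k ^ q)).
  { induction q as [|q IH].
    - rewrite Rminus_diag, Rabs_R0. simpl. lra.
    - replace (u (S q) - u O) with ((u (S q) - u q) + (u q - u O)) by ring.
      eapply Rle_trans; [apply Rabs_triang|]. eapply Rle_trans; [apply Rplus_le_compat; [apply Hu | exact IH]|].
      right. simpl. field. lra. }
  eapply Rle_trans; [exact H|]. rewrite <- (Rmult_1_r (C / (1 - k))) at 2.
  apply Rmult_le_compat_l; [apply Rdiv_le_0_compat; lra|]. assert (0 <= k ^ q) by (apply pow_le; lra). lra.
Qed.

Lemma geometric_limit (u : nat -> R) C k : 0 <= k < 1 ->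
  (forall q, Rabs (u (S q) - u q) <= C * k ^ q) -> exists L : R, is_lim_seq u L.
Proof.
  intros Hk Hu.
  assert (E : ex_series (fun q => u (S q) - u q)).
  { apply (ex_series_le (K := R_AbsRing) (V := R_CompleteNormedModule) _ (fun q => C * k ^ q)); [exact Hu|].
    apply (ex_series_scal_l C (fun q => k ^ q)). apply ex_series_geom. rewrite Rabs_pos_eq; lra. }
  destruct E as [L HL]. exists (u O + L).
  apply is_lim_seq_incr_1.
  apply (is_lim_seq_ext (fun n => u O + sum_n (fun q => u (S q) - u q) n)).
  - intros n. rewrite sum_n_Reals. induction n as [|n IH]; simpl in *; lra.
  - apply (is_lim_seq_plus' (fun _ => u O)); [apply is_lim_seq_const | exact HL].
Qed.

Lemma is_lim_seq_abs_le (u : nat -> R) (L B : R) : is_lim_seq u L -> (forall q, Rabs (u q) <= B) -> Rabs L <= B.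
Proof.
  intros H HB. apply (is_lim_seq_le (fun q => Rabs (u q)) (fun _ => B) (Rabs L) B); auto.
  - apply (is_lim_seq_abs u L H).
  - apply is_lim_seq_const.
Qed.

(** The remainder depends on [f] only through [H], so the estimate passes to a pointwise limit of
    functions with a common [H]; this is how the limit is shown to be differentiable. *)
Lemma taylor_holder a H f b : 0 < a -> 0 <= H -> (forall b, exd b f) ->
  (forall p q, p <> q -> Rabs (pd b f p - pd b f q) <= H * Rpower (dist2 p q) a) ->
  forall p t, t <> crd b p ->
  Rabs (f (upd b p t) - f p - (t - crd b p) * pd b f p) <= H * Rpower (Rabs (t - crd b p)) a * Rabs (t - crd b p).
Proof.
  intros Ha HH He Hf p t Ht.
  assert (Ec : exd b (crd b) /\ pd b (crd b) = fun _ => 1).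
  { apply pd_is_derive. intros q. apply (is_derive_ext (fun t => t)); [intros; rewrite crd_upd; auto|].
    apply (is_derive_id (K := R_AbsRing)). }
  destruct Ec as [Ec Pc].
  destruct (exd_scal b (pd b f p) (crd b) Ec) as [E1 P1].
  destruct (exd_minus b f _ (He b) E1) as [E2 P2].
  replace (f (upd b p t) - f p - (t - crd b p) * pd b f p) with
    ((f (upd b p t) - pd b f p * crd b (upd b p t)) - (f p - pd b f p * crd b p)) by (rewrite crd_upd; ring).
  apply (MVT_pd b (fun q => f q - pd b f p * crd b q) p t); auto.
  intros s Hs. rewrite P2, P1, Pc, Rmult_1_r.
  destruct (Req_dec s (crd b p)) as [->|Hsp].
  - rewrite upd_crd, Rminus_diag, Rabs_R0. apply Rmult_le_pos; auto. left; apply exp_pos.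
  - eapply Rle_trans; [apply Hf; intros E; apply Hsp; rewrite <- E, crd_upd; auto|].
    rewrite dist2_upd. apply Rmult_le_compat_l; auto. apply Rle_Rpower_l; [lra|]. split.
    + apply Rabs_pos_lt. lra.
    + destruct (Rle_dec (crd b p) t).
      * rewrite Rmin_left, Rmax_right in Hs by lra. rewrite !Rabs_pos_eq; lra.
      * rewrite Rmin_right, Rmax_left in Hs by lra. rewrite !Rabs_left1; lra.
Qed.

Lemma holder_continuous a H f : 0 < a ->
  (forall p q, p <> q -> Rabs (f p - f q) <= H * Rpower (dist2 p q) a) -> cont f.
Proof.
  intros Ha Hf p. apply continuous_eps. intros e He.
  assert (HB : 0 < 1 + Rabs H) by (assert (X := Rabs_pos H); lra).
  destruct (Rpower_small a (e / 2 / (1 + Rabs H))) as (d & Hd & Hx); auto.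
  { apply Rdiv_lt_0_compat; lra. }
  exists (d / 2). split; [lra|]. intros q H1 H2.
  destruct (classic (q = p)) as [->|N]; [rewrite Rminus_diag, Rabs_R0; auto|].
  eapply Rle_lt_trans; [apply Hf; auto|].
  assert (D : dist2 q p <= d) by (eapply Rle_trans; [apply dist2_le | lra]).
  assert (X := Hx (dist2 q p) (conj (dist2_pos _ _ N) D)).
  assert (X0 : 0 <= Rpower (dist2 q p) a) by (left; apply exp_pos).
  apply Rle_lt_trans with ((1 + Rabs H) * Rpower (dist2 q p) a);
    [apply Rmult_le_compat_r; auto; assert (Y := Rle_abs H); lra|].
  apply Rle_lt_trans with ((1 + Rabs H) * (e / 2 / (1 + Rabs H))); [apply Rmult_le_compat_l; lra|].
  replace ((1 + Rabs H) * (e / 2 / (1 + Rabs H))) with (e / 2) by (field; lra). lra.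
Qed.

(** Pointwise limits suffice: summing the increments bounds the Hölder seminorms of the derivatives
    uniformly in [q], and such bounds survive pointwise convergence. *)
Lemma holder_limit a (f : nat -> pt -> R) C0 C k : 0 < a -> 0 <= C0 -> 0 <= C -> 0 <= k < 1 ->
  (forall q b, exd b (f q)) ->
  (forall q p, Rabs (f (S q) p - f q p) <= C0 * (/ 2) ^ q) ->
  (forall q b p, Rabs (pd b (f (S q)) p - pd b (f q) p) <= C * k ^ q) ->
  (forall q b p p', p <> p' -> Rabs ((pd b (f (S q)) p - pd b (f q) p) - (pd b (f (S q)) p' - pd b (f q) p'))
     <= C * k ^ q * Rpower (dist2 p p') a) ->
  bounded_fun (f O) -> (forall b, bounded_fun (pd b (f O))) -> (forall b, holder a (pd b (f O))) ->
  exists F, is_C1a a F /\ (forall p, is_lim_seq (fun q => f q p) (F p)) /\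
    (forall b p, is_lim_seq (fun q => pd b (f q) p) (pd b F p)) /\
    forall p, Rabs (F p - f O p) <= 2 * C0.
Proof.
  intros Ha HC0 HC Hk He Hf Hd Hh B0 B1 HH.
  assert (Hk2 : 0 <= / 2 < 1) by lra.
  assert (L0 : forall p, exists L : R, is_lim_seq (fun q => f q p) L).
  { intros p. apply (geometric_limit _ C0 (/ 2)); auto. }
  assert (L1 : forall bp : bool * pt, exists L : R, is_lim_seq (fun q => pd (fst bp) (f q) (snd bp)) L).
  { intros [b p]. apply (geometric_limit _ C k); simpl; auto. }
  apply functional_choice in L0. destruct L0 as [F LF].
  apply functional_choice in L1. destruct L1 as [Z' LZ'].
  set (Z := fun b p => Z' (b, p)).
  assert (LZ : forall b p, is_lim_seq (fun q => pd b (f q) p) (Z b p)) by (intros b p; apply (LZ' (b, p))).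
  assert (HU : forall b, exists H, 0 <= H /\ forall q p p', p <> p' ->
     Rabs (pd b (f q) p - pd b (f q) p') <= H * Rpower (dist2 p p') a).
  { intros b. destruct (HH b) as [H1 HH1]. exists (Rabs H1 + C / (1 - k)).
    assert (0 <= C / (1 - k)) by (apply Rdiv_le_0_compat; lra).
    split; [assert (X := Rabs_pos H1); lra|]. intros q p p' N.
    assert (R0 : 0 <= Rpower (dist2 p p') a) by (left; apply exp_pos).
    replace (pd b (f q) p - pd b (f q) p') with
      (((pd b (f q) p - pd b (f q) p') - (pd b (f O) p - pd b (f O) p')) + (pd b (f O) p - pd b (f O) p')) by ring.
    eapply Rle_trans; [apply Rabs_triang|]. rewrite Rmult_plus_distr_r, Rplus_comm. apply Rplus_le_compat.
    - eapply Rle_trans; [apply HH1; auto|]. apply Rmult_le_compat_r; auto. apply Rle_abs.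
    - replace (C / (1 - k) * Rpower (dist2 p p') a) with (C * Rpower (dist2 p p') a / (1 - k)) by (field; lra).
      apply (geometric_increments (fun q => pd b (f q) p - pd b (f q) p')); auto using Rmult_le_pos.
      intros n. eapply Rle_trans; [|eapply Rle_trans; [apply (Hh n b p p' N)|]]; [right; f_equal; ring | right; ring]. }
  assert (HZ : forall b, exists H, 0 <= H /\ forall p p', p <> p' -> Rabs (Z b p - Z b p') <= H * Rpower (dist2 p p') a).
  { intros b. destruct (HU b) as (H & HH0 & HHq). exists H; split; auto. intros p p' N.
    apply (is_lim_seq_abs_le (fun q => pd b (f q) p - pd b (f q) p')); auto.
    apply is_lim_seq_minus'; auto. }
  (* The Taylor remainder shared by all iterates holds for [F] with slope [Z b], hence [Z b] is its
     partial derivative. *)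
  assert (D : forall b, exd b F /\ pd b F = Z b).
  { intros b. apply pd_is_derive. intros p. apply is_derive_Reals. intros e Hep.
    destruct (HU b) as (H & HH0 & HHq).
    destruct (Rpower_small a (e / 2 / (1 + H))) as (d & Hdp & Hx); auto.
    { apply Rdiv_lt_0_compat; lra. }
    exists (mkposreal d Hdp). simpl. intros t Ht Htd.
    assert (T : Rabs (F (upd b p (crd b p + t)) - F p - t * Z b p) <= H * Rpower (Rabs t) a * Rabs t).
    { apply (is_lim_seq_abs_le (fun q => f q (upd b p (crd b p + t)) - f q p - t * pd b (f q) p)).
      - apply is_lim_seq_minus'; [apply is_lim_seq_minus'; auto|].
        apply (is_lim_seq_scal_l (fun q => pd b (f q) p) t (Z b p)); auto.
      - intros q. generalize (taylor_holder a H (f q) b Ha HH0 (He q) (HHq q) p (crd b p + t)).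
        replace (crd b p + t - crd b p) with t by ring. intros X; apply X. lra. }
    rewrite upd_crd.
    replace ((F (upd b p (crd b p + t)) - F p) / t - Z b p)
      with ((F (upd b p (crd b p + t)) - F p - t * Z b p) / t) by (field; auto).
    unfold Rdiv. rewrite Rabs_mult, Rabs_inv.
    assert (Hta : 0 < Rabs t) by (apply Rabs_pos_lt; auto).
    apply Rle_lt_trans with (H * Rpower (Rabs t) a).
    - apply (Rmult_le_reg_r (Rabs t)); auto. rewrite Rmult_assoc, Rinv_l, Rmult_1_r by lra. auto.
    - assert (X := Hx (Rabs t) (conj Hta (Rlt_le _ _ Htd))).
      apply Rle_lt_trans with ((1 + H) * (e / 2 / (1 + H))).
      + apply Rmult_le_compat; auto; try lra. left; apply exp_pos.
      + replace ((1 + H) * (e / 2 / (1 + H))) with (e / 2) by (field; lra). lra. }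
  assert (C0b : forall p, Rabs (F p - f O p) <= 2 * C0).
  { intros p. apply (is_lim_seq_abs_le (fun q => f q p - f O p)).
    - apply is_lim_seq_minus'; auto. apply is_lim_seq_const.
    - intros q. replace (2 * C0) with (C0 / (1 - / 2)) by field.
      apply (geometric_increments (fun q => f q p)); auto. }
  assert (BZ : forall b, bounded_fun (Z b)).
  { intros b. destruct (B1 b) as [M HM]. exists (M + C / (1 - k)). intros p.
    apply (is_lim_seq_abs_le (fun q => pd b (f q) p)); auto. intros q.
    replace (pd b (f q) p) with (pd b (f O) p + (pd b (f q) p - pd b (f O) p)) by ring.
    eapply Rle_trans; [apply Rabs_triang|]. apply Rplus_le_compat; auto.
    apply (geometric_increments (fun q => pd b (f q) p)); auto. }
  exists F. split; [|split; [auto | split; auto]].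
  - assert (Dt := proj2 (D true)). assert (Df := proj2 (D false)).
    change (pd true F) with (Defs.d1 F) in Dt. change (pd false F) with (Defs.d2 F) in Df.
    split; [|split; [|split; [|split; [|split]]]].
    + split; intros p; split.
      * apply (proj1 (D true)).
      * apply (proj1 (D false)).
      * rewrite Dt. destruct (HZ true) as (H & _ & X). apply (holder_continuous a H); auto.
      * rewrite Df. destruct (HZ false) as (H & _ & X). apply (holder_continuous a H); auto.
    + destruct B0 as [M HM]. exists (M + 2 * C0). intros p. replace (F p) with (f O p + (F p - f O p)) by ring.
      eapply Rle_trans; [apply Rabs_triang|]. apply Rplus_le_compat; auto.
    + rewrite Dt; auto.
    + rewrite Df; auto.
    + rewrite Dt. destruct (HZ true) as (H & _ & X). exists H; auto.
    + rewrite Df. destruct (HZ false) as (H & _ & X). exists H; auto.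
  - intros b p. rewrite (proj2 (D b)). auto.
Qed.

(** * The iteration *)

(** The invariant travels with the state in a subset type, which makes the choice of the next state
    a total function. *)
Lemma dependent_choice (X : Type) (P : nat -> X -> Prop) (Q : nat -> X -> X -> Prop) :
  (forall q x, P q x -> exists y, P (S q) y /\ Q q x y) -> forall x0, P O x0 ->
  exists f : nat -> X, f O = x0 /\ forall q, P q (f q) /\ Q q (f q) (f (S q)).
Proof.
  intros H x0 H0.
  set (next := fun q (x : {x | P q x}) =>
    let (y, Hy) := constructive_indefinite_description _ (H q (proj1_sig x) (proj2_sig x)) in
    exist (P (S q)) y (proj1 Hy)).
  set (F := nat_rect (fun q => {x | P q x}) (exist _ x0 H0) next).
  exists (fun q => proj1_sig (F q)). split; auto. intros q. split; [apply (proj2_sig (F q))|].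
  change (F (S q)) with (next q (F q)). unfold next.
  destruct (constructive_indefinite_description _ _) as [y [Hy1 Hy2]]. auto.
Qed.

Lemma Rpower_anti r x y : 0 < r <= 1 -> x <= y -> Rpower r y <= Rpower r x.
Proof.
  intros Hr Hxy. unfold Rpower. destruct (Req_dec r 1) as [->|N].
  - rewrite ln_1, !Rmult_0_r. lra.
  - assert (ln r < 0) by (rewrite <- ln_1; apply ln_increasing; lra).
    destruct (Req_dec x y) as [->|]; [lra|]. left. apply exp_increasing.
    replace (y * ln r) with (ln r * y) by ring. replace (x * ln r) with (ln r * x) by ring.
    apply Rmult_lt_gt_compat_neg_l; lra.
Qed.

Lemma Rpower_lt_1 r x : 0 < r < 1 -> 0 < x -> Rpower r x < 1.
Proof.
  intros Hr Hx. rewrite <- exp_0. unfold Rpower. apply exp_increasing.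
  assert (ln r < 0) by (rewrite <- ln_1; apply ln_increasing; lra).
  replace (x * ln r) with (- (x * - ln r)) by ring.
  assert (0 < x * - ln r) by (apply Rmult_lt_0_compat; lra). lra.
Qed.

(** The oscillation is at most [2 B] and at most [2 L] times the distance; the second [2] is the
    comparison of the l1 and the Euclidean distance. *)
Lemma holder_interpolated t f B L : 0 <= t <= 1 -> 0 < B -> 0 < L -> (forall b, exd b f) ->
  (forall p, Rabs (f p) <= B) -> (forall b p, Rabs (pd b f p) <= L) ->
  forall p q, p <> q ->
  Rabs (f p - f q) <= Rpower (2 * B) (1 - t) * Rpower (2 * L) t * Rpower (dist2 p q) t.
Proof.
  intros Ht HB HL He Hf HD p q N. assert (Hd := dist2_pos p q N).
  rewrite Rmult_assoc, Rpower_mult_distr by lra.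
  apply interpolation; auto using Rabs_pos; try lra.
  - apply Rmult_lt_0_compat; lra.
  - unfold Rminus. eapply Rle_trans; [apply Rabs_triang|]. rewrite Rabs_Ropp.
    assert (X := Hf p). assert (Y := Hf q). lra.
  - eapply Rle_trans; [apply (lipschitz f L); auto|]. 
    assert (X := dd1_dist2 q p). assert (L * dd1 q p <= L * (2 * dist2 p q)) by (apply Rmult_le_compat_l; lra). lra.
Qed.

Lemma is_lim_seq_EE v w tv tw a c p :
  (forall j b p, is_lim_seq (fun q => pd b (v q j) p) (pd b (tv j) p)) ->
  (forall j b p, is_lim_seq (fun q => pd b (w q j) p) (pd b (tw j) p)) ->
  is_lim_seq (fun q => EE (v q) (w q) a c p) (EE tv tw a c p).
Proof.
  intros Hv Hw. unfold EE, sum3.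
  assert (X : forall j, is_lim_seq (fun q => / 2 * (pd a (v q j) p * pd c (v q j) p)) (/ 2 * (pd a (tv j) p * pd c (tv j) p))).
  { intros j. apply (is_lim_seq_scal_l (fun q => pd a (v q j) p * pd c (v q j) p) (/ 2) (pd a (tv j) p * pd c (tv j) p)). apply is_lim_seq_mult'; auto. }
  apply is_lim_seq_plus'; [apply is_lim_seq_plus'; [apply is_lim_seq_plus'|]|]; auto.
  apply (is_lim_seq_scal_l (fun q => pd a (w q c) p + pd c (w q a) p) (/ 2) (pd a (tw c) p + pd c (tw a) p)). apply is_lim_seq_plus'; auto.
Qed.

(** The admissible initial error [eta] must not depend on the second derivatives [B] of the initial
    fields, which blow up as that error decreases. A large [B] is compensated by starting at a
    smaller scale [l0]. *)
Lemma iteration b alpha A CA V0 d0 :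
  0 < alpha < b -> b <= 3 / 5 ->
  (forall a c p, A a c p = A c a p) -> (forall a c, cont (A a c)) -> 0 <= CA ->
  (forall l, 0 < l <= 1 -> forall a c p, Rabs (Sn 12 l (A a c) p - A a c p) <= CA * Rpower l (2 * b)) ->
  1 <= V0 -> 0 < d0 <= 1 -> forall eps, 0 < eps -> exists eta, 0 < eta /\ forall v0 w0 B, 0 <= B ->
  (forall j, sm 2 (v0 j)) -> (forall j, sm 2 (w0 j)) ->
  (forall j p, bdp 2 1 B (v0 j) p) -> (forall j p, bdp 2 1 B (w0 j) p) ->
  (forall j a p, Rabs (pd a (v0 j) p) <= V0) ->
  (forall a c p, Rabs (A a c p - EE v0 w0 a c p - d0 * h0 a c) <= eta) ->
  exists tv tw, (forall j, is_C1a alpha (tv j)) /\ (forall j, is_C1a alpha (tw j)) /\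
    (forall j p, Rabs (tv j p - v0 j p) <= eps) /\ (forall j p, Rabs (tw j p - w0 j p) <= eps) /\
    forall a c p, EE tv tw a c p = A a c p.
Proof.
  intros Hal Hb SA CoA HCA HA HV0 Hd0 eps Heps.
  destruct stage as (Cu & HCu & Hst).
  (* The gradient increments [Cu sqrt (dq q)] at least halve at each stage, so [2 * Cu] bounds their
     sum and [V] holds throughout. *)
  set (V := V0 + 2 * Cu). destruct (Hst V) as (CV & r & HCV & Hr & Hstage); [unfold V; lra|]. clear Hst.
  exists (r * d0). split; [apply Rmult_lt_0_compat; lra|].
  intros v0 w0 B HB Sv0 Sw0 Bv0 Bw0 HVv0 HD0.
  assert (Bv1 : forall j a p, Rabs (pd a (v0 j) p) <= B) by (intros j a p; generalize (proj1 (bdp_2 1 B (v0 j) p (Bv0 j p)) a); lra).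
  assert (Bw1 : forall j a p, Rabs (pd a (w0 j) p) <= B) by (intros j a p; generalize (proj1 (bdp_2 1 B (w0 j) p (Bw0 j p)) a); lra).
  assert (Bv2 : forall j a c p, Rabs (pd a (pd c (v0 j)) p) <= B) by (intros j a c p; generalize (proj2 (bdp_2 1 B (v0 j) p (Bv0 j p)) a c); lra).
  assert (Bw2 : forall j a c p, Rabs (pd a (pd c (w0 j)) p) <= B) by (intros j a c p; generalize (proj2 (bdp_2 1 B (w0 j) p (Bw0 j p)) a c); lra).
  set (G := B + 2 * CV).
  (* Second derivatives grow by [r ^ -J], faster than necessary when [b < 3 / 5]. The scales then
     shrink by [r ^ (9 / 2 + J) = r ^ (9 / (2 b))], so the smoothing error [l ^ (2 b)] of [A] decays
     exactly like the defect, by [r ^ 9]. The condition [b <= 3 / 5] is [J >= 3]. *)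
  set (J := 9 / 2 * (1 - b) / b).
  assert (HJ : 3 <= J).
  { unfold J. apply (Rmult_le_reg_r b); [lra|]. unfold Rdiv. rewrite (Rmult_assoc _ (/ b)), Rinv_l by lra. lra. }
  set (tau := Rpower r J). set (rho1 := Rpower r (9 / 2)).
  assert (Htau : 0 < tau) by apply exp_pos.
  assert (Hrho1 : 0 < rho1) by apply exp_pos.
  assert (Htau3 : tau <= r ^ 3).
  { rewrite <- Rpower_pow by lra. apply Rpower_anti; [lra|]. simpl; lra. }
  assert (Hrho2 : rho1 * rho1 = r ^ 9).
  { unfold rho1. rewrite <- Rpower_plus, <- Rpower_pow by lra. f_equal. simpl; field. }
  assert (Hrho12 : rho1 <= / 2).
  { apply Rle_trans with r; [|lra]. rewrite <- (Rpower_1 r) by lra. apply Rpower_anti; lra. }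
  assert (Htau1 : tau <= 1) by (eapply Rle_trans; [exact Htau3|]; rewrite <- (pow1 3); apply pow_incr; lra).
  set (s0 := sqrt d0).
  assert (Hs0 : 0 < s0) by (apply sqrt_lt_R0; lra).
  assert (Hs01 : s0 <= 1) by (unfold s0; rewrite <- sqrt_1; apply sqrt_le_1; lra).
  set (dq := fun q => d0 * (r ^ 9) ^ q).
  assert (Hr9 : 0 < r ^ 9) by (apply pow_lt; lra).
  assert (Hr91 : r ^ 9 <= 1) by (rewrite <- (pow1 9); apply pow_incr; lra).
  assert (Hdq : forall q, 0 < dq q <= 1).
  { intros q. unfold dq. assert (0 < (r ^ 9) ^ q <= 1).
    { split; [apply pow_lt; auto|]. rewrite <- (pow1 q). apply pow_incr; lra. }
    split; [apply Rmult_lt_0_compat; lra|]. rewrite <- (Rmult_1_l 1). apply Rmult_le_compat; lra. }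
  assert (Hsq : forall q, sqrt (dq q) = s0 * rho1 ^ q).
  { intros q. rewrite <- (sqrt_square (s0 * rho1 ^ q)).
    - f_equal. unfold dq. rewrite <- Hrho2, Rpow_mult_distr.
      replace (s0 * rho1 ^ q * (s0 * rho1 ^ q)) with ((s0 * s0) * (rho1 ^ q * rho1 ^ q)) by ring.
      unfold s0. rewrite sqrt_sqrt by lra. auto.
    - apply Rmult_le_pos; [lra|]. apply pow_le; lra. }
  assert (HG : 1 <= 1 + G) by (unfold G; lra).
  destruct (Rpower_small (2 * b) (/ 2 * (r * (r ^ 9 * d0)) / (CA + 1))) as (lA & HlA & HlA'); [lra | |].
  { apply Rdiv_lt_0_compat; [|lra]. repeat apply Rmult_lt_0_compat; lra. }
  (* The four bounds: the range where the hypothesis on [A] applies, the smoothing error of [A] at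
     the first stage, [M0 >= B], and total displacement at most [eps]. *)
  set (l0 := Rmin (Rmin 1 lA) (Rmin (s0 * r / (B + 1)) (eps / (2 * (CV * (1 + G)))))).
  assert (HCG : 0 < CV * (1 + G)) by (apply Rmult_lt_0_compat; lra).
  assert (HCGV : CV <= CV * (1 + G)) by (rewrite <- (Rmult_1_r CV) at 1; apply Rmult_le_compat_l; lra).
  assert (Hl0 : 0 < l0).
  { unfold l0. repeat apply Rmin_pos; try lra; apply Rdiv_lt_0_compat; try lra. apply Rmult_lt_0_compat; lra. }
  assert (Hl1 : l0 <= 1) by (unfold l0; eapply Rle_trans; [apply Rmin_l | apply Rmin_l]).
  assert (Hl2 : l0 <= lA) by (unfold l0; eapply Rle_trans; [apply Rmin_l | apply Rmin_r]).
  assert (Hl3 : l0 <= s0 * r / (B + 1)) by (unfold l0; eapply Rle_trans; [apply Rmin_r | apply Rmin_l]).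
  assert (Hl4 : l0 <= eps / (2 * (CV * (1 + G)))) by (unfold l0; eapply Rle_trans; [apply Rmin_r | apply Rmin_r]).
  assert (Hl5 : 2 * (CV * (1 + G) * l0) <= eps).
  { apply Rle_trans with (2 * (CV * (1 + G)) * (eps / (2 * (CV * (1 + G))))); [|right; field; lra].
    rewrite <- Rmult_assoc. apply Rmult_le_compat_l; lra. }
  clearbody l0.
  (* [M0] is only an upper bound for the second derivatives, read off so that the first scale [l] of
     [stage] is exactly [l0]. *)
  set (M0 := s0 * r / l0). set (Mq := fun q => M0 * (/ tau) ^ q).
  assert (Hsr : 0 < s0 * r) by (apply Rmult_lt_0_compat; lra).
  assert (HM0 : B <= M0).
  { unfold M0. apply Rle_trans with (B + 1); [lra|]. apply (Rmult_le_reg_r l0); auto. unfold Rdiv.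
    rewrite (Rmult_assoc (s0 * r)), Rinv_l, Rmult_1_r by lra.
    apply Rle_trans with ((B + 1) * (s0 * r / (B + 1))); [apply Rmult_le_compat_l; lra | right; field; lra]. }
  assert (HM0p : 0 < M0) by (apply Rdiv_lt_0_compat; auto).
  assert (Hit : 1 <= / tau) by (rewrite <- Rinv_1; apply Rinv_le_contravar; lra).
  assert (HMq : forall q, 0 < Mq q) by (intros q; apply Rmult_lt_0_compat; auto; apply pow_lt; lra).
  assert (HMS : forall q, Mq q * (/ r) ^ 3 <= Mq (S q)).
  { intros q. unfold Mq. simpl. rewrite (Rmult_comm (/ tau)), <- (Rmult_assoc M0).
    apply Rmult_le_compat_l; [left; apply HMq|].
    replace (/ r * (/ r * (/ r * 1))) with (/ (r ^ 3)) by (simpl; field; lra).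
    apply Rinv_le_contravar; auto. }
  assert (HMS' : forall q, Mq q <= Mq (S q)).
  { intros q. unfold Mq. simpl. apply Rmult_le_compat_l; [lra|]. rewrite <- (Rmult_1_l ((/ tau) ^ q)) at 1.
    apply Rmult_le_compat_r; auto. apply pow_le; lra. }
  assert (Hlq : forall q, sqrt (dq q) * r / Mq q = l0 * (rho1 * tau) ^ q).
  { intros q. rewrite Hsq. unfold Mq, M0. rewrite pow_inv, Rpow_mult_distr. assert (tau ^ q <> 0) by (apply pow_nonzero; lra).
    field. repeat split; auto; lra. }
  assert (Hrt : 0 < rho1 * tau <= / 2).
  { split; [apply Rmult_lt_0_compat; auto|]. rewrite <- (Rmult_1_r (/ 2)). apply Rmult_le_compat; lra. }
  assert (Hrtq : forall q, 0 < (rho1 * tau) ^ q <= (/ 2) ^ q) by (intros q; split; [apply pow_lt | apply pow_incr]; lra).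
  assert (H2q : forall q, (/ 2) ^ q <= 1) by (intros q; rewrite <- (pow1 q); apply pow_incr; lra).
  assert (Hlqp : forall q, 0 < l0 * (rho1 * tau) ^ q <= l0 * (/ 2) ^ q).
  { intros q; split; [apply Rmult_lt_0_compat; auto; apply Hrtq | apply Rmult_le_compat_l; [lra | apply Hrtq]]. }
  assert (HAq : forall q a c p, Rabs (Sn 12 (sqrt (dq q) * r / Mq q) (A a c) p - A a c p) <= / 2 * (r * (r ^ 9 * dq q))).
  { intros q a c p. rewrite Hlq. eapply Rle_trans; [apply HA|].
    - split; [apply Hlqp|]. eapply Rle_trans; [apply Hlqp|]. rewrite <- (Rmult_1_r 1).
      assert (0 < (/ 2) ^ q) by (apply pow_lt; lra). apply Rmult_le_compat; try lra; auto.
    - rewrite <- Rpower_mult_distr; auto; [|apply Hrtq]. rewrite Rpower_pow_swap by lra.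
      replace (Rpower (rho1 * tau) (2 * b)) with (r ^ 9).
      2:{ unfold rho1, tau. rewrite <- Rpower_plus, Rpower_mult, <- Rpower_pow by lra. f_equal. unfold J. simpl. field. lra. }
      unfold dq. replace (/ 2 * (r * (r ^ 9 * (d0 * (r ^ 9) ^ q)))) with (/ 2 * (r * (r ^ 9 * d0)) * (r ^ 9) ^ q) by ring.
      rewrite <- Rmult_assoc. apply Rmult_le_compat_r; [left; apply pow_lt; auto|].
      apply Rle_trans with ((CA + 1) * (/ 2 * (r * (r ^ 9 * d0)) / (CA + 1))); [|right; field; lra].
      apply Rmult_le_compat; try lra; [left; apply exp_pos|]. apply HlA'; lra. }
  (* The gradient bounds keep a reserve [2 Cu sqrt (dq q)] for all later stages: as [sqrt (dq q)] at
     least halves, the drop of the reserve pays for the current increment. *)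
  set (P := fun q (x : (ix -> pt -> R) * (bool -> pt -> R)) =>
    (forall j, sm 2 (fst x j)) /\ (forall j, sm 2 (snd x j)) /\
    (forall j a p, Rabs (pd a (fst x j) p) <= V - 2 * Cu * sqrt (dq q)) /\
    (forall j a p, Rabs (pd a (snd x j) p) <= G - 2 * CV * sqrt (dq q)) /\
    (forall j a c p, Rabs (pd a (pd c (fst x j)) p) <= Mq q) /\
    (forall j a c p, Rabs (pd a (pd c (snd x j)) p) <= Mq q) /\
    (forall a c p, Rabs (A a c p - EE (fst x) (snd x) a c p - dq q * h0 a c) <= r * dq q)).
  set (Cd := Cu + CV).
  set (Q := fun q (x y : (ix -> pt -> R) * (bool -> pt -> R)) =>
    (forall j a p, Rabs (pd a (fst y j) p - pd a (fst x j) p) <= Cd * sqrt (dq q)) /\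
    (forall j a p, Rabs (pd a (snd y j) p - pd a (snd x j) p) <= Cd * sqrt (dq q)) /\
    (forall j p, Rabs (fst y j p - fst x j p) <= CV * (1 + G) * l0 * (/ 2) ^ q) /\
    (forall j p, Rabs (snd y j p - snd x j p) <= CV * (1 + G) * l0 * (/ 2) ^ q)).
  assert (Hss : forall q, 0 < sqrt (dq q) /\ 2 * sqrt (dq (S q)) <= sqrt (dq q)).
  { intros q. split; [apply sqrt_lt_R0, Hdq|]. rewrite !Hsq. simpl.
    assert (0 < s0 * rho1 ^ q) by (apply Rmult_lt_0_compat; auto; apply pow_lt; lra).
    replace (2 * (s0 * (rho1 * rho1 ^ q))) with (s0 * rho1 ^ q * (2 * rho1)) by ring.
    rewrite <- (Rmult_1_r (s0 * rho1 ^ q)) at 2. apply Rmult_le_compat_l; lra. }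
  assert (Tri : forall x y B1 B2, Rabs (y - x) <= B1 -> Rabs x <= B2 -> Rabs y <= B1 + B2).
  { intros x y B1 B2 H1 H2. replace y with ((y - x) + x) by ring. eapply Rle_trans; [apply Rabs_triang | lra]. }
  destruct (dependent_choice _ P Q) with (x0 := (v0, w0)) as (f & Hf0 & Hf).
  { intros q [v w] (H1 & H2 & H3 & H4 & H5 & H6 & H7). simpl in *.
    destruct (Hss q) as [Hs1 Hs2].
    assert (HCus : 0 <= Cu * sqrt (dq q)) by (apply Rmult_le_pos; lra).
    assert (HCVs : 0 <= CV * sqrt (dq q)) by (apply Rmult_le_pos; lra).
    assert (HCus2 : Cu * (2 * sqrt (dq (S q))) <= Cu * sqrt (dq q)) by (apply Rmult_le_compat_l; lra).
    assert (HCVs2 : CV * (2 * sqrt (dq (S q))) <= CV * sqrt (dq q)) by (apply Rmult_le_compat_l; lra).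
    destruct (Hstage r (dq q) (Mq q) G A v w) as (v' & w' & K1 & K2 & K3 & K4 & K5 & K6 & K7 & K8 & K9); auto; try lra.
    { intros j a p. specialize (H3 j a p). lra. }
    { intros j a p. specialize (H4 j a p). lra. }
    exists (v', w'). unfold P, Q; simpl fst; simpl snd. 
    rewrite Hlq in K7, K8.
    assert (Y : forall x B1, 0 <= B1 -> B1 <= CV * (1 + G) -> Rabs x <= B1 * (l0 * (rho1 * tau) ^ q) -> Rabs x <= CV * (1 + G) * l0 * (/ 2) ^ q).
    { intros x B1 HB0 HB1 Hx. eapply Rle_trans; [exact Hx|]. rewrite (Rmult_assoc _ l0). destruct (Hlqp q). apply Rmult_le_compat; lra. }
    unfold Cd.
    split; [|split; [|split; [|split]]].
    - split; [auto | split; [auto | split; [|split; [|split; [|split]]]]].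
      + intros j a p. eapply Rle_trans; [apply (Tri _ _ _ _ (K5 j a p) (H3 j a p))|]. lra.
      + intros j a p. eapply Rle_trans; [apply (Tri _ _ _ _ (K6 j a p) (H4 j a p))|]. lra.
      + intros. eapply Rle_trans; [apply K3 | apply HMS].
      + intros. eapply Rle_trans; [apply K4 | apply HMS].
      + intros a c p. replace (dq (S q)) with (r ^ 9 * dq q) by (unfold dq; simpl; ring). apply K9.
    - intros. eapply Rle_trans; [apply K5|]. lra.
    - intros. eapply Rle_trans; [apply K6|]. lra.
    - intros j p. apply (Y _ CV); auto; lra.
    - intros j p. apply (Y _ (CV * (1 + G))); auto; lra. }
  { assert (Hd00 : dq O = d0) by (unfold dq; simpl; ring). assert (HM00 : Mq O = M0) by (unfold Mq; simpl; ring).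
    unfold P; simpl fst; simpl snd. rewrite Hd00, HM00. fold s0.
    assert (Cu * s0 <= Cu * 1) by (apply Rmult_le_compat_l; lra). assert (CV * s0 <= CV * 1) by (apply Rmult_le_compat_l; lra).
    split; [auto | split; [auto | split; [|split; [|split; [|split; [|auto]]]]]]; intros; (eapply Rle_trans; [eauto | unfold V, G in *; lra]). }
  (* Ratio of successive Hölder increments: gradients decay by [rho1], second derivatives grow by
     [/ tau]. It is [r] to the power [9 / 2 * (b - alpha) / b], hence below [1] because
     [alpha < b]. *)
  set (kH := Rpower rho1 (1 - alpha) * Rpower (/ tau) alpha).
  assert (HkH : 0 < kH < 1).
  { split; [apply Rmult_lt_0_compat; apply exp_pos|]. unfold kH, rho1, tau.
    rewrite <- Rpower_Ropp, !Rpower_mult, <- Rpower_plus. apply Rpower_lt_1; [lra|].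
    replace (9 / 2 * (1 - alpha) + - J * alpha) with (9 / 2 * ((b - alpha) / b)) by (unfold J; field; lra).
    apply Rmult_lt_0_compat; [lra|]. apply Rdiv_lt_0_compat; lra. }
  set (k := Rmax rho1 kH).
  assert (Hk : 0 <= k < 1) by (unfold k; split; [eapply Rle_trans; [|apply Rmax_l]; lra | apply Rmax_lub_lt; lra]).
  assert (Hk1 : forall q, rho1 ^ q <= k ^ q) by (intros q; apply pow_incr; split; [lra | apply Rmax_l]).
  assert (Hk2 : forall q, kH ^ q <= k ^ q) by (intros q; apply pow_incr; split; [lra | apply Rmax_r]).
  assert (HCds : 0 < Cd * s0) by (apply Rmult_lt_0_compat; unfold Cd; lra).
  set (CH := Rpower (2 * (Cd * s0)) (1 - alpha) * Rpower (4 * (M0 * / tau)) alpha).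
  assert (HCH : 0 < CH) by (apply Rmult_lt_0_compat; apply exp_pos).
  assert (HMt : 0 < M0 * / tau) by (apply Rmult_lt_0_compat; lra).
  assert (Lim : forall u : nat -> pt -> R,
    (forall q, sm 2 (u q)) -> (forall q a c p, Rabs (pd a (pd c (u q)) p) <= Mq q) ->
    (forall q a p, Rabs (pd a (u (S q)) p - pd a (u q) p) <= Cd * sqrt (dq q)) ->
    (forall q p, Rabs (u (S q) p - u q p) <= CV * (1 + G) * l0 * (/ 2) ^ q) ->
    (forall p, bdp 2 1 B (u O) p) ->
    exists F, is_C1a alpha F /\ (forall p, is_lim_seq (fun q => u q p) (F p)) /\
    (forall b p, is_lim_seq (fun q => pd b (u q) p) (pd b F p)) /\
    forall p, Rabs (F p - u O p) <= 2 * (CV * (1 + G) * l0)).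
  { intros u Su Mu Du Vu Bu.
    apply (holder_limit alpha u (CV * (1 + G) * l0) (Cd * s0 + CH) k); try lra; auto.
    - apply Rmult_le_pos; lra.
    - intros; apply (sm_exd 1), Su.
    - intros q c p. eapply Rle_trans; [apply Du|]. rewrite Hsq.
      assert (X := Hk1 q). assert (0 < rho1 ^ q) by (apply pow_lt; lra).
      rewrite <- Rmult_assoc. apply Rmult_le_compat; lra.
    - intros q c p p' N.
      assert (E1 : forall n, forall e, exd e (pd c (u n))) by (intros n e; apply (sm_exd 0), sm_pd, Su).
      assert (Hsp : 0 < Cd * sqrt (dq q)) by (apply Rmult_lt_0_compat; [unfold Cd; lra | apply Hss]).
      eapply Rle_trans; [apply (holder_interpolated alpha (fun p => pd c (u (S q)) p - pd c (u q) p) (Cd * sqrt (dq q)) (2 * Mq (S q))); auto; try lra|].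
      + generalize (HMq (S q)); lra.
      + intros e. apply (exd_minus e (pd c (u (S q))) (pd c (u q))); auto.
      + intros e x. rewrite (proj2 (exd_minus e (pd c (u (S q))) (pd c (u q)) (E1 _ e) (E1 _ e))).
        unfold Rminus. eapply Rle_trans; [apply Rabs_triang|]. rewrite Rabs_Ropp.
        generalize (Mu (S q) e c x) (Mu q e c x) (HMS' q); lra.
      + apply Rmult_le_compat_r; [left; apply exp_pos|]. rewrite Hsq.
        replace (2 * (Cd * (s0 * rho1 ^ q))) with (2 * (Cd * s0) * rho1 ^ q) by ring.
        replace (2 * (2 * Mq (S q))) with (4 * (M0 * / tau) * (/ tau) ^ q) by (unfold Mq; simpl; ring).
        rewrite <- (Rpower_mult_distr (2 * (Cd * s0)) (rho1 ^ q)) by (try lra; apply pow_lt; lra).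
        rewrite <- (Rpower_mult_distr (4 * (M0 * / tau)) ((/ tau) ^ q)) by (try lra; apply pow_lt; lra).
        rewrite !Rpower_pow_swap by lra.
        replace (Rpower (2 * (Cd * s0)) (1 - alpha) * Rpower rho1 (1 - alpha) ^ q * (Rpower (4 * (M0 * / tau)) alpha * Rpower (/ tau) alpha ^ q))
          with (CH * kH ^ q) by (unfold CH, kH; rewrite Rpow_mult_distr; ring).
        assert (X := Hk2 q). assert (0 < kH ^ q) by (apply pow_lt; lra). apply Rmult_le_compat; lra.
    - exists B. intros p. apply (bdp_abs 2 1), Bu.
    - intros c. exists B. intros p. generalize (proj1 (bdp_2 1 B (u O) p (Bu p)) c); lra.
    - intros c. eexists. intros p q N.
      apply (holder_interpolated alpha (pd c (u O)) (B + 1) (B + 1)); auto; try lra.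
      + intros e; apply (sm_exd 0), sm_pd, Su.
      + intros x. generalize (proj1 (bdp_2 1 B (u O) x (Bu x)) c); lra.
      + intros e x. generalize (proj2 (bdp_2 1 B (u O) x (Bu x)) e c); lra. }
  assert (Lv : forall j, exists F, is_C1a alpha F /\ (forall p, is_lim_seq (fun q => fst (f q) j p) (F p)) /\
    (forall b p, is_lim_seq (fun q => pd b (fst (f q) j) p) (pd b F p)) /\
    forall p, Rabs (F p - v0 j p) <= 2 * (CV * (1 + G) * l0)).
  { intros j. replace (v0 j) with (fst (f O) j) by (rewrite Hf0; auto). apply (Lim (fun q => fst (f q) j)).
    - intros q; destruct (Hf q) as [(H1 & H2 & _) _]. exact (H1 j).
    - intros q; destruct (Hf q) as [(_ & _ & _ & _ & H5 & H6 & _) _]. exact (H5 j).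
    - intros q; destruct (Hf q) as [_ (K1 & K2 & _)]. exact (K1 j).
    - intros q; destruct (Hf q) as [_ (_ & _ & K3 & K4)]. exact (K3 j).
    - rewrite Hf0. exact (Bv0 j). }
  assert (Lw : forall j, exists F, is_C1a alpha F /\ (forall p, is_lim_seq (fun q => snd (f q) j p) (F p)) /\
    (forall b p, is_lim_seq (fun q => pd b (snd (f q) j) p) (pd b F p)) /\
    forall p, Rabs (F p - w0 j p) <= 2 * (CV * (1 + G) * l0)).
  { intros j. replace (w0 j) with (snd (f O) j) by (rewrite Hf0; auto). apply (Lim (fun q => snd (f q) j)).
    - intros q; destruct (Hf q) as [(H1 & H2 & _) _]. exact (H2 j).
    - intros q; destruct (Hf q) as [(_ & _ & _ & _ & H5 & H6 & _) _]. exact (H6 j).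
    - intros q; destruct (Hf q) as [_ (K1 & K2 & _)]. exact (K2 j).
    - intros q; destruct (Hf q) as [_ (_ & _ & K3 & K4)]. exact (K4 j).
    - rewrite Hf0. exact (Bw0 j). }
  apply functional_choice in Lv. destruct Lv as [tv Htv]. apply functional_choice in Lw. destruct Lw as [tw Htw].
  exists tv, tw. split; [intros; apply Htv|]. split; [intros; apply Htw|].
  split; [intros; eapply Rle_trans; [apply Htv | lra]|]. split; [intros; eapply Rle_trans; [apply Htw | lra]|].
  intros a c p.
  assert (L1 : is_lim_seq (fun q => EE (fst (f q)) (snd (f q)) a c p) (EE tv tw a c p)).
  { apply (is_lim_seq_EE (fun q => fst (f q)) (fun q => snd (f q))); intros; [apply Htv | apply Htw]. }
  assert (L2 : is_lim_seq (fun q => EE (fst (f q)) (snd (f q)) a c p) (A a c p)).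
  { assert (L3 : is_lim_seq dq 0).
    { replace (Finite 0) with (Rbar_mult d0 0) by (simpl; f_equal; ring). apply is_lim_seq_scal_l.
      apply is_lim_seq_geom. rewrite Rabs_pos_eq by lra. 
      apply Rle_lt_trans with (r ^ 1); [|rewrite pow_1; lra]. replace (r ^ 9) with (r ^ 8 * r ^ 1) by ring. rewrite <- (Rmult_1_l (r ^ 1)) at 2.
      apply Rmult_le_compat_r; [rewrite pow_1; lra|]. rewrite <- (pow1 8). apply pow_incr; lra. }
    apply (is_lim_seq_ext (fun q => A a c p - (A a c p - EE (fst (f q)) (snd (f q)) a c p))); [intros; ring|].
    replace (A a c p) with (A a c p - 0) at 1 by ring. apply is_lim_seq_minus'; [apply is_lim_seq_const|].
    apply (is_lim_seq_le_le (fun q => - ((r + 1) * dq q)) _ (fun q => (r + 1) * dq q)).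
    - intros q. apply Rabs_le_between. destruct (Hf q) as [(_ & _ & _ & _ & _ & _ & HD) _].
      replace (A a c p - EE (fst (f q)) (snd (f q)) a c p) with
        ((A a c p - EE (fst (f q)) (snd (f q)) a c p - dq q * h0 a c) + dq q * h0 a c) by ring.
      eapply Rle_trans; [apply Rabs_triang|]. rewrite Rmult_plus_distr_r. apply Rplus_le_compat; auto.
      destruct (h0_bound a c), (Hdq q). rewrite Rabs_pos_eq by (apply Rmult_le_pos; lra).
      rewrite Rmult_comm. apply Rmult_le_compat_r; lra.
    - replace (Finite 0) with (Rbar_opp (Rbar_mult (r + 1) 0)) by (simpl; f_equal; ring).
      apply (is_lim_seq_opp (fun q => (r + 1) * dq q)). apply is_lim_seq_scal_l; auto.
    - replace (Finite 0) with (Rbar_mult (r + 1) 0) by (simpl; f_equal; ring). apply is_lim_seq_scal_l; auto. }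
  apply is_lim_seq_unique in L1. apply is_lim_seq_unique in L2. rewrite L1 in L2. injection L2; auto.
Qed.

(** * Uniformly continuous data *)

Definition UC (f : pt -> R) : Prop := forall e, 0 < e -> exists d, 0 < d /\
  forall p q, box p d q -> Rabs (f q - f p) <= e.
Definition BUC (f : pt -> R) : Prop := UC f /\ bounded_fun f.

Lemma box_le p d d' q : d <= d' -> box p d q -> box p d' q.
Proof. intros H [H1 H2]; split; lra. Qed.

Lemma UC_cont f : UC f -> cont f.
Proof.
  intros H p. apply continuous_eps. intros e He. destruct (H (e / 2)) as (d & Hd & Hq); [lra|].
  exists d; split; auto. intros q H1 H2. apply Rle_lt_trans with (e / 2); [|lra]. apply Hq. split; lra.
Qed.

Lemma BUC_const c : BUC (fun _ => c).
Proof.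
  split.
  - intros e He. exists 1; split; [lra|]. intros. rewrite Rminus_diag, Rabs_R0; lra.
  - exists (Rabs c). intros; lra.
Qed.

Lemma bounded_pos f : bounded_fun f -> exists B, 0 < B /\ forall p, Rabs (f p) <= B.
Proof.
  intros [B HB]. exists (Rabs B + 1). assert (X := Rabs_pos B). split; [lra|].
  intros p. eapply Rle_trans; [apply HB|]. assert (Y := Rle_abs B). lra.
Qed.

(** Boundedness of the data makes a local Lipschitz condition on [g] sufficient, which covers
    products. *)
Lemma BUC_comp2 (g : R -> R -> R) f1 f2 : BUC f1 -> BUC f2 ->
  (forall B, 0 < B -> exists L, 0 < L /\ forall x y x' y', Rabs x <= B -> Rabs y <= B -> Rabs x' <= B -> Rabs y' <= B ->
     Rabs (g x' y' - g x y) <= L * (Rabs (x' - x) + Rabs (y' - y))) ->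
  BUC (fun p => g (f1 p) (f2 p)).
Proof.
  intros [U1 B1] [U2 B2] Hg.
  destruct (bounded_pos _ B1) as (C1 & HC1 & H1), (bounded_pos _ B2) as (C2 & HC2 & H2).
  destruct (Hg (C1 + C2)) as (L & HL & HLip); [lra|].
  assert (K1 : forall p, Rabs (f1 p) <= C1 + C2) by (intros p; specialize (H1 p); lra).
  assert (K2 : forall p, Rabs (f2 p) <= C1 + C2) by (intros p; specialize (H2 p); lra).
  split.
  - intros e He. destruct (U1 (e / (2 * L))) as (d1 & Hd1 & X1); [apply Rdiv_lt_0_compat; lra|].
    destruct (U2 (e / (2 * L))) as (d2 & Hd2 & X2); [apply Rdiv_lt_0_compat; lra|].
    exists (Rmin d1 d2). split; [apply Rmin_pos; auto|]. intros p q Hq.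
    eapply Rle_trans; [apply HLip; auto|].
    apply Rle_trans with (L * (e / (2 * L) + e / (2 * L))); [|right; field; lra].
    apply Rmult_le_compat_l; [lra|]. apply Rplus_le_compat; [apply X1, (box_le p (Rmin d1 d2)) | apply X2, (box_le p (Rmin d1 d2))]; auto using Rmin_l, Rmin_r.
  - exists (Rabs (g 0 0) + L * (2 * (C1 + C2))). intros p.
    replace (g (f1 p) (f2 p)) with (g 0 0 + (g (f1 p) (f2 p) - g 0 0)) by ring.
    eapply Rle_trans; [apply Rabs_triang|]. apply Rplus_le_compat_l.
    eapply Rle_trans; [apply HLip; auto; rewrite Rabs_R0; lra|].
    apply Rmult_le_compat_l; [lra|]. rewrite !Rminus_0_r. specialize (K1 p). specialize (K2 p). lra.
Qed.

Lemma BUC_plus f g : BUC f -> BUC g -> BUC (fun p => f p + g p).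
Proof.
  intros Hf Hg. apply (BUC_comp2 (fun x y => x + y)); auto. intros B HB. exists 1; split; [lra|].
  intros. replace (x' + y' - (x + y)) with ((x' - x) + (y' - y)) by ring. rewrite Rmult_1_l. apply Rabs_triang.
Qed.
Lemma BUC_mult f g : BUC f -> BUC g -> BUC (fun p => f p * g p).
Proof.
  intros Hf Hg. apply (BUC_comp2 (fun x y => x * y)); auto. intros B HB. exists B; split; [lra|].
  intros. replace (x' * y' - x * y) with (y' * (x' - x) + x * (y' - y)) by ring.
  eapply Rle_trans; [apply Rabs_triang|]. rewrite Rmult_plus_distr_l, !Rabs_mult.
  apply Rplus_le_compat; apply Rmult_le_compat_r; auto using Rabs_pos.
Qed.
Lemma BUC_scal c f : BUC f -> BUC (fun p => c * f p).
Proof. intros; apply BUC_mult; auto using BUC_const. Qed.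
Lemma BUC_minus f g : BUC f -> BUC g -> BUC (fun p => f p - g p).
Proof.
  intros Hf Hg. replace (fun p => f p - g p) with (fun p => f p + -1 * g p)
    by (apply functional_extensionality; intros; ring). auto using BUC_plus, BUC_scal.
Qed.
Lemma BUC_lip (g : R -> R) f L : 0 < L -> (forall x y, Rabs (g y - g x) <= L * Rabs (y - x)) -> BUC f -> BUC (fun p => g (f p)).
Proof.
  intros HL Hg Hf. apply (BUC_comp2 (fun x _ => g x) f f); auto. intros B HB. exists L; split; auto.
  intros. eapply Rle_trans; [apply Hg|]. apply Rmult_le_compat_l; [lra|]. assert (X := Rabs_pos (y' - y)). lra.
Qed.
Lemma lip_max c x y : Rabs (Rmax c y - Rmax c x) <= 1 * Rabs (y - x).
Proof. rewrite Rmult_1_l. unfold Rmax, Rabs. repeat destruct Rle_dec; repeat destruct Rcase_abs; lra. Qed.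
Lemma lip_min c x y : Rabs (Rmin c y - Rmin c x) <= 1 * Rabs (y - x).
Proof. rewrite Rmult_1_l. unfold Rmin, Rabs. repeat destruct Rle_dec; repeat destruct Rcase_abs; lra. Qed.
Lemma lip_abs x y : Rabs (Rabs y - Rabs x) <= 1 * Rabs (y - x).
Proof. rewrite Rmult_1_l. unfold Rabs. repeat destruct Rcase_abs; lra. Qed.
Lemma BUC_min f g : BUC f -> BUC g -> BUC (fun p => Rmin (f p) (g p)).
Proof.
  intros Hf Hg. apply (BUC_comp2 Rmin); auto. intros B HB. exists 1; split; [lra|].
  intros. unfold Rmin, Rabs. repeat destruct Rle_dec; repeat destruct Rcase_abs; lra.
Qed.
Lemma BUC_inv f c : 0 < c -> BUC f -> (forall p, c <= f p) -> BUC (fun p => / f p).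
Proof.
  intros Hc Hf Hp. replace (fun p => / f p) with (fun p => (fun x => / Rmax c x) (f p)).
  2:{ apply functional_extensionality; intros p. simpl. rewrite Rmax_right; auto. }
  apply (BUC_lip (fun x => / Rmax c x) f (/ c * / c)); auto.
  { apply Rmult_lt_0_compat; apply Rinv_0_lt_compat; auto. }
  intros x y. assert (X := Rmax_l c x). assert (Y := Rmax_l c y).
  replace (/ Rmax c y - / Rmax c x) with (/ Rmax c y * / Rmax c x * - (Rmax c y - Rmax c x)) by (field; lra).
  rewrite Rabs_mult, Rabs_Ropp. apply Rmult_le_compat; auto using Rabs_pos.
  - rewrite Rabs_pos_eq; [apply Rmult_le_compat; try (apply Rinv_le_contravar; lra) |]; 
      try apply Rmult_le_pos; left; apply Rinv_0_lt_compat; lra.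
  - generalize (lip_max c x y); lra.
Qed.
(** [sqrt] is not Lipschitz at [0], where amplitudes may vanish; the modulus comes from the square
    of the difference of two roots being at most the difference of the arguments. *)
Lemma BUC_sqrt f : BUC f -> (forall p, 0 <= f p) -> BUC (fun p => sqrt (f p)).
Proof.
  intros [U B] Hp. split.
  - intros e He. destruct (U (e * e)) as (d & Hd & H); [apply Rmult_lt_0_compat; auto|].
    exists d; split; auto. intros p q Hq. specialize (H p q Hq).
    assert (X := sqrt_pos (f p)). assert (Y := sqrt_pos (f q)).
    assert (X2 := sqrt_sqrt (f p) (Hp p)). assert (Y2 := sqrt_sqrt (f q) (Hp q)).
    rewrite <- X2, <- Y2 in H. revert H.
    replace (sqrt (f q) * sqrt (f q) - sqrt (f p) * sqrt (f p))
      with ((sqrt (f q) - sqrt (f p)) * (sqrt (f q) + sqrt (f p))) by ring.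
    rewrite Rabs_mult, (Rabs_pos_eq (_ + _)) by lra. intros H.
    apply Rnot_lt_le. intros N.
    assert (Z : Rabs (sqrt (f q) - sqrt (f p)) <= sqrt (f q) + sqrt (f p)) by (unfold Rabs; destruct Rcase_abs; lra).
    assert (e * e < Rabs (sqrt (f q) - sqrt (f p)) * (sqrt (f q) + sqrt (f p))) by (apply Rmult_le_0_lt_compat; lra).
    lra.
  - destruct B as [B HB]. exists (B + 1). intros p. specialize (HB p). rewrite Rabs_pos_eq in HB by auto.
    rewrite Rabs_pos_eq by apply sqrt_pos. assert (X := sqrt_pos (f p)). assert (X2 := sqrt_sqrt (f p) (Hp p)).
    destruct (Rle_dec (sqrt (f p)) 1); [specialize (Hp p); lra|].
    assert (1 * sqrt (f p) <= sqrt (f p) * sqrt (f p)) by (apply Rmult_le_compat_r; lra). lra.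
Qed.

Lemma holder_box a f M : 0 < a -> (forall p q, p <> q -> Rabs (f p - f q) <= M * Rpower (dist2 p q) a) ->
  forall d p q, 0 < d -> box p d q -> Rabs (f q - f p) <= Rabs M * Rpower (2 * d) a.
Proof.
  intros Ha H d p q Hd [H1 H2].
  assert (HR : 0 <= Rabs M * Rpower (2 * d) a) by (apply Rmult_le_pos; [apply Rabs_pos | left; apply exp_pos]).
  destruct (classic (q = p)) as [->|N]; [rewrite Rminus_diag, Rabs_R0; auto|].
  eapply Rle_trans; [apply H; auto|].
  apply Rle_trans with (Rabs M * Rpower (dist2 q p) a).
  - apply Rmult_le_compat_r; [left; apply exp_pos | apply Rle_abs].
  - apply Rmult_le_compat_l; [apply Rabs_pos|]. apply Rle_Rpower_l; [lra|].
    split; [apply dist2_pos; auto|]. eapply Rle_trans; [apply dist2_le|]. lra.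
Qed.

Lemma holder_BUC a f : 0 < a -> is_C0a a f -> BUC f.
Proof.
  intros Ha [B [M HM]]. split; auto. intros e He.
  assert (HB : 0 < 1 + Rabs M) by (assert (X := Rabs_pos M); lra).
  destruct (Rpower_small a (e / (1 + Rabs M))) as (d & Hd & Hx); [auto | apply Rdiv_lt_0_compat; lra |].
  exists (d / 2); split; [lra|]. intros p q Hq.
  eapply Rle_trans; [apply (holder_box a f M Ha HM (d / 2) p q); auto; lra|].
  replace (2 * (d / 2)) with d by field.
  apply Rle_trans with ((1 + Rabs M) * (e / (1 + Rabs M))); [|right; field; lra].
  apply Rmult_le_compat; auto using Rabs_pos; try lra; [left; apply exp_pos | apply Hx; lra].
Qed.

(** * Approximation by Steklov means *)

Definition ul (F : R -> pt -> R) (f : pt -> R) : Prop := forall e, 0 < e -> exists h0, 0 < h0 /\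
  forall h, 0 < h <= h0 -> forall p, Rabs (F h p - f p) <= e.

Lemma ul_Sn n f : UC f -> ul (fun h => Sn n h f) f.
Proof.
  intros Hf e He. destruct (Hf e He) as (d & Hd & H). assert (Hn := pos_INR n).
  exists (d / (INR n + 1)). split; [apply Rdiv_lt_0_compat; lra|]. intros h Hh p.
  apply Sn_near; [lra | apply UC_cont; auto |]. intros q Hq. apply H. eapply box_le; [|exact Hq].
  apply Rle_trans with ((INR n + 1) * (d / (INR n + 1))); [|right; field; lra].
  apply Rmult_le_compat; lra.
Qed.
Lemma ul_const f : ul (fun _ => f) f.
Proof. intros e He. exists 1; split; [lra|]. intros. rewrite Rminus_diag, Rabs_R0; lra. Qed.
Lemma ul_plus F G f g : ul F f -> ul G g -> ul (fun h p => F h p + G h p) (fun p => f p + g p).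
Proof.
  intros HF HG e He. destruct (HF (e / 2)) as (h1 & H1 & X1); [lra|]. destruct (HG (e / 2)) as (h2 & H2 & X2); [lra|].
  exists (Rmin h1 h2); split; [apply Rmin_pos; auto|]. intros h Hh p.
  assert (A1 := Rmin_l h1 h2). assert (A2 := Rmin_r h1 h2).
  replace (F h p + G h p - (f p + g p)) with ((F h p - f p) + (G h p - g p)) by ring.
  eapply Rle_trans; [apply Rabs_triang|]. replace e with (e / 2 + e / 2) by field. apply Rplus_le_compat; [apply X1 | apply X2]; lra.
Qed.
Lemma ul_mult F G f g : bounded_fun f -> bounded_fun g -> ul F f -> ul G g ->
  ul (fun h p => F h p * G h p) (fun p => f p * g p).
Proof.
  intros Bf Bg HF HG e He.
  destruct (bounded_pos _ Bf) as (C & HC & KC), (bounded_pos _ Bg) as (D & HD & KD).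
  set (t := Rmin 1 (e / (C + D + 1))).
  assert (Ht : 0 < t) by (apply Rmin_pos; [lra | apply Rdiv_lt_0_compat; lra]).
  assert (Ht1 : t <= 1) by apply Rmin_l.
  assert (Ht2 : (C + D + 1) * t <= e).
  { apply Rle_trans with ((C + D + 1) * (e / (C + D + 1))); [apply Rmult_le_compat_l; [lra | apply Rmin_r] | right; field; lra]. }
  destruct (HF t Ht) as (h1 & H1 & X1). destruct (HG t Ht) as (h2 & H2 & X2).
  exists (Rmin h1 h2); split; [apply Rmin_pos; auto|]. intros h Hh p.
  assert (A1 := Rmin_l h1 h2). assert (A2 := Rmin_r h1 h2).
  assert (Y1 : Rabs (F h p - f p) <= t) by (apply X1; lra). assert (Y2 : Rabs (G h p - g p) <= t) by (apply X2; lra).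
  replace (F h p * G h p - f p * g p) with ((F h p - f p) * (G h p - g p) + ((F h p - f p) * g p + f p * (G h p - g p))) by ring.
  eapply Rle_trans; [apply Rabs_triang|]. eapply Rle_trans; [apply Rplus_le_compat_l, Rabs_triang|]. rewrite !Rabs_mult.
  apply Rle_trans with (t * 1 + (t * D + C * t)); [|lra].
  apply Rplus_le_compat; [|apply Rplus_le_compat]; apply Rmult_le_compat; auto using Rabs_pos; lra.
Qed.
(** The mean over a symmetric interval annihilates the linear Taylor term, which leaves an error of
    second order in [h]. *)
Lemma stk_second b h f B p : 0 < h -> sm 2 f -> (forall a c p, Rabs (pd a (pd c f) p) <= B) ->
  Rabs (stk b h f p - f p) <= 2 * B * h ^ 2.
Proof.
  intros Hh Sf HB.
  assert (Cf : cont f) by (apply (sm_cont 2); auto).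
  assert (HB0 : 0 <= B) by (eapply Rle_trans; [apply Rabs_pos | apply (HB true true p)]).
  set (c := pd b f p).
  assert (T : forall t, Rabs t <= h -> Rabs (f (sh b p t) - (f p + t * c)) <= 2 * B * h ^ 2).
  { intros t Ht. destruct (Req_dec t 0) as [->|N].
    - unfold sh. rewrite Rplus_0_r, upd_crd. replace (f p - (f p + 0 * c)) with 0 by ring. rewrite Rabs_R0.
      apply Rmult_le_pos; [lra | apply pow_le; lra].
    - generalize (taylor_holder 1 (2 * B) f b Rlt_0_1). intros X.
      specialize (X ltac:(lra) (fun d => sm_exd 1 f d Sf)).
      assert (HH : forall p q, p <> q -> Rabs (pd b f p - pd b f q) <= 2 * B * Rpower (dist2 p q) 1).
      { intros x y Nxy. rewrite Rpower_1 by (apply dist2_pos; auto).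
        eapply Rle_trans; [apply (lipschitz (pd b f) B); auto; intros d; apply (sm_exd 0), sm_pd, Sf|].
        assert (Y := dd1_dist2 y x). assert (B * dd1 y x <= B * (2 * dist2 x y)) by (apply Rmult_le_compat_l; lra). lra. }
      specialize (X HH p (crd b p + t)). replace (crd b p + t - crd b p) with t in X by ring.
      rewrite Rpower_1 in X by (apply Rabs_pos_lt; auto). fold (sh b p t) in X. fold c in X.
      replace (f (sh b p t) - (f p + t * c)) with (f (sh b p t) - f p - t * c) by ring.
      eapply Rle_trans; [apply X; lra|]. rewrite Rmult_assoc. apply Rmult_le_compat_l; [lra|].
      simpl. rewrite Rmult_1_r. apply Rmult_le_compat; auto using Rabs_pos. }
  assert (I1 : is_RInt (fun t => f p + t * c) (- h) h (2 * h * f p)).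
  { replace (2 * h * f p) with (minus (h * f p + h ^ 2 / 2 * c) ((- h) * f p + (- h) ^ 2 / 2 * c))
      by (unfold minus, plus, opp; simpl; field).
    apply (is_RInt_derive (fun t => t * f p + t ^ 2 / 2 * c)).
    - intros x _. auto_derive; auto. field.
    - intros x _. apply (ex_derive_continuous (fun t => f p + t * c)). auto_derive; auto. }
  unfold stk.
  replace (/ (2 * h) * RInt (fun t => f (sh b p t)) (- h) h - f p)
    with (/ (2 * h) * RInt (fun t => f (sh b p t) - (f p + t * c)) (- h) h).
  - rewrite Rabs_mult, Rabs_pos_eq by (left; apply Rinv_0_lt_compat; lra).
    apply (Rmult_le_reg_l (2 * h)); [lra|]. rewrite <- Rmult_assoc, Rinv_r, Rmult_1_l by lra.
    replace (2 * h * (2 * B * h ^ 2)) with ((h - - h) * (2 * B * h ^ 2)) by ring.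
    apply abs_RInt_le_const; [lra | |].
    + apply (ex_RInt_minus (V := R_CompleteNormedModule) (fun t => f (sh b p t))); [apply ex_RInt_sh; auto | eexists; exact I1].
    + intros t Ht. apply T. apply Rabs_le; lra.
  - rewrite (RInt_minus (V := R_CompleteNormedModule) (fun t => f (sh b p t)) (fun t => f p + t * c));
      [|apply ex_RInt_sh; auto | eexists; exact I1].
    rewrite (is_RInt_unique (V := R_CompleteNormedModule) _ _ _ _ I1). unfold minus, plus, opp; simpl. field; lra.
Qed.

Lemma stk_pd2_bound b h f B : 0 < h -> sm 2 f -> (forall a c p, Rabs (pd a (pd c f) p) <= B) ->
  forall a c p, Rabs (pd a (pd c (stk b h f)) p) <= B.
Proof.
  intros Hh Sf HB a c p.
  destruct (stk_pd b c h f) as [_ ->]; auto; [apply (sm_cont 2); auto | apply (sm_exd 1); auto | apply (sm_cont 1), sm_pd; auto |].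
  destruct (stk_pd b a h (pd c f)) as [_ ->]; auto;
    [apply (sm_cont 1), sm_pd; auto | apply (sm_exd 0), sm_pd; auto | apply (sm_cont 0), sm_pd, sm_pd; auto |].
  apply stk_bound; auto. apply (sm_cont 0), sm_pd, sm_pd; auto.
Qed.

Transparent Sn.
(** Needed because the exponent [2 * b] of the smoothing error in [iteration] may exceed [1]: for
    the field [Th] added to the diagonal of [A], a first order estimate would be too weak. *)
Lemma Sn_second n h f B p : 0 < h -> sm 2 f -> (forall a c p, Rabs (pd a (pd c f) p) <= B) ->
  Rabs (Sn n h f p - f p) <= INR n * (4 * B * h ^ 2).
Proof.
  intros Hh. revert f; induction n as [|n IH]; intros f Sf HB.
  - simpl. rewrite Rminus_diag, Rabs_R0. lra.
  - rewrite S_INR. simpl Sn.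
    assert (S1 : sm 2 (stk false h f)) by (apply sm_stk; auto).
    assert (B1 := stk_pd2_bound false h f B Hh Sf HB).
    assert (S2 : sm 2 (stk2 h f)) by exact (sm_stk 2 true h _ Hh S1).
    assert (B2 := stk_pd2_bound true h _ B Hh S1 B1). fold (stk2 h f) in B2.
    replace (Sn n h (stk2 h f) p - f p) with
      ((Sn n h (stk2 h f) p - stk2 h f p) + ((stk2 h f p - stk false h f p) + (stk false h f p - f p))) by ring.
    eapply Rle_trans; [apply Rabs_triang|]. rewrite Rmult_plus_distr_r. apply Rplus_le_compat; [apply IH; auto|].
    eapply Rle_trans; [apply Rabs_triang|]. 
    assert (X1 := stk_second true h _ B p Hh S1 B1). assert (X2 := stk_second false h f B p Hh Sf HB).
    fold (stk2 h f) in X1. lra.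
Qed.
Opaque Sn.

(** * Compactness *)

(** One number [d] is both the radius of the neighbourhood and the bound expressed by [P]. Reading
    [P d] as an upper bound [/ d] gives boundedness, reading it as a lower bound [d] gives a
    positive minimum. *)
Lemma compact_box r (P : R -> pt -> Prop) : (forall d d' p, 0 < d' <= d -> P d p -> P d' p) ->
  (forall p, Rabs (fst p) <= r -> Rabs (snd p) <= r -> exists d, 0 < d /\
    forall q, Rabs (fst q - fst p) < d -> Rabs (snd q - snd p) < d -> P d q) ->
  exists d, 0 < d /\ forall q, Rabs (fst q) <= r -> Rabs (snd q) <= r -> P d q.
Proof.
  intros Hm H.
  assert (H' : forall p : pt, exists d : posreal, Rabs (fst p) <= r -> Rabs (snd p) <= r ->
    forall q, Rabs (fst q - fst p) < d -> Rabs (snd q - snd p) < d -> P d q).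
  { intros p. destruct (classic (Rabs (fst p) <= r /\ Rabs (snd p) <= r)) as [[H1 H2]|N].
    - destruct (H p H1 H2) as (d & Hd & X). exists (mkposreal d Hd). auto.
    - exists (mkposreal 1 Rlt_0_1). intros; exfalso; auto. }
  apply functional_choice in H'. destruct H' as [dl Hdl].
  destruct (compactness_value_2d (- r) r (- r) r (fun x y => dl (x, y))) as [d Hd].
  exists d; split; [apply d|]. intros [x y] Hx Hy. simpl in Hx, Hy.
  apply Rabs_le_between in Hx. apply Rabs_le_between in Hy.
  destruct (NNPP _ (Hd x y Hx Hy)) as (u & v & Hu & Hv & H1 & H2 & H3).
  apply (Hm (dl (u, v))).
  - split; auto. apply d.
  - apply Hdl; auto; simpl; apply Rabs_le_between; auto.
Qed.

Lemma cont_bounded_box r f : cont f -> exists B, 0 < B /\ forall q, Rabs (fst q) <= r -> Rabs (snd q) <= r -> Rabs (f q) <= B.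
Proof.
  intros Hf. destruct (compact_box r (fun d q => Rabs (f q) <= / d)) as (d & Hd & X).
  - intros d d' p Hd Hp. eapply Rle_trans; [exact Hp|]. apply Rinv_le_contravar; lra.
  - intros p _ _. destruct (proj1 (continuous_eps f p) (Hf p) 1 Rlt_0_1) as (d & Hd & X).
    assert (Hp := Rabs_pos (f p)).
    assert (Hi : 0 < / (Rabs (f p) + 1)) by (apply Rinv_0_lt_compat; lra).
    exists (Rmin d (/ (Rabs (f p) + 1))). split; [apply Rmin_pos; auto|].
    intros q H1 H2. assert (Y : Rabs (f q - f p) < 1) by (apply X; eapply Rlt_le_trans; eauto using Rmin_l).
    apply Rle_trans with (Rabs (f p) + 1).
    + replace (f q) with (f p + (f q - f p)) by ring. eapply Rle_trans; [apply Rabs_triang | lra].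
    + apply Rle_trans with (/ / (Rabs (f p) + 1)); [rewrite Rinv_inv; lra|]. apply Rinv_le_contravar; [apply Rmin_pos; auto | apply Rmin_r].
  - exists (/ d). split; [apply Rinv_0_lt_compat; auto | auto].
Qed.

Lemma closure_inf (om : pt -> Prop) r f : cont f -> (forall p, closure2 om p -> Rabs (fst p) <= r /\ Rabs (snd p) <= r) ->
  (forall p, closure2 om p -> 0 < f p) -> exists c, 0 < c /\ forall p, closure2 om p -> c <= f p.
Proof.
  intros Hf Hr Hp. destruct (compact_box r (fun d q => closure2 om q -> d <= f q)) as (c & Hc & X).
  - intros d d' p Hd H K. specialize (H K). lra.
  - intros p _ _. destruct (classic (closure2 om p)) as [K|K].
    + specialize (Hp p K). destruct (proj1 (continuous_eps f p) (Hf p) (f p / 2)) as (d & Hd & X); [lra|].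
      exists (Rmin d (f p / 2)). split; [apply Rmin_pos; lra|]. intros q H1 H2 _.
      assert (Y : Rabs (f q - f p) < f p / 2) by (apply X; eapply Rlt_le_trans; eauto using Rmin_l).
      apply Rabs_lt_between in Y. eapply Rle_trans; [apply Rmin_r | lra].
    (* A point outside the closure has a neighbourhood outside it, so the local property holds
       vacuously there. *)
    + apply not_all_ex_not in K. destruct K as [e K]. apply imply_to_and in K. destruct K as [He K].
      exists (e / 4). split; [lra|]. intros q H1 H2 Kq. exfalso. destruct (Kq (e / 4)) as (z & Oz & Dz); [lra|].
      apply K. exists z; split; auto. destruct (dist2_ge q z) as [D1 D2].
      eapply Rle_lt_trans; [apply dist2_le|].
      assert (T1 := Rabs_triang (- (fst q - fst p)) (fst q - fst z)). assert (T2 := Rabs_triang (- (snd q - snd p)) (snd q - snd z)).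
      rewrite Rabs_Ropp in T1, T2. 
      replace (- (fst q - fst p) + (fst q - fst z)) with (fst p - fst z) in T1 by ring.
      replace (- (snd q - snd p) + (snd q - snd z)) with (snd p - snd z) in T2 by ring. lra.
  - exists c; split; auto. intros p K. destruct (Hr p K). auto.
Qed.

(** * Decomposition of a positive definite field into primitive ones *)

Fixpoint rsum (n : nat) (g : nat -> R) : R := match n with O => 0 | S m => rsum m g + g m end.

Lemma rsum_ext n f g : (forall k, (k < n)%nat -> f k = g k) -> rsum n f = rsum n g.
Proof. induction n; simpl; intros H; auto. rewrite IHn, H; auto. Qed.
Lemma rsum_scal n c g : rsum n (fun k => c * g k) = c * rsum n g.
Proof. induction n; simpl; [ring | rewrite IHn; ring]. Qed.
Lemma rsum_zero n g : (forall k, (k < n)%nat -> g k = 0) -> rsum n g = 0.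
Proof. induction n; simpl; intros H; auto. rewrite IHn, H; auto. ring. Qed.
Lemma rsum_nonneg n g : (forall k, 0 <= g k) -> 0 <= rsum n g.
Proof. induction n; simpl; intros H; [lra|]. specialize (IHn H). specialize (H n). lra. Qed.
Lemma rsum_plus n f g : rsum n (fun k => f k + g k) = rsum n f + rsum n g.
Proof. induction n; simpl; [ring | rewrite IHn; ring]. Qed.

Definition hat (x : R) : R := Rmax 0 (1 + - Rabs x).

Lemma hat_bound x : 0 <= hat x <= 1.
Proof. unfold hat. assert (X := Rabs_pos x). split; [apply Rmax_l | apply Rmax_lub; lra]. Qed.
Lemma hat_out x : 1 <= Rabs x -> hat x = 0.
Proof. intros. unfold hat. apply Rmax_left. lra. Qed.
Lemma hat_in x : 0 <= x <= 1 -> hat x = 1 - x.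
Proof. intros. unfold hat. rewrite Rabs_pos_eq, Rmax_right; lra. Qed.
Lemma hat_even x : hat (- x) = hat x.
Proof. unfold hat. rewrite Rabs_Ropp; auto. Qed.

(** At most two tents are nonzero at [x], so the sum interpolates [phi] linearly between two nodes.
    The second alternative arises for [n = 0], where the sum has no node [S k]. *)
Lemma hat_interpolation n x : 0 <= x <= INR n -> exists k t, x = INR k + t /\ 0 <= t <= 1 /\
  forall phi, rsum (S n) (fun i => hat (x - INR i) * phi i) = (1 - t) * phi k + t * phi (S k) \/
     (k = n /\ t = 0 /\ rsum (S n) (fun i => hat (x - INR i) * phi i) = phi k).
Proof.
  induction n as [|n IH]; intros Hx.
  - simpl in Hx. exists O, 0. split; [simpl; lra|]. split; [lra|]. intros phi. right.
    split; [auto | split; [auto|]]. simpl. replace (x - 0) with 0 by lra. rewrite hat_in by lra. ring.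
  - rewrite S_INR in Hx. destruct (Rle_dec x (INR n)) as [Hn|Hn].
    + destruct IH as (k & t & Ek & Ht & E); [lra|]. exists k, t. split; auto. split; auto.
      intros phi. left. change (rsum (S (S n)) (fun i => hat (x - INR i) * phi i))
        with (rsum (S n) (fun i => hat (x - INR i) * phi i) + hat (x - INR (S n)) * phi (S n)).
      destruct (E phi) as [Ep | (-> & -> & Ep)]; rewrite Ep.
      * rewrite (hat_out (x - INR (S n))); [ring|]. rewrite S_INR, Rabs_left1; lra.
      * rewrite (hat_out (x - INR (S n))); [ring|]. rewrite S_INR, Rabs_left1; lra.
    + exists n, (x - INR n). split; [ring|]. split; [lra|]. intros phi. left.
      simpl rsum. rewrite rsum_zero.
      * replace (x - match n with 0%nat => 1 | S _ => INR n + 1 end) with (- (1 - (x - INR n)))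
          by (destruct n; simpl; ring). rewrite hat_even, !hat_in by lra. ring.
      * intros k Hk. rewrite hat_out; [ring|]. 
        assert (INR k + 1 <= INR n) by (rewrite <- S_INR; apply le_INR; lia). rewrite Rabs_pos_eq; lra.
Qed.

(** Linear interpolation reproduces affine functions; on squares it errs by [t (1 - t)], which lies
    between [0] and [1]. *)
Lemma hat_moments n x : 0 <= x <= INR n ->
  rsum (S n) (fun i => hat (x - INR i)) = 1 /\ rsum (S n) (fun i => hat (x - INR i) * INR i) = x /\
  x * x <= rsum (S n) (fun i => hat (x - INR i) * (INR i * INR i)) <= x * x + 1.
Proof.
  intros Hx. destruct (hat_interpolation n x Hx) as (k & t & Ek & Ht & E).
  assert (E0 := E (fun _ => 1)). assert (E1 := E INR). assert (E2 := E (fun i => INR i * INR i)). clear E. cbv beta in E0, E2.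
  rewrite (rsum_ext (S n) _ (fun i => hat (x - INR i))) in E0 by (intros; ring). 
  assert (Hk := pos_INR k). rewrite S_INR in E1, E2.
  assert (0 <= t * (1 - t) <= 1). { split; [apply Rmult_le_pos; lra|]. rewrite <- (Rmult_1_l 1). apply Rmult_le_compat; lra. }
  destruct E0 as [E0 | (_ & _ & E0)], E1 as [E1 | (_ & T1 & E1)], E2 as [E2 | (_ & T2 & E2)];
    rewrite E0, E1, E2, Ek; try subst t; repeat split; nra.
Qed.

Lemma BUC_hat f : BUC f -> BUC (fun p => hat (f p)).
Proof.
  intros Hf. unfold hat. apply (BUC_lip (Rmax 0) (fun p => 1 + - Rabs (f p)) 1); [lra | apply lip_max|].
  apply BUC_plus; [apply BUC_const|]. replace (fun p => - Rabs (f p)) with (fun p => -1 * Rabs (f p))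
    by (apply functional_extensionality; intros; ring).
  apply BUC_scal. apply (BUC_lip Rabs f 1); auto using lip_abs; lra.
Qed.

Lemma BUC_rsum n f : (forall k, BUC (f k)) -> BUC (fun p => rsum n (fun k => f k p)).
Proof. intros H. induction n; simpl; [apply BUC_const | apply BUC_plus; auto]. Qed.

Lemma BUC_EE v w a b : (forall j c, BUC (pd c (v j))) -> (forall j c, BUC (pd c (w j))) -> BUC (EE v w a b).
Proof.
  intros Hv Hw. unfold EE, sum3.
  assert (X : forall j, BUC (fun p => / 2 * (pd a (v j) p * pd b (v j) p))) by (intros j; apply BUC_scal, BUC_mult; auto).
  exact (BUC_plus _ _ (BUC_plus _ _ (BUC_plus _ _ (X j1) (X j2)) (X j3)) (BUC_scal (/ 2) _ (BUC_plus _ _ (Hw b a) (Hw a b)))).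
Qed.

Definition ent (x : R * R) (b : bool) : R := if b then fst x else snd x.

(* The slope [F12 / F11] is interpolated on a fine grid; what is left is a multiple of [e2 e2]. *)
Lemma decomposition (F : bool -> bool -> pt -> R) c : 0 < c ->
  (forall a b, BUC (F a b)) -> (forall p, F true false p = F false true p) ->
  (forall p, c <= F true true p) -> (forall p, c <= F true true p * F false false p - F true false p * F true false p) ->
  exists n (f : nat -> pt -> R) (xi : nat -> R * R) B,
    (forall k, BUC (f k)) /\ (forall k p, 0 <= f k p <= B) /\
    forall a b p, rsum n (fun k => f k p * (ent (xi k) a * ent (xi k) b)) = F a b p.
Proof.
  intros Hc HF Sy H1 H2.
  assert (HB : exists B, 1 <= B /\ forall a b p, Rabs (F a b p) <= B).
  { destruct (bounded_pos _ (proj2 (HF true true))) as (B1 & P1 & K1), (bounded_pos _ (proj2 (HF true false))) as (B2 & P2 & K2),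
      (bounded_pos _ (proj2 (HF false true))) as (B3 & P3 & K3), (bounded_pos _ (proj2 (HF false false))) as (B4 & P4 & K4).
    exists (1 + B1 + B2 + B3 + B4); split; [lra|].
    intros [] [] p; [specialize (K1 p) | specialize (K2 p) | specialize (K3 p) | specialize (K4 p)]; lra. }
  destruct HB as (B & HB & KB).
  set (s := fun p => F true false p * / F true true p).
  assert (Us : BUC s) by (apply BUC_mult; auto; apply (BUC_inv _ c); auto).
  destruct (bounded_pos s (proj2 Us)) as (T & HT & KT).
  (* Grid step: interpolation raises the squared slope by at most [eta ^ 2]. Multiplied by [F11 ^ 2]
     this is at most [B ^ 2 eta <= c], so the determinant bound keeps the remaining coefficient of
     [e2 e2] nonnegative. *)
  set (eta := c / (B * (1 + B))).
  assert (HBB : 0 < B * (1 + B)) by (apply Rmult_lt_0_compat; lra).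
  assert (Heta : 0 < eta) by (apply Rdiv_lt_0_compat; auto).
  assert (HcB : c <= B).
  { eapply Rle_trans; [apply (H1 (0, 0))|]. eapply Rle_trans; [apply Rle_abs | apply KB]. }
  assert (Eeta : eta * (B * (1 + B)) = c) by (unfold eta; field; lra).
  assert (Heta1 : eta <= 1).
  { apply (Rmult_le_reg_r (B * (1 + B))); auto. rewrite Eeta. assert (B * 1 <= B * (1 + B)) by (apply Rmult_le_compat_l; lra). lra. }
  destruct (nfloor_ex (2 * T / eta)) as [n Hn].
  { apply Rdiv_le_0_compat; lra. }
  set (x := fun p => / eta * (s p + T)).
  assert (Ux : BUC x) by (apply BUC_scal, BUC_plus; auto using BUC_const).
  assert (Hx : forall p, 0 <= x p <= INR (S n)).
  { intros p. specialize (KT p). apply Rabs_le_between in KT. unfold x.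
    assert (Hi : 0 < / eta) by (apply Rinv_0_lt_compat; auto). split; [apply Rmult_le_pos; lra|].
    apply Rle_trans with (2 * T / eta); [|rewrite S_INR; lra].
    rewrite Rmult_comm. apply Rmult_le_compat_r; lra. }
  assert (Exs : forall p, s p = eta * x p - T) by (intros p; unfold x; field; lra).
  set (g := fun k p => hat (x p - INR k)).
  assert (Ug : forall k, BUC (g k)) by (intros k; apply BUC_hat, BUC_minus; auto using BUC_const).
  set (sl := fun k => eta * INR k - T).
  set (q := fun p => rsum (S (S n)) (fun k => g k p * (sl k * sl k))).
  assert (Mom : forall p, rsum (S (S n)) (fun k => g k p) = 1 /\ rsum (S (S n)) (fun k => g k p * sl k) = s p /\
    s p * s p <= q p <= s p * s p + eta * eta).
  { intros p. destruct (hat_moments (S n) (x p) (Hx p)) as (M0 & M1 & M2).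
    split; auto. split.
    - rewrite (rsum_ext _ _ (fun k => eta * (hat (x p - INR k) * INR k) + - T * hat (x p - INR k)))
        by (intros; unfold g, sl; ring).
      rewrite rsum_plus, !rsum_scal, M0, M1, Exs. ring.
    - unfold q. rewrite (rsum_ext _ _ (fun k => eta * eta * (hat (x p - INR k) * (INR k * INR k)) +
        (-2 * eta * T * (hat (x p - INR k) * INR k) + T * T * hat (x p - INR k))))
        by (intros; unfold g, sl; ring).
      rewrite !rsum_plus, !rsum_scal, M0, M1, Exs.
      assert (Hee : 0 < eta * eta) by (apply Rmult_lt_0_compat; auto). nra. }
  set (rem := fun p => F false false p - F true true p * q p).
  assert (Hrem : forall p, 0 <= rem p <= B).
  { intros p. destruct (Mom p) as (_ & _ & Q1 & Q2). specialize (H1 p). specialize (H2 p).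
    assert (K1 := KB true true p). rewrite Rabs_pos_eq in K1 by lra.
    assert (K2 := KB false false p). apply Rabs_le_between in K2.
    assert (Es : F true true p * (F true true p * (s p * s p)) = F true false p * F true false p) by (unfold s; field; lra).
    assert (X1 : F true true p * q p <= F true true p * (s p * s p + eta * eta)) by (apply Rmult_le_compat_l; lra).
    assert (X0 : 0 <= F true true p * q p) by (apply Rmult_le_pos; [lra|]; assert (Y := Rle_0_sqr (s p)); unfold Rsqr in Y; lra).
    split; [|unfold rem; lra]. unfold rem.
    apply (Rmult_le_reg_l (F true true p)); [lra|]. rewrite Rmult_0_r.
    assert (X2 : F true true p * (F true true p * q p) <= F true true p * (F true true p * (s p * s p + eta * eta))) by (apply Rmult_le_compat_l; lra).
    assert (X3 : F true true p * (F true true p * (eta * eta)) <= B * (B * (eta * 1))).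
    { assert (Y1 : 0 <= eta * eta) by (apply Rmult_le_pos; lra).
      assert (Y2 : eta * eta <= eta * 1) by (apply Rmult_le_compat_l; lra).
      assert (Y3 : 0 <= F true true p * (eta * eta)) by (apply Rmult_le_pos; lra).
      assert (Y4 : F true true p * (eta * eta) <= B * (eta * 1)) by (apply Rmult_le_compat; lra).
      apply Rmult_le_compat; lra. }
    assert (X4 : B * (B * (eta * 1)) <= c). { rewrite <- Eeta. assert (0 <= eta * B) by (apply Rmult_le_pos; lra). nra. }
    nra. }
  (* The directions are [e1 + sl k e2] at the grid slopes; the last index carries the remainder
     along [e2]. *)
  exists (S (S (S n))), (fun k p => if Nat.ltb k (S (S n)) then F true true p * g k p else rem p),
    (fun k => if Nat.ltb k (S (S n)) then (1, sl k) else (0, 1)), B.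
  split; [|split].
  - intros k. destruct (Nat.ltb k (S (S n))).
    + apply BUC_mult; auto.
    + apply BUC_minus; auto. apply BUC_mult; auto. apply (BUC_rsum (S (S n)) (fun k p => g k p * (sl k * sl k))).
      intros i. apply BUC_mult; auto using BUC_const.
  - intros k p. destruct (Nat.ltb k (S (S n))); auto.
    destruct (hat_bound (x p - INR k)). specialize (H1 p).
    assert (K1 := KB true true p). rewrite Rabs_pos_eq in K1 by lra.
    split; [apply Rmult_le_pos; unfold g; lra|]. rewrite <- (Rmult_1_r B). apply Rmult_le_compat; unfold g; lra.
  - intros a b p. change (rsum (S (S (S n))) ?g) with (rsum (S (S n)) g + g (S (S n))). cbv beta.
    rewrite Nat.ltb_irrefl.
    rewrite (rsum_ext _ _ (fun k => F true true p * (g k p * (ent (1, sl k) a * ent (1, sl k) b)))).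
    2:{ intros k Hk. apply Nat.ltb_lt in Hk. rewrite Hk. ring. }
    rewrite rsum_scal. destruct (Mom p) as (M0 & M1 & _). specialize (H1 p).
    assert (Es : F true true p * s p = F true false p) by (unfold s; field; lra).
    destruct a, b; unfold ent; simpl fst; simpl snd.
    + rewrite (rsum_ext _ _ (fun k => g k p)) by (intros; ring). rewrite M0. ring.
    + rewrite (rsum_ext _ _ (fun k => g k p * sl k)) by (intros; ring). rewrite M1, Es. ring.
    + rewrite (rsum_ext _ _ (fun k => g k p * sl k)) by (intros; ring). rewrite M1, Es, Sy. ring.
    + fold (q p). unfold rem. ring.
Qed.

(** * Corrugations *)

Definition Bn (n : nat) (f : pt -> R) : Prop := sm n f /\ exists C, 0 <= C /\ forall p, bdp n 1 C f p.

Lemma Bn_plus n f g : Bn n f -> Bn n g -> Bn n (fun p => f p + g p).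
Proof.
  intros [S [C [HC H]]] [S' [C' [HC' H']]]. split; [apply sm_plus; auto|].
  exists (C + C'); split; [lra|]. intros; apply bdp_plus; auto.
Qed.
Lemma Bn_mult n f g : Bn n f -> Bn n g -> Bn n (fun p => f p * g p).
Proof.
  intros [S [C [HC H]]] [S' [C' [HC' H']]]. split; [apply sm_mult; auto|].
  exists (2 ^ n * (C * C')); split; [apply Rmult_le_pos; [apply pow_le; lra | apply Rmult_le_pos; auto]|].
  intros; apply bdp_mult; auto; lra.
Qed.
Lemma Bn_const n c : Bn n (fun _ => c).
Proof. split; [apply sm_const|]. exists (Rabs c); split; [apply Rabs_pos|]. intros; apply bdp_const; lra. Qed.
Lemma Bn_scal n c f : Bn n f -> Bn n (fun p => c * f p).
Proof. intros; apply Bn_mult; auto using Bn_const. Qed.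
Lemma Bn_minus n f g : Bn n f -> Bn n g -> Bn n (fun p => f p - g p).
Proof.
  intros Hf Hg. replace (fun p => f p - g p) with (fun p => f p + -1 * g p)
    by (apply functional_extensionality; intros; ring). auto using Bn_plus, Bn_scal.
Qed.
Lemma Bn_pd n f b : Bn (S n) f -> Bn n (pd b f).
Proof.
  intros [S [C [HC H]]]. split; [apply sm_pd; auto|]. exists C; split; auto.
  intros p. generalize (bdp_pd _ _ _ _ _ b (H p)). rewrite Rmult_1_l. auto.
Qed.
Lemma Bn_S n f : Bn (S n) f -> Bn n f.
Proof. intros [S [C [HC H]]]. split; [apply sm_S; auto|]. exists C; split; auto. intros p. apply bdp_S, H. Qed.
Lemma Bn_Sn n h f : 0 < h -> UC f -> bounded_fun f -> Bn n (Sn n h f).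
Proof.
  intros Hh Hf Bf. destruct (bounded_pos f Bf) as (B & HB & KB). assert (Cf := UC_cont f Hf).
  split; [rewrite <- (Nat.add_0_r n) at 1; apply sm_Sn; auto; split; auto|].
  assert (H1 : 1 <= Rmax 1 (/ h)) by apply Rmax_l.
  exists (B * Rmax 1 (/ h) ^ n). split; [apply Rmult_le_pos; [lra | apply pow_le; lra]|].
  intros p. apply bdp_one; auto. apply (bdp_r n (/ h)).
  - split; [left; apply Rinv_0_lt_compat; auto | apply Rmax_r].
  - apply Sn_bdp; auto.
Qed.

Definition phase (xi : R * R) (p : pt) : R := fst xi * fst p + snd xi * snd p.

Lemma pd_wave l xi c :
  (exd c (fun p => sin (l * phase xi p)) /\ pd c (fun p => sin (l * phase xi p)) = (fun p => l * ent xi c * cos (l * phase xi p))) /\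
  (exd c (fun p => cos (l * phase xi p)) /\ pd c (fun p => cos (l * phase xi p)) = (fun p => - (l * ent xi c) * sin (l * phase xi p))).
Proof.
  split; apply pd_is_derive; intros p; unfold phase, upd, crd; destruct c; simpl; auto_derive; auto; ring.
Qed.

Lemma Bn_wave n l xi : Bn n (fun p => sin (l * phase xi p)) /\ Bn n (fun p => cos (l * phase xi p)).
Proof.
  induction n as [|n [IH1 IH2]].
  - assert (Cp : cont (fun p => l * phase xi p)) by (apply cont_scal; unfold phase; apply cont_plus; apply cont_scal; [apply (cont_crd true) | apply (cont_crd false)]).
    split; (split; [split; auto | exists 1; split; [lra|]; intros p; split; auto]).
    + intros p. apply (continuous_comp (fun p => l * phase xi p) sin); [apply Cp|]. apply continuity_pt_filterlim, continuity_sin.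
    + apply Rabs_le, SIN_bound.
    + intros p. apply (continuous_comp (fun p => l * phase xi p) cos); [apply Cp|]. apply continuity_pt_filterlim, continuity_cos.
    + apply Rabs_le, COS_bound.
  - assert (HS : forall f, Bn n f -> (forall c, exd c f /\ Bn n (pd c f)) -> Bn (S n) f).
    { intros f [Sf [C [HC H]]] Hc. split; [split; [apply (sm_cont n); auto | intros c; split; apply Hc]|].
      destruct (proj2 (Hc true)) as [_ (C1 & HC1 & H1)]. destruct (proj2 (Hc false)) as [_ (C2 & HC2 & H2)].
      exists (C + C1 + C2). split; [lra|]. intros p. split.
      - apply Rle_trans with C; [eapply bdp_abs, H | lra].
      - intros c. rewrite Rmult_1_l. destruct c; [apply (bdp_le _ _ C1) | apply (bdp_le _ _ C2)]; auto; lra. }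
    split; apply HS; auto; intros c; destruct (pd_wave l xi c) as [[E1 P1] [E2 P2]]; rewrite ?P1, ?P2; split; auto using Bn_scal.
Qed.

(** [w] has one derivative less than [v] because its correction [corr P v] contains [grad v]. *)
Definition Bstate (v : ix -> pt -> R) (w : bool -> pt -> R) : Prop := (forall j, Bn 3 (v j)) /\ (forall b, Bn 2 (w b)).
Definition size1 (xi : R * R) : R := Rabs (fst xi) + Rabs (snd xi).

Lemma ent_size xi c : Rabs (ent xi c) <= size1 xi.
Proof. unfold size1. assert (X := Rabs_pos (fst xi)). assert (Y := Rabs_pos (snd xi)). destruct c; simpl; lra. Qed.

Lemma abs_mult_le x y B D : Rabs x <= B -> Rabs y <= D -> Rabs (x * y) <= B * D.
Proof. intros. rewrite Rabs_mult. apply Rmult_le_compat; auto using Rabs_pos. Qed.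
Lemma abs_plus_le x y B D : Rabs x <= B -> Rabs y <= D -> Rabs (x + y) <= B + D.
Proof. intros. eapply Rle_trans; [apply Rabs_triang | lra]. Qed.

(** Only the first component of [v] is perturbed, by [2 ep a sin (phase / ep)]. Half its squared
    gradient is [2 a ^ 2 cos ^ 2] times [xi xi] up to [O (ep)], and [W] removes the oscillating part
    of [2 cos ^ 2 = 1 + cos (2 phase / ep)]. The gradient change is not small, but its leading part
    depends only on [Ba] and [xi]. *)
Lemma corrugation v w a xi Ba e : Bstate v w -> Bn 3 a -> (forall p, Rabs (a p) <= Ba) -> 0 < e ->
  exists v' w', Bstate v' w' /\
    (forall j p, Rabs (v' j p - v j p) <= e) /\ (forall b p, Rabs (w' b p - w b p) <= e) /\
    (forall j c p, Rabs (pd c (v' j) p - pd c (v j) p) <= 2 * Ba * size1 xi + e) /\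
    (forall c d p, Rabs (EE v' w' c d p - EE v w c d p - a p * a p * (ent xi c * ent xi d)) <= e).
Proof.
  intros [Sv Sw] Sa HBa He.
  set (X := size1 xi). assert (HX : 0 <= X) by (eapply Rle_trans; [apply Rabs_pos | apply (ent_size xi true)]).
  assert (HC : exists C, 1 <= C /\ (forall p, Rabs (a p) <= C) /\ (forall c p, Rabs (pd c a p) <= C) /\
    (forall c p, Rabs (pd c (v j1) p) <= C) /\ (forall c d p, Rabs (pd c (pd d (v j1)) p) <= C)).
  { destruct Sa as [_ (C1 & HC1 & K1)]. destruct (Sv j1) as [_ (C2 & HC2 & K2)].
    exists (1 + C1 + C2). split; [lra|].
    split; [|split; [|split]]; intros.
    - apply Rle_trans with C1; [eapply bdp_abs, K1 | lra].
    - generalize (proj1 (bdp_2 1 C1 a p (bdp_S _ _ _ _ _ (K1 p))) c). lra.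
    - generalize (proj1 (bdp_2 1 C2 (v j1) p (bdp_S _ _ _ _ _ (K2 p))) c). lra.
    - generalize (proj2 (bdp_2 1 C2 (v j1) p (bdp_S _ _ _ _ _ (K2 p))) c d). lra. }
  destruct HC as (C & HC & Ka & Kda & Kdv & Kddv).
  (* Sum of the coefficients of [ep] in all the error estimates below, so that [ep * Kk <= e]
     settles every one of them. *)
  set (Kk := 1 * (C * C * X) + 2 * C * C + (2 * C * X * C + 2 * (C * C)) + (2 * C * C)).
  assert (HCC : 1 <= C * C) by (rewrite <- (Rmult_1_l 1); apply Rmult_le_compat; lra).
  assert (HCX : 0 <= C * C * X) by (apply Rmult_le_pos; lra).
  assert (HKk : 1 <= Kk) by (unfold Kk; lra).
  set (ep := Rmin 1 (e / Kk)).
  assert (Hep : 0 < ep) by (apply Rmin_pos; [lra | apply Rdiv_lt_0_compat; lra]).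
  assert (Hep1 : ep <= 1) by apply Rmin_l.
  assert (HepK : ep * Kk <= e).
  { apply Rle_trans with (e / Kk * Kk); [apply Rmult_le_compat_r; [lra | apply Rmin_r] | right; field; lra]. }
  clearbody ep.
  set (sn := fun p => sin (/ ep * phase xi p)). set (cs := fun p => cos (/ ep * phase xi p)).
  destruct (Bn_wave 3 (/ ep) xi) as [Ssn Scs]. fold sn in Ssn. fold cs in Scs.
  assert (Ksn : forall p, Rabs (sn p) <= 1) by (intros; apply Rabs_le, SIN_bound).
  assert (Kcs : forall p, Rabs (cs p) <= 1) by (intros; apply Rabs_le, COS_bound).
  assert (T : forall p, cs p * cs p = 1 - sn p * sn p) by (intros; apply cc).
  assert (Dsn : forall c, exd c sn /\ pd c sn = (fun p => / ep * ent xi c * cs p)) by (intros c; exact (proj1 (pd_wave (/ ep) xi c))).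
  assert (Dcs : forall c, exd c cs /\ pd c cs = (fun p => - (/ ep * ent xi c) * sn p)) by (intros c; exact (proj2 (pd_wave (/ ep) xi c))).
  assert (Ea : forall c, exd c a) by (intros; apply (sm_exd 2), Sa).
  set (P := fun j : ix => match j with j1 => fun p => 2 * ep * (a p * sn p) | _ => fun _ => 0 end).
  set (W := fun b p => - (ep * ent xi b) * ((a p * a p) * (sn p * cs p))).
  assert (SP : forall j, Bn 3 (P j)) by (intros []; unfold P; auto using Bn_const, Bn_scal, Bn_mult).
  assert (SW : forall j, Bn 3 (W j)) by (intros j; unfold W; auto using Bn_scal, Bn_mult).
  assert (SC : forall b, Bn 2 (corr P v b)).
  { intros b. unfold corr. repeat apply Bn_plus; apply Bn_mult; auto using Bn_S, Bn_pd. }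
  assert (DP : forall c, pd c (P j1) = fun p => 2 * (ep * (pd c a p * sn p) + ent xi c * (a p * cs p))).
  { intros c. unfold P. destruct (exd_mult c a sn (Ea c) (proj1 (Dsn c))) as [E1 Q1].
    rewrite (proj2 (exd_scal c (2 * ep) _ E1)), Q1, (proj2 (Dsn c)).
    apply functional_extensionality; intros p. field. lra. }
  assert (DP0 : forall j c p, j <> j1 -> pd c (P j) p = 0).
  { intros j c p N. destruct j; [congruence | |]; unfold P; rewrite (proj2 (exd_const c 0)); auto. }
  assert (DW : forall b c, pd c (W b) = fun p => - ent xi b * (2 * ep * (pd c a p * (a p * (sn p * cs p)))
      + ent xi c * (a p * (a p * (1 - 2 * (sn p * sn p)))))).
  { intros b c. unfold W.
    destruct (exd_mult c a a (Ea c) (Ea c)) as [E1 Q1].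
    destruct (exd_mult c sn cs (proj1 (Dsn c)) (proj1 (Dcs c))) as [E2 Q2].
    destruct (exd_mult c _ _ E1 E2) as [E3 Q3].
    rewrite (proj2 (exd_scal c (- (ep * ent xi b)) _ E3)), Q3, Q1, Q2, (proj2 (Dsn c)), (proj2 (Dcs c)).
    apply functional_extensionality; intros p. field [(T p)]. lra. }
  assert (KP : forall p, Rabs (P j1 p) <= ep * (2 * (C * 1))).
  { intros p. unfold P. replace (2 * ep * (a p * sn p)) with (ep * (2 * (a p * sn p))) by ring.
    apply abs_mult_le; [rewrite Rabs_pos_eq; lra|]. apply abs_mult_le; [rewrite Rabs_pos_eq; lra|]. apply abs_mult_le; auto. }
  assert (Hepm : forall z, 0 <= z -> z <= Kk -> ep * z <= e).
  { intros z Hz Hz'. eapply Rle_trans; [|exact HepK]. apply Rmult_le_compat_l; lra. }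
  assert (HC2 : C * 1 <= C * C) by (apply Rmult_le_compat_l; lra).
  assert (HCXC : 0 <= 2 * C * X * C) by (repeat apply Rmult_le_pos; lra).
  exists (fun j p => v j p + P j p), (fun b p => w b p + (W b p - corr P v b p)).
  split; [|split; [|split; [|split]]].
  - split; [intros; apply Bn_plus; auto|]. intros b. apply Bn_plus; auto. apply Bn_minus; auto using Bn_S.
  - intros j p. replace (v j p + P j p - v j p) with (P j p) by ring. destruct j.
    + eapply Rle_trans; [apply KP|]. apply Hepm; unfold Kk; lra.
    + unfold P. rewrite Rabs_R0; lra.
    + unfold P. rewrite Rabs_R0; lra.
  - intros b p. replace (w b p + (W b p - corr P v b p) - w b p) with (W b p + - (P j1 p * pd b (v j1) p)).
    2:{ unfold corr. change (P j2 p) with 0. change (P j3 p) with 0. ring. }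
    apply Rle_trans with (ep * (X * ((C * C) * (1 * 1))) + ep * (2 * (C * 1)) * C).
    + apply abs_plus_le.
      * unfold W. replace (- (ep * ent xi b) * (a p * a p * (sn p * cs p)))
          with (ep * (- ent xi b * (a p * a p * (sn p * cs p)))) by ring.
        apply abs_mult_le; [rewrite Rabs_pos_eq; lra|]. apply abs_mult_le; [rewrite Rabs_Ropp; apply ent_size|].
        apply abs_mult_le; apply abs_mult_le; auto.
      * rewrite Rabs_Ropp. apply abs_mult_le; auto.
    + replace (ep * (X * (C * C * (1 * 1))) + ep * (2 * (C * 1)) * C) with (ep * (C * C * X + 2 * C * C)) by ring.
      apply Hepm; unfold Kk; lra.
  - intros j c p. assert (HBX : 0 <= 2 * Ba * X).
    { apply Rmult_le_pos; auto. assert (0 <= Ba) by (eapply Rle_trans; [apply Rabs_pos | apply (HBa p)]). lra. }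
    rewrite (proj2 (exd_plus c (v j) (P j) (sm_exd 2 _ c (proj1 (Sv j))) (sm_exd 2 _ c (proj1 (SP j))))).
    replace (pd c (v j) p + pd c (P j) p - pd c (v j) p) with (pd c (P j) p) by ring.
    destruct j; [|rewrite DP0 by congruence; rewrite Rabs_R0; fold X; lra|rewrite DP0 by congruence; rewrite Rabs_R0; fold X; lra].
    rewrite DP.
    replace (2 * (ep * (pd c a p * sn p) + ent xi c * (a p * cs p)))
      with (2 * (ent xi c * (a p * cs p)) + ep * (2 * (pd c a p * sn p))) by ring.
    apply abs_plus_le.
    + fold X. replace (2 * Ba * X) with (2 * (X * (Ba * 1))) by ring.
      apply abs_mult_le; [rewrite Rabs_pos_eq; lra|]. apply abs_mult_le; [apply ent_size|]. apply abs_mult_le; auto.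
    + eapply Rle_trans; [apply abs_mult_le; [right; apply Rabs_pos_eq; lra | apply abs_mult_le; [right; apply Rabs_pos_eq; lra | apply abs_mult_le; eauto]]|].
      apply Hepm; unfold Kk; lra.
  - intros c d p. rewrite EE_update.
    2: intros; apply (sm_exd 2), Sv.
    2: intros; apply (sm_exd 1), Sw.
    2: intros; apply (sm_exd 2), SP.
    2: intros; apply (sm_exd 2), SW.
    2: intros; apply (sm_exd 1), sm_pd, Sv.
    unfold sum3. rewrite ?(DP0 j2), ?(DP0 j3) by congruence. change (P j2 p) with 0. change (P j3 p) with 0.
    rewrite !DP, !DW. change (P j1 p) with (2 * ep * (a p * sn p)).
    match goal with |- Rabs ?z <= _ => replace z with
      (ep * (a p * (sn p * cs p) * (ent xi c * pd d a p + ent xi d * pd c a p)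
        + (2 * ep * ((sn p * sn p) * (pd c a p * pd d a p))
        + - (2 * (a p * sn p) * (/ 2 * (pd c (pd d (v j1)) p + pd d (pd c (v j1)) p))))))
      by field [(T p)] end.
    apply Rle_trans with (ep * (C * (1 * 1) * (X * C + X * C) + (2 * 1 * ((1 * 1) * (C * C)) + 2 * (C * 1) * (/ 2 * (C + C))))).
    + apply abs_mult_le; [rewrite Rabs_pos_eq; lra|].
      apply abs_plus_le; [|apply abs_plus_le].
      * apply abs_mult_le; [apply abs_mult_le; [auto | apply abs_mult_le; auto]|].
        apply abs_plus_le; apply abs_mult_le; auto using ent_size.
      * apply abs_mult_le; [rewrite Rabs_pos_eq; lra|]. apply abs_mult_le; apply abs_mult_le; auto.
      * rewrite Rabs_Ropp. apply abs_mult_le; [apply abs_mult_le; [rewrite Rabs_pos_eq; lra | apply abs_mult_le; auto]|].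
        apply abs_mult_le; [rewrite Rabs_pos_eq; lra|]. apply abs_plus_le; auto.
    + apply Hepm; [|unfold Kk; lra]. lra.
Qed.

(** The frequency of each corrugation is chosen after the previous ones have been added, so that the
    interaction with them fits into its own error. *)
Lemma corrugations n a xi Ba : (forall k, Bn 3 (a k)) -> (forall k p, Rabs (a k p) <= Ba) ->
  forall v w e, Bstate v w -> 0 < e -> exists v' w', Bstate v' w' /\
    (forall j p, Rabs (v' j p - v j p) <= e) /\ (forall b p, Rabs (w' b p - w b p) <= e) /\
    (forall j c p, Rabs (pd c (v' j) p - pd c (v j) p) <= rsum n (fun k => 2 * Ba * size1 (xi k)) + e) /\
    (forall c d p, Rabs (EE v' w' c d p - EE v w c d p - rsum n (fun k => a k p * a k p * (ent (xi k) c * ent (xi k) d))) <= e).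
Proof.
  intros Sa HBa. induction n as [|n IH]; intros v w e S He.
  - exists v, w. split; auto. split; [|split; [|split]]; intros; simpl; rewrite ?Rminus_0_r, Rminus_diag, Rabs_R0; lra.
  - destruct (IH v w (e / 2) S) as (v1 & w1 & S1 & A1 & A2 & A3 & A4); [lra|].
    destruct (corrugation v1 w1 (a n) (xi n) Ba (e / 2) S1 (Sa n) (HBa n)) as (v2 & w2 & S2 & B1 & B2 & B3 & B4); [lra|].
    assert (Tri : forall x y z D1 D2, Rabs (z - y) <= D1 -> Rabs (y - x) <= D2 -> Rabs (z - x) <= D2 + D1).
    { intros x y z D1 D2 H1 H2. replace (z - x) with ((y - x) + (z - y)) by ring. apply abs_plus_le; auto. }
    exists v2, w2. split; auto. split; [|split; [|split]]; intros.
    + replace e with (e / 2 + e / 2) by field. eapply Tri; eauto.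
    + replace e with (e / 2 + e / 2) by field. eapply Tri; eauto.
    + simpl. replace (rsum n (fun k => 2 * Ba * size1 (xi k)) + 2 * Ba * size1 (xi n) + e)
        with ((rsum n (fun k => 2 * Ba * size1 (xi k)) + e / 2) + (2 * Ba * size1 (xi n) + e / 2)) by field.
      eapply Tri; eauto.
    + simpl. replace e with (e / 2 + e / 2) by field.
      match goal with |- Rabs ?z <= _ => replace z with
       ((EE v1 w1 c d p - EE v w c d p - rsum n (fun k => a k p * a k p * (ent (xi k) c * ent (xi k) d)))
        + (EE v2 w2 c d p - EE v1 w1 c d p - a n p * a n p * (ent (xi n) c * ent (xi n) d))) by ring end.
      apply abs_plus_le; auto.
Qed.

Lemma ul_rsum n (F : nat -> R -> pt -> R) f : (forall k, ul (F k) (f k)) ->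
  ul (fun h p => rsum n (fun k => F k h p)) (fun p => rsum n (fun k => f k p)).
Proof. intros H. induction n; simpl; [apply ul_const | apply (ul_plus _ (F n)); auto]. Qed.

(** [V0] and [d0] are fixed before [eta], since in [iteration] the admissible [eta] depends on both.
    This is possible because the gradients created by the corrugations are controlled by the
    amplitudes and directions of the decomposition, not by the frequencies. *)
Lemma initial v w A c : 0 < c ->
  (forall j, BUC (v j)) -> (forall j b, exd b (v j) /\ BUC (pd b (v j))) ->
  (forall j, BUC (w j)) -> (forall j b, exd b (w j) /\ BUC (pd b (w j))) ->
  (forall a b, BUC (A a b)) -> (forall p, A true false p = A false true p) ->
  let D := fun a b p => A a b p - EE v w a b p in
  (forall p, c <= D true true p) -> (forall p, c <= D true true p * D false false p - D true false p * D true false p) ->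
  exists V0 d0, 1 <= V0 /\ 0 < d0 <= 1 /\ forall eta, 0 < eta -> exists v0 w0 B, 0 <= B /\
    (forall j, sm 2 (v0 j)) /\ (forall j, sm 2 (w0 j)) /\
    (forall j p, bdp 2 1 B (v0 j) p) /\ (forall j p, bdp 2 1 B (w0 j) p) /\
    (forall j a p, Rabs (pd a (v0 j) p) <= V0) /\
    (forall a b p, Rabs (A a b p - EE v0 w0 a b p - d0 * h0 a b) <= eta) /\
    (forall j p, Rabs (v0 j p - v j p) <= eta) /\ (forall j p, Rabs (w0 j p - w j p) <= eta).
Proof.
  intros Hc Uv Uv' Uw Uw' UA SA D HD1 HD2.
  assert (UE : forall a b, BUC (EE v w a b)).
  { intros a b. apply BUC_EE; intros; [apply Uv' | apply Uw']. }
  assert (UD : forall a b, BUC (D a b)) by (intros; apply BUC_minus; auto).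
  assert (SD : forall p, D true false p = D false true p) by (intros p; unfold D; rewrite SA, EE_sym; auto).
  assert (HB : exists B, 1 <= B /\ forall a b p, Rabs (D a b p) <= B).
  { destruct (bounded_pos _ (proj2 (UD true true))) as (B1 & P1 & K1), (bounded_pos _ (proj2 (UD true false))) as (B2 & P2 & K2),
      (bounded_pos _ (proj2 (UD false true))) as (B3 & P3 & K3), (bounded_pos _ (proj2 (UD false false))) as (B4 & P4 & K4).
    exists (1 + B1 + B2 + B3 + B4); split; [lra|].
    intros [] [] p; [specialize (K1 p) | specialize (K2 p) | specialize (K3 p) | specialize (K4 p)]; lra. }
  destruct HB as (B & HB & KB).
  (* Small enough that subtracting [d0 * h0] lowers the first entry and the determinant of the
     defect by at most [c / 2]. *)
  set (d0 := Rmin 1 (c / (4 * B))).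
  assert (Hd0 : 0 < d0) by (apply Rmin_pos; [lra | apply Rdiv_lt_0_compat; lra]).
  assert (Hd1 : d0 <= 1) by apply Rmin_l.
  assert (Hd2 : d0 * B <= c / 4).
  { apply Rle_trans with (c / (4 * B) * B); [apply Rmult_le_compat_r; [lra | apply Rmin_r] | right; field; lra]. }
  set (F := fun a b p => D a b p - d0 * h0 a b).
  destruct (decomposition F (c / 2)) as (n & f & xi & Bf & Uf & Kf & Sf); [lra | | | | |].
  { intros a b. apply BUC_minus; auto using BUC_const. }
  { intros p. unfold F. rewrite SD. reflexivity. }
  { intros p. unfold F, h0; simpl. specialize (HD1 p). assert (d0 * 1 <= d0 * B) by (apply Rmult_le_compat_l; lra). lra. }
  { intros p. unfold F, h0; simpl. specialize (HD2 p).
    assert (K1 := KB true true p). assert (K2 := KB false false p). assert (K3 := KB true false p).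
    apply Rabs_le_between in K1. apply Rabs_le_between in K2. apply Rabs_le_between in K3.
    assert (d0 * D true true p <= d0 * B) by (apply Rmult_le_compat_l; lra).
    assert (d0 * D false false p <= d0 * B) by (apply Rmult_le_compat_l; lra).
    assert (d0 * - D true false p <= d0 * B) by (apply Rmult_le_compat_l; lra).
    assert (0 <= d0 * d0) by (apply Rmult_le_pos; lra). lra. }
  assert (HBv : exists Bv, 0 <= Bv /\ forall j b p, Rabs (pd b (v j) p) <= Bv).
  { assert (X : forall j, exists Bv, 0 <= Bv /\ forall b p, Rabs (pd b (v j) p) <= Bv).
    { intros j. destruct (bounded_pos _ (proj2 (proj2 (Uv' j true)))) as (B1 & P1 & K1), (bounded_pos _ (proj2 (proj2 (Uv' j false)))) as (B2 & P2 & K2).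
      exists (B1 + B2). split; [lra|]. intros [] p; [specialize (K1 p) | specialize (K2 p)]; lra. }
    destruct (X j1) as (B1 & P1 & K1), (X j2) as (B2 & P2 & K2), (X j3) as (B3 & P3 & K3).
    exists (B1 + B2 + B3). split; [lra|]. intros [] b p; [specialize (K1 b p) | specialize (K2 b p) | specialize (K3 b p)]; lra. }
  destruct HBv as (Bv & HBv & KBv).
  set (sf := fun k p => sqrt (f k p)).
  assert (Usf : forall k, BUC (sf k)) by (intros k; apply BUC_sqrt; auto; intros p; apply Kf).
  set (Ba := Bf + 1).
  assert (Ksf : forall k p, Rabs (sf k p) <= Ba).
  { intros k p. destruct (Kf k p) as [X1 X2]. unfold sf, Ba. rewrite Rabs_pos_eq by apply sqrt_pos.
    assert (Y := sqrt_pos (f k p)). assert (Z := sqrt_sqrt _ X1).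
    destruct (Rle_dec (sqrt (f k p)) 1); [lra|].
    assert (1 * sqrt (f k p) <= sqrt (f k p) * sqrt (f k p)) by (apply Rmult_le_compat_r; lra). lra. }
  set (Vs := rsum n (fun k => 2 * Ba * size1 (xi k))).
  assert (HBa : 0 <= Ba) by (eapply Rle_trans; [apply Rabs_pos | apply (Ksf O (0, 0))]).
  assert (HVs : 0 <= Vs).
  { apply rsum_nonneg. intros k. apply Rmult_le_pos; [lra|]. eapply Rle_trans; [apply Rabs_pos | apply (ent_size (xi k) true)]. }
  exists (Bv + Vs + 1), d0. split; [lra|]. split; [lra|]. intros eta0 Heta0.
  set (eta := Rmin 1 eta0). assert (Heta : 0 < eta) by (apply Rmin_pos; lra).
  assert (Heta1 : eta <= 1) by apply Rmin_l. assert (Heta2 : eta <= eta0) by apply Rmin_r.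
  set (vh := fun h j => Sn 3 h (v j)). set (wh := fun h b => Sn 3 h (w b)). set (ah := fun h k => Sn 3 h (sf k)).
  assert (Dv : forall h j b, 0 < h -> pd b (vh h j) = Sn 3 h (pd b (v j))).
  { intros h j b Hh. apply (Sn_pd 3 b h (v j)); auto; [apply UC_cont, Uv | apply Uv' | apply UC_cont, Uv']. }
  assert (Dw : forall h j b, 0 < h -> pd b (wh h j) = Sn 3 h (pd b (w j))).
  { intros h j b Hh. apply (Sn_pd 3 b h (w j)); auto; [apply UC_cont, Uw | apply Uw' | apply UC_cont, Uw']. }
  (* Fields and amplitudes are smoothed at the same scale, and the whole expression that should
     equal [A - d0 h0] converges uniformly as [h] tends to [0]. *)
  assert (ULE : forall a b, ul (fun h p => sum3 (fun j => / 2 * (Sn 3 h (pd a (v j)) p * Sn 3 h (pd b (v j)) p))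
        + / 2 * (Sn 3 h (pd a (w b)) p + Sn 3 h (pd b (w a)) p)
        + rsum n (fun k => Sn 3 h (sf k) p * Sn 3 h (sf k) p * (ent (xi k) a * ent (xi k) b)))
      (fun p => EE v w a b p + rsum n (fun k => sf k p * sf k p * (ent (xi k) a * ent (xi k) b)))).
  { intros a b.
    assert (Ub : forall x : R, bounded_fun (fun _ => x)) by (intros x; exists (Rabs x); intros; lra).
    assert (Lv : forall j c, ul (fun h => Sn 3 h (pd c (v j))) (pd c (v j))) by (intros; apply ul_Sn, Uv').
    assert (Lw : forall j c, ul (fun h => Sn 3 h (pd c (w j))) (pd c (w j))) by (intros; apply ul_Sn, Uw').
    assert (Ls : forall k, ul (fun h => Sn 3 h (sf k)) (sf k)) by (intros; apply ul_Sn, Usf).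
    assert (Lvv : forall j, ul (fun h p => / 2 * (Sn 3 h (pd a (v j)) p * Sn 3 h (pd b (v j)) p)) (fun p => / 2 * (pd a (v j) p * pd b (v j) p))).
    { intros j. apply (ul_mult (fun _ _ => / 2) _ (fun _ => / 2)); auto using ul_const.
      - apply BUC_mult; apply Uv'.
      - apply (ul_mult (fun h => Sn 3 h (pd a (v j)))); auto; apply Uv'. }
    unfold EE, sum3.
    apply (ul_plus (fun h p => / 2 * (Sn 3 h (pd a (v j1)) p * Sn 3 h (pd b (v j1)) p) +
      / 2 * (Sn 3 h (pd a (v j2)) p * Sn 3 h (pd b (v j2)) p) + / 2 * (Sn 3 h (pd a (v j3)) p * Sn 3 h (pd b (v j3)) p)
      + / 2 * (Sn 3 h (pd a (w b)) p + Sn 3 h (pd b (w a)) p))).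
    - apply (ul_plus (fun h p => / 2 * (Sn 3 h (pd a (v j1)) p * Sn 3 h (pd b (v j1)) p) +
        / 2 * (Sn 3 h (pd a (v j2)) p * Sn 3 h (pd b (v j2)) p) + / 2 * (Sn 3 h (pd a (v j3)) p * Sn 3 h (pd b (v j3)) p))).
      + apply (ul_plus (fun h p => / 2 * (Sn 3 h (pd a (v j1)) p * Sn 3 h (pd b (v j1)) p) +
          / 2 * (Sn 3 h (pd a (v j2)) p * Sn 3 h (pd b (v j2)) p))); auto.
        apply (ul_plus (fun h p => / 2 * (Sn 3 h (pd a (v j1)) p * Sn 3 h (pd b (v j1)) p))); auto.
      + apply (ul_mult (fun _ _ => / 2) _ (fun _ => / 2)); auto using ul_const.
        * apply BUC_plus; apply Uw'.
        * apply (ul_plus (fun h => Sn 3 h (pd a (w b)))); auto.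
    - apply (ul_rsum n (fun k h p => Sn 3 h (sf k) p * Sn 3 h (sf k) p * (ent (xi k) a * ent (xi k) b))
        (fun k p => sf k p * sf k p * (ent (xi k) a * ent (xi k) b))). intros k.
      apply (ul_mult (fun h p => Sn 3 h (sf k) p * Sn 3 h (sf k) p) (fun _ _ => ent (xi k) a * ent (xi k) b)
        (fun p => sf k p * sf k p) (fun _ => ent (xi k) a * ent (xi k) b)); auto using ul_const.
      + apply BUC_mult; auto.
      + apply (ul_mult (fun h => Sn 3 h (sf k))); auto; apply Usf. }
  assert (Heta4 : 0 < eta / 2) by lra.
  destruct (ULE true true _ Heta4) as (h1 & H1 & X1), (ULE true false _ Heta4) as (h2 & H2 & X2), (ULE false false _ Heta4) as (h3 & H3 & X3).
  destruct (ul_Sn 3 _ (proj1 (Uv j1)) _ Heta4) as (h4 & H4 & X4), (ul_Sn 3 _ (proj1 (Uv j2)) _ Heta4) as (h5 & H5 & X5),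
    (ul_Sn 3 _ (proj1 (Uv j3)) _ Heta4) as (h6 & H6 & X6), (ul_Sn 3 _ (proj1 (Uw true)) _ Heta4) as (h7 & H7 & X7),
    (ul_Sn 3 _ (proj1 (Uw false)) _ Heta4) as (h8 & H8 & X8).
  set (h := Rmin (Rmin (Rmin h1 h2) (Rmin h3 h4)) (Rmin (Rmin h5 h6) (Rmin h7 h8))).
  assert (Hh : 0 < h) by (unfold h; repeat apply Rmin_pos; auto).
  assert (L1 := Rmin_l (Rmin (Rmin h1 h2) (Rmin h3 h4)) (Rmin (Rmin h5 h6) (Rmin h7 h8))).
  assert (L2 := Rmin_r (Rmin (Rmin h1 h2) (Rmin h3 h4)) (Rmin (Rmin h5 h6) (Rmin h7 h8))). fold h in L1, L2.
  assert (L3 := Rmin_l (Rmin h1 h2) (Rmin h3 h4)). assert (L4 := Rmin_r (Rmin h1 h2) (Rmin h3 h4)).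
  assert (L5 := Rmin_l (Rmin h5 h6) (Rmin h7 h8)). assert (L6 := Rmin_r (Rmin h5 h6) (Rmin h7 h8)).
  assert (Q1 := Rmin_l h1 h2). assert (Q2 := Rmin_r h1 h2). assert (Q3 := Rmin_l h3 h4). assert (Q4 := Rmin_r h3 h4).
  assert (Q5 := Rmin_l h5 h6). assert (Q6 := Rmin_r h5 h6). assert (Q7 := Rmin_l h7 h8). assert (Q8 := Rmin_r h7 h8).
  clearbody h.
  assert (St : Bstate (vh h) (wh h)).
  { split; intros j; [|apply Bn_S]; apply Bn_Sn; auto; apply Uv || apply Uw. }
  destruct (corrugations n (ah h) xi Ba) with (v := vh h) (w := wh h) (e := eta / 2) as (v0 & w0 & [Sv0 Sw0] & C1 & C2 & C3 & C4); auto.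
  { intros k. apply Bn_Sn; auto; apply Usf. }
  { intros k p. apply Sn_box; auto. apply UC_cont, Usf. }
  assert (EC : forall a b p, Rabs (sum3 (fun j => / 2 * (Sn 3 h (pd a (v j)) p * Sn 3 h (pd b (v j)) p))
        + / 2 * (Sn 3 h (pd a (w b)) p + Sn 3 h (pd b (w a)) p)
        + rsum n (fun k => Sn 3 h (sf k) p * Sn 3 h (sf k) p * (ent (xi k) a * ent (xi k) b))
        - (EE v w a b p + rsum n (fun k => sf k p * sf k p * (ent (xi k) a * ent (xi k) b)))) <= eta / 2).
  { intros a b p. destruct a, b.
    - apply X1; lra.
    - apply X2; lra.
    - generalize (X2 h ltac:(lra) p). intros Y. eapply Rle_trans; [|exact Y]. right. f_equal.
      rewrite (EE_sym v w false true). unfold sum3.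
      rewrite (rsum_ext n _ (fun k => Sn 3 h (sf k) p * Sn 3 h (sf k) p * (ent (xi k) true * ent (xi k) false))) by (intros; ring).
      rewrite (rsum_ext n (fun k => sf k p * sf k p * (ent (xi k) false * ent (xi k) true))
        (fun k => sf k p * sf k p * (ent (xi k) true * ent (xi k) false))) by (intros; ring). ring.
    - apply X3; lra. }
  assert (HBB : exists BB, 0 <= BB /\ (forall j p, bdp 2 1 BB (v0 j) p) /\ (forall j p, bdp 2 1 BB (w0 j) p)).
  { destruct (Bn_S _ _ (Sv0 j1)) as [_ (B1 & P1 & K1)], (Bn_S _ _ (Sv0 j2)) as [_ (B2 & P2 & K2)], (Bn_S _ _ (Sv0 j3)) as [_ (B3 & P3 & K3)],
      (Sw0 true) as [_ (B4 & P4 & K4)], (Sw0 false) as [_ (B5 & P5 & K5)].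
    exists (B1 + B2 + B3 + B4 + B5). split; [lra|]. split; intros [] p.
    - apply (bdp_le _ _ B1); auto; lra.
    - apply (bdp_le _ _ B2); auto; lra.
    - apply (bdp_le _ _ B3); auto; lra.
    - apply (bdp_le _ _ B4); auto; lra.
    - apply (bdp_le _ _ B5); auto; lra. }
  destruct HBB as (BB & HBB & KB1 & KB2).
  exists v0, w0, BB. split; auto.
  split; [intros j; apply (Bn_S _ _ (Sv0 j))|]. split; [intros j; apply (Sw0 j)|]. split; auto. split; auto.
  split; [|split; [|split]].
  - intros j a p. replace (pd a (v0 j) p) with (pd a (vh h j) p + (pd a (v0 j) p - pd a (vh h j) p)) by ring.
    apply Rle_trans with (Bv + (Vs + eta / 2)); [|lra]. apply abs_plus_le; auto.
    rewrite Dv by auto. apply Sn_box; auto. apply UC_cont, Uv'.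
  - intros a b p. apply Rle_trans with (eta / 2 + eta / 2); [|lra].
    assert (Es : EE (vh h) (wh h) a b p = sum3 (fun j => / 2 * (Sn 3 h (pd a (v j)) p * Sn 3 h (pd b (v j)) p))
        + / 2 * (Sn 3 h (pd a (w b)) p + Sn 3 h (pd b (w a)) p)).
    { unfold EE, sum3. rewrite !Dv, !Dw by auto. reflexivity. }
    assert (Sq : rsum n (fun k => sf k p * sf k p * (ent (xi k) a * ent (xi k) b)) = A a b p - EE v w a b p - d0 * h0 a b).
    { fold (D a b p). fold (F a b p). rewrite <- (Sf a b p). apply rsum_ext. intros k _. unfold sf. rewrite sqrt_sqrt by apply Kf. auto. }
    assert (Y1 := EC a b p). assert (Y2 := C4 a b p). rewrite <- Es, Sq in Y1. unfold ah in Y2.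
    match type of Y1 with Rabs ?y1 <= _ => match type of Y2 with Rabs ?y2 <= _ =>
      replace (A a b p - EE v0 w0 a b p - d0 * h0 a b) with (- y1 + - y2) by ring end end.
    apply abs_plus_le; rewrite Rabs_Ropp; auto.
  - intros j p. replace (v0 j p - v j p) with ((v0 j p - vh h j p) + (vh h j p - v j p)) by ring.
    apply Rle_trans with (eta / 2 + eta / 2); [|lra]. apply abs_plus_le; auto.
    destruct j; [apply X4 | apply X5 | apply X6]; lra.
  - intros j p. replace (w0 j p - w j p) with ((w0 j p - wh h j p) + (wh h j p - w j p)) by ring.
    apply Rle_trans with (eta / 2 + eta / 2); [|lra]. apply abs_plus_le; auto.
    destruct j; [apply X7 | apply X8]; lra.
Qed.

(** * Reduction to uniformly continuous data on the plane *)

Definition ka (r x : R) : R := Rmax 0 (Rmin 1 (r + 1 - Rabs x)).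
(** A bounded [C^1] map of the line that is the identity on [[-r, r]]. Composing each coordinate
    with it makes the data bounded and uniformly continuous on the plane, together with their first
    derivatives, and leaves them unchanged on the square. *)
Definition tau (r x : R) : R := RInt (ka r) 0 x.

Lemma ka_lip r x y : Rabs (ka r y - ka r x) <= Rabs (y - x).
Proof.
  unfold ka. eapply Rle_trans; [apply lip_max|]. rewrite Rmult_1_l. eapply Rle_trans; [apply lip_min|]. rewrite Rmult_1_l.
  replace (r + 1 - Rabs y - (r + 1 - Rabs x)) with (- (Rabs y - Rabs x)) by ring. rewrite Rabs_Ropp.
  generalize (lip_abs x y). lra.
Qed.
Lemma ka_bound r x : 0 <= ka r x <= 1.
Proof. unfold ka. split; [apply Rmax_l | apply Rmax_lub; [lra | apply Rmin_l]]. Qed.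
Lemma ka_in r x : Rabs x <= r -> ka r x = 1.
Proof. intros. unfold ka. rewrite Rmin_left, Rmax_right; lra. Qed.
Lemma ka_out r x : r + 1 <= Rabs x -> ka r x = 0.
Proof. intros. unfold ka. apply Rmax_left. eapply Rle_trans; [apply Rmin_r | lra]. Qed.

Lemma ka_continuous r x : continuous (ka r) x.
Proof.
  apply continuity_pt_filterlim. intros e He. exists e; split; auto.
  intros y [_ Hy]. simpl in *. unfold R_dist in *. eapply Rle_lt_trans; [apply ka_lip | auto].
Qed.

Lemma tau_derive r x : is_derive (tau r) x (ka r x).
Proof.
  apply (is_derive_RInt (ka r) (tau r) 0); [|apply ka_continuous].
  apply filter_forall. intros y. apply (RInt_correct (V := R_CompleteNormedModule)).
  apply (ex_RInt_continuous (V := R_CompleteNormedModule)). intros; apply ka_continuous.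
Qed.

Lemma tau_MVT r x y : exists c, Rmin x y <= c <= Rmax x y /\ tau r y - tau r x = ka r c * (y - x).
Proof.
  apply (MVT_gen (tau r) x y (ka r)).
  - intros; apply tau_derive.
  - intros z _. apply continuity_pt_filterlim. apply (ex_derive_continuous (tau r)). eexists; apply tau_derive.
Qed.

Lemma tau_lip r x y : Rabs (tau r y - tau r x) <= Rabs (y - x).
Proof.
  destruct (tau_MVT r x y) as (c & _ & ->). rewrite Rabs_mult. destruct (ka_bound r c).
  rewrite <- (Rmult_1_l (Rabs (y - x))) at 2. apply Rmult_le_compat_r; [apply Rabs_pos|]. rewrite Rabs_pos_eq; lra.
Qed.

Lemma tau_0 r : tau r 0 = 0.
Proof. unfold tau. apply (RInt_point (V := R_CompleteNormedModule)). Qed.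

Lemma tau_in r x : Rabs x <= r -> tau r x = x.
Proof.
  intros Hx. destruct (tau_MVT r 0 x) as (c & Hc & E). rewrite tau_0, ka_in in E; [lra|].
  apply Rabs_le_between in Hx. apply Rabs_le_between. unfold Rmin, Rmax in Hc. destruct Rle_dec; lra.
Qed.

Lemma tau_bound r x : 0 <= r -> Rabs (tau r x) <= r + 1.
Proof.
  intros Hr.
  assert (B : forall y, Rabs y <= r + 1 -> Rabs (tau r y) <= r + 1).
  { intros y Hy. generalize (tau_lip r 0 y). rewrite tau_0, !Rminus_0_r. lra. }
  destruct (Rle_dec (Rabs x) (r + 1)) as [|N]; auto. apply Rnot_le_lt in N.
  set (y := if Rle_dec 0 x then r + 1 else - (r + 1)).
  assert (E : tau r x = tau r y).
  { destruct (tau_MVT r y x) as (c & Hc & E). rewrite ka_out in E; [lra|].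
    unfold y in Hc. destruct (Rle_dec 0 x).
    - rewrite Rabs_pos_eq in N by lra. rewrite Rmin_left in Hc by lra. rewrite Rabs_pos_eq; lra.
    - rewrite Rabs_left in N by lra. rewrite Rmax_left in Hc by lra. rewrite Rabs_left; lra. }
  rewrite E. apply B. unfold y. destruct (Rle_dec 0 x); [rewrite Rabs_pos_eq; lra | rewrite Rabs_Ropp, Rabs_pos_eq; lra].
Qed.

Definition cmp (r : R) (f : pt -> R) : pt -> R := fun p => f (tau r (fst p), tau r (snd p)).

Lemma cmp_in r f p : Rabs (fst p) <= r -> Rabs (snd p) <= r -> cmp r f p = f p.
Proof. intros. unfold cmp. rewrite !tau_in by auto. destruct p; auto. Qed.

Lemma cmp_pd r f b : exd b f -> exd b (cmp r f) /\ pd b (cmp r f) = fun p => ka r (crd b p) * cmp r (pd b f) p.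
Proof.
  intros Hf. apply pd_is_derive. intros p. set (q := (tau r (fst p), tau r (snd p))).
  apply (is_derive_ext (fun t => (fun s => f (upd b q s)) (tau r t))).
  { intros t. unfold cmp, q. destruct b; reflexivity. }
  apply (is_derive_comp (fun s => f (upd b q s)) (tau r) (crd b p) (pd b f q) (ka r (crd b p))); [|apply tau_derive].
  replace (tau r (crd b p)) with (crd b q) by (destruct b; reflexivity). apply is_derive_pd_at; auto.
Qed.

Lemma cmp_BUC r f : 0 <= r -> cont f -> BUC (cmp r f).
Proof.
  intros Hr Hf. split.
  - intros e He. destruct (heine f (r + 1) e Hf He) as (d & Hd & H). exists (d / 2); split; [lra|].
    intros p q [H1 H2]. left. apply H; simpl; auto using tau_bound; (eapply Rle_lt_trans; [apply tau_lip | lra]).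
  - destruct (cont_bounded_box (r + 1) f Hf) as (B & HB & K). exists B. intros p. apply K; apply tau_bound; auto.
Qed.

Lemma ka_BUC r b : BUC (fun p => ka r (crd b p)).
Proof.
  split.
  - intros e He. exists e; split; auto. intros p q [H1 H2]. eapply Rle_trans; [apply ka_lip|]. destruct b; auto.
  - exists 1. intros p. destruct (ka_bound r (crd b p)). rewrite Rabs_pos_eq; lra.
Qed.

Lemma is_C1_pd f b : is_C1 f -> exd b f /\ cont (pd b f).
Proof.
  intros [H1 H2]. destruct b; split; intros p.
  - exact (proj1 (H1 p)).
  - exact (proj1 (H2 p)).
  - exact (proj2 (H1 p)).
  - exact (proj2 (H2 p)).
Qed.

(** [is_C1] speaks of the partial derivatives only; joint continuity of the function follows from
    their local boundedness. *)
Lemma C1_cont f : (forall b, exd b f) -> (forall b, cont (pd b f)) -> cont f.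
Proof.
  intros He Hc p. apply continuous_eps. intros e Hep.
  set (r := Rabs (fst p) + Rabs (snd p) + 1).
  destruct (cont_bounded_box r _ (Hc true)) as (B1 & P1 & K1), (cont_bounded_box r _ (Hc false)) as (B2 & P2 & K2).
  set (B := B1 + B2). exists (Rmin 1 (e / (2 * B))).
  assert (HB : 0 < B) by (unfold B; lra).
  split; [apply Rmin_pos; [lra | apply Rdiv_lt_0_compat; lra]|]. intros q H1 H2.
  assert (M1 := Rmin_l 1 (e / (2 * B))). assert (M2 := Rmin_r 1 (e / (2 * B))).
  assert (A1 := Rabs_pos (fst p)). assert (A2 := Rabs_pos (snd p)).
  assert (Y : forall a c x, Rabs (c - a) < 1 -> Rmin a c <= x <= Rmax a c -> Rabs x <= Rabs a + 1).
  { intros a c x Hac Hx. replace x with (a + (x - a)) by ring. eapply Rle_trans; [apply Rabs_triang|].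
    apply Rplus_le_compat_l. apply Rabs_lt_between in Hac. apply Rabs_le_between.
    unfold Rmin, Rmax in Hx. destruct Rle_dec; lra. }
  apply Rle_lt_trans with (B * dd1 p q).
  - apply lipschitz_box; auto. intros x X1 X2.
    assert (Z1 : Rabs (fst x) <= r) by (eapply Rle_trans; [apply (Y (fst p) (fst q)); auto; lra | unfold r; lra]).
    assert (Z2 : Rabs (snd x) <= r) by (eapply Rle_trans; [apply (Y (snd p) (snd q)); auto; lra | unfold r; lra]).
    intros []; [generalize (K1 x Z1 Z2) | generalize (K2 x Z1 Z2)]; unfold B; lra.
  - apply Rlt_le_trans with (B * (e / (2 * B) + e / (2 * B))); [|right; field; lra].
    apply Rmult_lt_compat_l; auto. unfold dd1. lra.
Qed.

Lemma gradient_UC f L : (forall b, exd b f) -> (forall b p, Rabs (pd b f p) <= L) -> UC f.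
Proof.
  intros He HL e Hep. assert (HL0 : 0 <= L) by (eapply Rle_trans; [apply Rabs_pos | apply (HL true (0, 0))]).
  exists (e / (2 * (L + 1))). split; [apply Rdiv_lt_0_compat; lra|]. intros p q [H1 H2].
  eapply Rle_trans; [apply (lipschitz f L); auto|].
  apply Rle_trans with ((L + 1) * (e / (2 * (L + 1)) + e / (2 * (L + 1)))); [|right; field; lra].
  apply Rmult_le_compat; try lra; [unfold dd1; apply Rplus_le_le_0_compat; apply Rabs_pos | unfold dd1; lra].
Qed.

(* With [m] the smallest leading minor of the defect, adding [Th] to the diagonal makes the defect positive
   definite on the whole plane without changing it on the domain. *)
Lemma bump m c La : 0 < c -> 0 <= La -> BUC m -> exists Th B,
  sm 2 Th /\ 0 <= B /\ (forall p, bdp 2 1 B Th p) /\ (forall p, 0 <= Th p) /\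
  (forall p, c <= m p -> Th p = 0) /\ (forall p, m p < c / 8 -> Th p = La).
Proof.
  intros Hc HLa Um.
  (* This falls from [La] to [0] while [m] rises from [c / 4] to [c / 2]. *)
  set (T0 := fun p => La * Rmax 0 (Rmin 1 (2 + - (4 / c) * m p))).
  assert (U0 : BUC T0).
  { apply BUC_scal. apply (BUC_lip (Rmax 0) (fun p => Rmin 1 (2 + - (4 / c) * m p)) 1); [lra | apply lip_max|].
    apply (BUC_lip (Rmin 1) (fun p => 2 + - (4 / c) * m p) 1); [lra | apply lip_min|]. auto using BUC_plus, BUC_scal, BUC_const. }
  assert (R0 : forall p, 0 <= T0 p <= La).
  { intros p. unfold T0. set (z := Rmax 0 _). assert (0 <= z <= 1) by (unfold z; split; [apply Rmax_l | apply Rmax_lub; [lra | apply Rmin_l]]).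
    split; [apply Rmult_le_pos; lra|]. rewrite <- (Rmult_1_r La) at 2. apply Rmult_le_compat_l; lra. }
  assert (Em : forall p, 4 / c * m p * c = 4 * m p) by (intros; field; lra).
  assert (Z0 : forall p, c / 2 <= m p -> T0 p = 0).
  { intros p Hp. unfold T0. rewrite Rmax_left; [ring|]. eapply Rle_trans; [apply Rmin_r|].
    apply (Rmult_le_reg_r c); auto. rewrite Rmult_plus_distr_r, Ropp_mult_distr_l_reverse. 
    rewrite Ropp_mult_distr_l_reverse, Em. lra. }
  assert (Z1 : forall p, m p <= c / 4 -> T0 p = La).
  { intros p Hp. unfold T0. rewrite Rmin_left, Rmax_right; try lra.
    apply (Rmult_le_reg_r c); auto. rewrite Rmult_plus_distr_r, Ropp_mult_distr_l_reverse.
    rewrite Ropp_mult_distr_l_reverse, Em. lra. }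
  (* Within the reach of the two means [m] varies by at most [c / 8], so smoothing keeps the exact
     values [0] where [c <= m] and [La] where [m < c / 8]. *)
  destruct (proj1 Um (c / 8)) as (d & Hd & HU); [lra|].
  set (h := d / 2). assert (Hh : 0 < h) by (unfold h; lra).
  assert (Eh : INR 2 * h = d) by (simpl; unfold h; field).
  assert (C0 := UC_cont _ (proj1 U0)).
  destruct (Bn_Sn 2 h T0 Hh (proj1 U0) (proj2 U0)) as [S (B & HB & KB)].
  assert (Sh : forall x e p, (forall q, box p (INR 2 * h) q -> Rabs (T0 q - x) <= e) -> Rabs (Sn 2 h T0 p - x) <= e).
  { intros x e p H. generalize (Sn_box 2 h (fun q => T0 q - x) p e Hh (cont_minus _ _ C0 (cont_const x)) H).
    rewrite Sn_minus, Sn_const; auto using cont_const. }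
  exists (Sn 2 h T0), B. split; auto. split; auto. split; auto. split; [|split].
  - intros p. assert (X : Rabs (Sn 2 h T0 p - La / 2) <= La / 2).
    { apply Sh. intros q _. specialize (R0 q). apply Rabs_le; lra. }
    apply Rabs_le_between in X. lra.
  - intros p Hp. assert (X : Rabs (Sn 2 h T0 p - 0) <= 0).
    { apply Sh. intros q Hq. rewrite Eh in Hq. specialize (HU p q Hq). apply Rabs_le_between in HU.
      rewrite Z0, Rminus_0_r, Rabs_R0; lra. }
    apply Rabs_le_between in X. lra.
  - intros p Hp. assert (X : Rabs (Sn 2 h T0 p - La) <= 0).
    { apply Sh. intros q Hq. rewrite Eh in Hq. specialize (HU p q Hq). apply Rabs_le_between in HU.
      rewrite Z1, Rminus_diag, Rabs_R0; lra. }
    apply Rabs_le_between in X. lra.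
Qed.

Lemma posdef2_minors a b c : posdef2 a b c -> 0 < Rmin a (a * c - b * b).
Proof.
  intros H. assert (Ha : 0 < a).
  { assert (X := H 1 0). assert (0 < a * 1 * 1 + 2 * b * 1 * 0 + c * 0 * 0) by (apply X; intros E; injection E; lra). lra. }
  apply Rmin_pos; auto.
  (* The test vector [(- b, a)] yields [a] times the determinant. *)
  assert (X : 0 < a * (- b) * (- b) + 2 * b * (- b) * a + c * a * a) by (apply H; intros E; injection E; lra).
  apply (Rmult_lt_reg_l a); auto. rewrite Rmult_0_r. replace (a * (a * c - b * b)) with (a * - b * - b + 2 * b * - b * a + c * a * a) by ring. auto.
Qed.

Lemma sqrt_small x e : 0 <= e -> x <= e ^ 2 -> sqrt x <= e.
Proof. intros He H. rewrite <- (sqrt_pow2 e) by auto. apply sqrt_le_1_alt; auto. Qed.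

Lemma sq_small x e : 0 <= e -> Rabs x <= e -> x ^ 2 <= e ^ 2.
Proof. intros He H. rewrite <- (pow2_abs x). apply pow_incr. split; auto using Rabs_pos. Qed.

Lemma exponent_bound : 1 - 1 / sqrt 5 <= 3 / 5.
Proof.
  assert (H5 : 0 < sqrt 5) by (apply sqrt_lt_R0; lra).
  assert (H : sqrt 5 <= 5 / 2) by (apply sqrt_small; simpl; lra).
  assert (2 / 5 <= 1 / sqrt 5); [|lra].
  apply (Rmult_le_reg_r (sqrt 5)); auto. unfold Rdiv at 2. rewrite Rmult_assoc, Rinv_l; lra.
Qed.

Theorem theorem1p1
  (omega : pt -> Prop) (beta : R)
  (v1 v2 v3 w1 w2 A11 A12 A22 : pt -> R) :
  is_domain omega -> bounded_set omega -> 0 < beta ->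
  is_C1 v1 -> is_C1 v2 -> is_C1 v3 -> is_C1 w1 -> is_C1 w2 ->
  is_C0a beta A11 -> is_C0a beta A12 -> is_C0a beta A22 ->
  (forall p, closure2 omega p ->
     posdef2 (A11 p - E11 v1 v2 v3 w1 w2 p)
             (A12 p - E12 v1 v2 v3 w1 w2 p)
             (A22 p - E22 v1 v2 v3 w1 w2 p)) ->
  forall alpha eps : R,
    0 < alpha -> alpha < Rmin (beta / 2) (1 - 1 / sqrt 5) -> 0 < eps ->
    exists tv1 tv2 tv3 tw1 tw2 : pt -> R,
      is_C1a alpha tv1 /\ is_C1a alpha tv2 /\ is_C1a alpha tv3 /\
      is_C1a alpha tw1 /\ is_C1a alpha tw2 /\
      (forall p, closure2 omega p ->
         sqrt ((tv1 p - v1 p)^2 + (tv2 p - v2 p)^2 + (tv3 p - v3 p)^2) <= eps) /\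
      (forall p, closure2 omega p ->
         sqrt ((tw1 p - w1 p)^2 + (tw2 p - w2 p)^2) <= eps) /\
      (forall p, closure2 omega p ->
         A11 p - E11 tv1 tv2 tv3 tw1 tw2 p = 0 /\
         A12 p - E12 tv1 tv2 tv3 tw1 tw2 p = 0 /\
         A22 p - E22 tv1 tv2 tv3 tw1 tw2 p = 0).
Proof.
  intros _ [M HM] Hbeta C1 C2 C3 C4 C5 HA11 HA12 HA22 Hpos alpha eps Hal Hal2 Heps.
  set (v := fun j => match j with j1 => v1 | j2 => v2 | j3 => v3 end).
  set (w := fun b : bool => if b then w1 else w2).
  set (A := fun a b : bool => if a then (if b then A11 else A12) else (if b then A12 else A22)).
  assert (EE_E : forall u1 u2 u3 z1 z2 p,
    let u := fun j => match j with j1 => u1 | j2 => u2 | j3 => u3 end in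
    let z := fun b : bool => if b then z1 else z2 in
    E11 u1 u2 u3 z1 z2 p = EE u z true true p /\ E12 u1 u2 u3 z1 z2 p = EE u z true false p /\
    E22 u1 u2 u3 z1 z2 p = EE u z false false p).
  { intros. unfold E11, E12, E22, gram, EE, sum3, u, z.
    change Defs.d1 with (pd true). change Defs.d2 with (pd false). repeat split; field. }
  set (r := Rabs M + 1). assert (Hr : 0 <= r) by (unfold r; assert (X := Rabs_pos M); lra).
  assert (HK : forall p, closure2 omega p -> Rabs (fst p) <= r /\ Rabs (snd p) <= r).
  { intros p Kp. destruct (Kp 1 Rlt_0_1) as (q & Oq & Dq). destruct (HM q Oq) as [Q1 Q2]. destruct (dist2_ge p q) as [D1 D2].
    assert (X := Rle_abs M). unfold r.
    split; [replace (fst p) with (fst q + (fst p - fst q)) by ring | replace (snd p) with (snd q + (snd p - snd q)) by ring];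
      (eapply Rle_trans; [apply Rabs_triang | lra]). }
  assert (Hv : forall j b, exd b (v j) /\ cont (pd b (v j))) by (intros [] b; apply is_C1_pd; auto).
  assert (Hw : forall j b, exd b (w j) /\ cont (pd b (w j))) by (intros [] b; apply is_C1_pd; auto).
  assert (HA : forall a b, is_C0a beta (A a b)) by (intros [] []; auto).
  assert (UA : forall a b, BUC (A a b)) by (intros; apply (holder_BUC beta); auto).
  assert (SA : forall a b p, A a b p = A b a p) by (intros [] [] p; auto).
  set (vt := fun j => cmp r (v j)). set (wt := fun b => cmp r (w b)).
  assert (Uv : forall j, BUC (vt j)) by (intros j; apply cmp_BUC; auto; apply C1_cont; intros b; apply Hv).
  assert (Uw : forall j, BUC (wt j)) by (intros j; apply cmp_BUC; auto; apply C1_cont; intros b; apply Hw).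
  assert (Uv' : forall j b, exd b (vt j) /\ BUC (pd b (vt j))).
  { intros j b. destruct (cmp_pd r (v j) b (proj1 (Hv j b))) as [E P]. split; auto. unfold vt. rewrite P.
    apply BUC_mult; [apply ka_BUC | apply cmp_BUC; auto; apply Hv]. }
  assert (Uw' : forall j b, exd b (wt j) /\ BUC (pd b (wt j))).
  { intros j b. destruct (cmp_pd r (w j) b (proj1 (Hw j b))) as [E P]. split; auto. unfold wt. rewrite P.
    apply BUC_mult; [apply ka_BUC | apply cmp_BUC; auto; apply Hw]. }
  assert (EEin : forall p, closure2 omega p -> forall a b, EE vt wt a b p = EE v w a b p).
  { intros p Kp a b. destruct (HK p Kp) as [K1 K2].
    assert (Dv : forall j c, pd c (vt j) p = pd c (v j) p).
    { intros j c. unfold vt. rewrite (proj2 (cmp_pd r (v j) c (proj1 (Hv j c)))), ka_in, cmp_in; auto; [ring | destruct c; auto]. }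
    assert (Dw : forall j c, pd c (wt j) p = pd c (w j) p).
    { intros j c. unfold wt. rewrite (proj2 (cmp_pd r (w j) c (proj1 (Hw j c)))), ka_in, cmp_in; auto; [ring | destruct c; auto]. }
    unfold EE, sum3. rewrite !Dv, !Dw. auto. }
  set (D := fun a b p => A a b p - EE vt wt a b p).
  assert (UD : forall a b, BUC (D a b)).
  { intros a b. apply BUC_minus; auto. apply BUC_EE; intros; [apply Uv' | apply Uw']. }
  set (m := fun p => Rmin (D true true p) (D true true p * D false false p - D true false p * D true false p)).
  assert (Um : BUC m) by (apply BUC_min; auto; apply BUC_minus; apply BUC_mult; auto).
  destruct (closure_inf omega r m) as (c & Hc & Hcm); auto.
  { apply UC_cont, Um. }
  { intros p Kp. unfold m, D. rewrite !EEin by auto. destruct (EE_E v1 v2 v3 w1 w2 p) as (X1 & X2 & X3).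
    assert (X := posdef2_minors _ _ _ (Hpos p Kp)). rewrite X1, X2, X3 in X. exact X. }
  assert (HB : exists B, 1 <= B /\ forall a b p, Rabs (D a b p) <= B).
  { destruct (bounded_pos _ (proj2 (UD true true))) as (B1 & P1 & K1), (bounded_pos _ (proj2 (UD true false))) as (B2 & P2 & K2),
      (bounded_pos _ (proj2 (UD false true))) as (B3 & P3 & K3), (bounded_pos _ (proj2 (UD false false))) as (B4 & P4 & K4).
    exists (1 + B1 + B2 + B3 + B4); split; [lra|].
    intros [] [] p; [specialize (K1 p) | specialize (K2 p) | specialize (K3 p) | specialize (K4 p)]; lra. }
  destruct HB as (B & HB & KB).
  (* Where the bump is full, the diagonal entries are at least [B + 1] and the other ones at most
     [B] in absolute value, so the determinant is at least [2 B + 1]. *)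
  destruct (bump m c (2 * B + 1)) as (Th & BT & STh & HBT & KTh & Th0 & ThK & ThB); auto; [lra|].
  assert (Ec : forall d, exd d Th) by (intros; apply (sm_exd 1); auto).
  assert (UTh : BUC Th).
  { split.
    - apply (gradient_UC Th BT); auto. intros b p. generalize (proj1 (bdp_2 1 BT Th p (KTh p)) b). lra.
    - exists BT. intros p. apply (bdp_abs 2 1), KTh. }
  set (A' := fun a b p => A a b p + (if Bool.eqb a b then Th p else 0)).
  assert (UI : forall a b, BUC (fun p => if Bool.eqb a b then Th p else 0)) by (intros [] []; simpl; auto using BUC_const).
  assert (UA' : forall a b, BUC (A' a b)) by (intros; apply BUC_plus; auto).
  assert (SA' : forall a b p, A' a b p = A' b a p) by (intros a b p; unfold A'; rewrite (SA a b); destruct a, b; auto).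
  set (c1 := Rmin (c / 8) 1). assert (Hc1 : 0 < c1) by (apply Rmin_pos; lra).
  assert (Hc2 : c1 <= c / 8) by apply Rmin_l. assert (Hc3 : c1 <= 1) by apply Rmin_r.
  assert (Hlow : forall p, c1 <= A' true true p - EE vt wt true true p /\
    c1 <= (A' true true p - EE vt wt true true p) * (A' false false p - EE vt wt false false p)
        - (A' true false p - EE vt wt true false p) * (A' true false p - EE vt wt true false p)).
  { intros p.
    replace (A' true true p - EE vt wt true true p) with (D true true p + Th p) by (unfold A', D; simpl; ring).
    replace (A' false false p - EE vt wt false false p) with (D false false p + Th p) by (unfold A', D; simpl; ring).
    replace (A' true false p - EE vt wt true false p) with (D true false p) by (unfold A', D; simpl; ring).
    specialize (Th0 p). destruct (Rlt_le_dec (m p) (c / 8)) as [Hm|Hm].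
    - rewrite (ThB p Hm). assert (K1 := KB true true p). assert (K2 := KB false false p). assert (K3 := KB true false p).
      apply Rabs_le_between in K1. apply Rabs_le_between in K2.
      split; [lra|].
      assert (X1 : (B + 1) * (B + 1) <= (D true true p + (2 * B + 1)) * (D false false p + (2 * B + 1))) by (apply Rmult_le_compat; lra).
      assert (X2 : D true false p * D true false p <= B * B).
      { rewrite <- (Rabs_pos_eq (D true false p * D true false p)) by (apply Rle_0_sqr). apply abs_mult_le; auto. }
      lra.
    - assert (M1 := Rmin_l (D true true p) (D true true p * D false false p - D true false p * D true false p)).
      assert (M2 := Rmin_r (D true true p) (D true true p * D false false p - D true false p * D true false p)). fold (m p) in M1, M2.
      split; [lra|].
      assert (HD22 : 0 < D false false p).
      { apply (Rmult_lt_reg_l (D true true p)); [lra|]. rewrite Rmult_0_r. assert (X := Rle_0_sqr (D true false p)). unfold Rsqr in X. lra. }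
      assert (0 <= Th p * (D true true p + D false false p)) by (apply Rmult_le_pos; lra).
      assert (0 <= Th p * Th p) by (apply Rmult_le_pos; lra). lra. }
  (* [2 b <= beta] makes the smoothing error of [A] at most a constant times [l ^ (2 b)] for
     [l <= 1], and [alpha < b] because [1 - 1 / sqrt 5 <= 3 / 5]. *)
  set (b := Rmin (beta / 2) (3 / 5)).
  assert (Hb1 : b <= beta / 2) by apply Rmin_l. assert (Hb2 : b <= 3 / 5) by apply Rmin_r.
  assert (Hab : alpha < b).
  { apply Rmin_glb_lt; [eapply Rlt_le_trans; [exact Hal2 | apply Rmin_l]|].
    eapply Rlt_le_trans; [exact Hal2|]. eapply Rle_trans; [apply Rmin_r | apply exponent_bound]. }
  assert (HCA : exists CA, 0 <= CA /\ forall l, 0 < l <= 1 -> forall a d p,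
     Rabs (Sn 12 l (A' a d) p - A' a d p) <= CA * Rpower l (2 * b)).
  { assert (X : exists MA, 0 <= MA /\ forall a d l p q, 0 < l -> box p l q -> Rabs (A a d q - A a d p) <= MA * Rpower (2 * l) beta).
    { destruct HA11 as [_ [Ma Ha]], HA12 as [_ [Mb Hb]], HA22 as [_ [Mc Hc']].
      assert (P1 := Rabs_pos Ma). assert (P2 := Rabs_pos Mb). assert (P3 := Rabs_pos Mc).
      exists (Rabs Ma + Rabs Mb + Rabs Mc). split; [lra|].
      intros a d l p q Hl Hq. assert (P0 : 0 <= Rpower (2 * l) beta) by (left; apply exp_pos).
      destruct a, d; unfold A.
      - eapply Rle_trans; [exact (holder_box beta A11 Ma Hbeta Ha l p q Hl Hq)|]. apply Rmult_le_compat_r; lra.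
      - eapply Rle_trans; [exact (holder_box beta A12 Mb Hbeta Hb l p q Hl Hq)|]. apply Rmult_le_compat_r; lra.
      - eapply Rle_trans; [exact (holder_box beta A12 Mb Hbeta Hb l p q Hl Hq)|]. apply Rmult_le_compat_r; lra.
      - eapply Rle_trans; [exact (holder_box beta A22 Mc Hbeta Hc' l p q Hl Hq)|]. apply Rmult_le_compat_r; lra. }
    destruct X as (MA & HMA & KMA). exists (MA * Rpower 24 beta + 12 * (4 * BT)).
    assert (P24 : 0 <= MA * Rpower 24 beta) by (apply Rmult_le_pos; auto; left; apply exp_pos).
    split; [lra|]. intros l Hl a d p.
    assert (E2 : forall x, 2 * b <= x -> Rpower l x <= Rpower l (2 * b)) by (intros; apply Rpower_anti; auto; lra).
    unfold A'. rewrite Sn_plus; [|lra|apply UC_cont, UA|apply UC_cont, UI].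
    match goal with |- Rabs (?x + ?y - (?z + ?t)) <= _ => replace (x + y - (z + t)) with ((x - z) + (y - t)) by ring end.
    rewrite Rmult_plus_distr_r. apply abs_plus_le.
    - apply Sn_near; [lra | apply UC_cont, UA |]. intros q Hq.
      eapply Rle_trans; [apply (KMA a d (INR 12 * l)); auto; simpl; lra|].
      replace (2 * (INR 12 * l)) with (24 * l) by (simpl; ring).
      rewrite <- Rpower_mult_distr by lra. rewrite Rmult_assoc. apply Rmult_le_compat_l; auto.
      apply Rmult_le_compat_l; [left; apply exp_pos | apply E2; lra].
    - assert (P0 : 0 <= 12 * (4 * BT) * Rpower l (2 * b)) by (apply Rmult_le_pos; [lra | left; apply exp_pos]).
      destruct (Bool.eqb a d).
      + eapply Rle_trans; [apply (Sn_second 12 l Th BT); auto; [lra|]|].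
        { intros x y z. generalize (proj2 (bdp_2 1 BT Th z (KTh z)) x y). lra. }
        replace (INR 12 * (4 * BT * l ^ 2)) with (12 * (4 * BT) * l ^ 2) by (simpl; ring).
        apply Rmult_le_compat_l; [lra|]. rewrite <- Rpower_pow by lra. apply E2. simpl; lra.
      + rewrite Sn_const by lra. rewrite Rminus_diag, Rabs_R0. auto. }
  destruct HCA as (CA & HCA & KCA).
  destruct (initial vt wt A' c1) as (V0 & d0 & HV0 & Hd0 & Hinit); auto; try (intros p; apply Hlow).
  destruct (iteration b alpha A' CA V0 d0) with (eps := eps / 4) as (eta & Heta & Hit); auto; try lra.
  { intros a d. apply UC_cont, UA'. }
  destruct (Hinit (Rmin eta (eps / 4))) as (v0 & w0 & B0 & HB0 & I1 & I2 & I3 & I4 & I5 & I6 & I7 & I8); [apply Rmin_pos; lra|].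
  destruct (Hit v0 w0 B0) as (tv & tw & T1 & T2 & T3 & T4 & T5); auto.
  { intros a d p. eapply Rle_trans; [apply I6 | apply Rmin_l]. }
  (* Each component moves by at most [eps / 4] in [initial] and [eps / 4] in [iteration]; three
     squares of [eps / 2] still sum to less than [eps ^ 2]. *)
  assert (Cv : forall p, closure2 omega p -> forall j, Rabs (tv j p - v j p) <= eps / 2).
  { intros p Kp j. destruct (HK p Kp) as [K1 K2].
    replace (tv j p - v j p) with ((tv j p - v0 j p) + (v0 j p - vt j p)) by (unfold vt; rewrite cmp_in by auto; ring).
    replace (eps / 2) with (eps / 4 + eps / 4) by field. apply abs_plus_le; auto. eapply Rle_trans; [apply I7 | apply Rmin_r]. }
  assert (Cw : forall p, closure2 omega p -> forall j, Rabs (tw j p - w j p) <= eps / 2).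
  { intros p Kp j. destruct (HK p Kp) as [K1 K2].
    replace (tw j p - w j p) with ((tw j p - w0 j p) + (w0 j p - wt j p)) by (unfold wt; rewrite cmp_in by auto; ring).
    replace (eps / 2) with (eps / 4 + eps / 4) by field. apply abs_plus_le; auto. eapply Rle_trans; [apply I8 | apply Rmin_r]. }
  exists (tv j1), (tv j2), (tv j3), (tw true), (tw false).
  do 5 (split; auto). assert (He2 : 0 <= eps / 2) by lra.
  split; [|split]; intros p Kp.
  - assert (X1 := sq_small _ _ He2 (Cv p Kp j1)). assert (X2 := sq_small _ _ He2 (Cv p Kp j2)). assert (X3 := sq_small _ _ He2 (Cv p Kp j3)).
    apply sqrt_small; [lra|]. change (v j1) with v1 in X1. change (v j2) with v2 in X2. change (v j3) with v3 in X3.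
    replace ((eps / 2) ^ 2) with (eps ^ 2 / 4) in * by field. assert (0 <= eps ^ 2) by apply pow2_ge_0. lra.
  - assert (X1 := sq_small _ _ He2 (Cw p Kp true)). assert (X2 := sq_small _ _ He2 (Cw p Kp false)).
    apply sqrt_small; [lra|]. change (w true) with w1 in X1. change (w false) with w2 in X2.
    replace ((eps / 2) ^ 2) with (eps ^ 2 / 4) in * by field. assert (0 <= eps ^ 2) by apply pow2_ge_0. lra.
  - destruct (EE_E (tv j1) (tv j2) (tv j3) (tw true) (tw false) p) as (X1 & X2 & X3). rewrite X1, X2, X3.
    assert (Y : forall a d, EE (fun j => match j with j1 => tv j1 | j2 => tv j2 | j3 => tv j3 end)
        (fun b : bool => if b then tw true else tw false) a d p = A a d p).
    { intros a d. transitivity (EE tv tw a d p).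
      - unfold EE, sum3. destruct a, d; reflexivity.
      (* On the closure [c <= m], so [Th] vanishes and the equation solved for [A'] is the one for
         [A]. *)
      - rewrite T5. unfold A'. rewrite ThK by (apply Hcm; auto). destruct (Bool.eqb a d); ring. }
    rewrite !Y. unfold A. repeat split; ring.
Qed.
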